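(* Let $\lambda=(\lambda_1>\dots>\lambda_r>0)$ be a strict partition of length $r$ and let $r'$ be the smallest even integer with $r'\ge r$. Then $$GQ_\lambda(x)=\mathrm{Pf}(\rho_{i,j})_{1\le i<j\le r'},$$ where $$\rho_{i,j}=\begin{cases}\displaystyle\sum_{k=0}^\infty\sum_{l=0}^\infty\beta^{k+l}\binom{i+1-r'}{k}\binom{j-r'}{l}\,GQ_{(\lambda_i+k,\lambda_j+l)}(x), & j\ne r+1,\\[8pt]\displaystyle\sum_{k=0}^\infty\beta^k\binom{i+1-r'}{k}\,GQ_{\lambda_i+k}(x), & j=r+1.\end{cases}$$
   Context: **$K$-theoretic $Q$-functions.** $\beta$ is an indeterminate. Let $x\oplus y=x+y+\beta xy$, $x\ominus y=\frac{x-y}{1+\beta y}$, $[[x]]^a=(2+\beta x)x^a$ for $a\ge1$, $[[x]]^0=1$. For a strict partition $\lambda=(\lambda_1>\dots>\lambda_r>0)$ and $n\ge r$, $$GQ_\lambda(x_1,\dots,x_n)=\frac1{(n-r)!}\sum_{w\in S_n}w\left[[[x_1]]^{\lambda_1}\cdots[[x_r]]^{\lambda_r}\prod_{i=1}^r\prod_{j=i+1}^n\frac{x_i\oplus x_j}{x_i\ominus x_j}\right],$$ where $S_n$ permutes the variables, and $GQ_\lambda(x)=GQ_\lambda(x_1,x_2,\dots)$ is the limit $n\to\infty$. One-row functions $GQ_n(x)=GQ_{(n)}(x)$ are extended to all $n\in\mathbb Z$ by $$GQ(z)=\sum_{n\in\mathbb Z}GQ_n(x)z^n=\frac1{1+\beta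 z^{-1}}\prod_{i\ge1}\frac{1+(z+\beta)x_i}{1+(z+\beta)\overline{x_i}},\qquad\overline x=\frac{-x}{1+\beta x},$$ with $(1+\beta z^{-1})^{-1}=1-\beta z^{-1}+\beta^2z^{-2}-\cdots$. **Two-index functions.** For arbitrary integers $a,b>0$ (not necessarily $a>b$), $GQ_{(a,b)}(x)$ denotes the coefficient of $z_1^az_2^b$ in $\Phi(z_1,z_2)=\langle0|e^{\mathcal H^{(\beta)}}\phi^{(\beta)}(z_1)e^\Theta\phi^{(\beta)}(z_2)e^\Theta|0\rangle$ with $p_n=p_n(x)=\sum_ix_i^n$. For $a>b$ this is the $K$-theoretic $Q$-function of the strict partition $(a,b)$. The notation is as follows. $k=\mathbb Q(\beta)$. (In the formula of the claim $k,l$ are summation indices.) $\mathcal A$ is the unital $k$-algebra generated by $\phi_n$ ($n\in\mathbb Z$) with $\phi_m\phi_n+\phi_n\phi_m=2(-1)^m\delta_{m+n,0}$; $\mathcal F=\mathcal A|0\rangle$ with $\phi_{-n}|0\rangle=0$ ($n>0$) and basis $\phi_{n_1}\cdots\phi_{n_s}|0\rangle$ ($n_1>\dots>n_s\ge0$); $\mathcal E=\langle0|\mathcal A$ with $\langle0|\phi_n=0$ ($n>0$) and basis $\langle0|\phi_{m_1}\cdots\phi_{m_s}$ ($0\ge m_1>\dots>m_s$); the pairing $\mathcal E\otimes\mathcal F\to k$ is determined by $\langle0|0\rangle=1$, $(\langle w|X)|v\rangle=\langle w|(X|v\rangle)$ for $X\in\mathcal A$, $\langle0|\phi_0|0\rangle=0$.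 For odd $m$, $b_m=\frac14\sum_i(-1)^i\phi_{-i-m}\phi_i$. $\phi^{(\beta)}_n$ is defined by $\sum_{n\ge0}\phi^{(\beta)}_nz^n=\sum_{n\ge0}\phi_n(z+\frac\beta2)^n$, $\sum_{n>0}\phi^{(\beta)}_{-n}z^{-n}=\sum_{n>0}\phi_{-n}\left(\frac{z^{-1}}{1+\frac\beta2z^{-1}}\right)^n$, and $\phi^{(\beta)}(z)=\sum_{n\in\mathbb Z}\phi^{(\beta)}_nz^n$. For $m\ge1$, $b_m^{(\beta)}$ is $\frac{(X-\frac\beta2)^m-(-X-\frac\beta2)^m}2$ with $X^l\mapsto b_l$; $\mathcal H^{(\beta)}=2\sum_{n\ge1}\frac{p_n}nb_n^{(\beta)}$; $\Theta=2\sum_{n=1,3,5,\dots}\left(\frac\beta2\right)^n\frac{b_{-n}}n$. All operators act successively from the right on $\mathcal E$, starting from $\langle0|$, and the result is paired with $|0\rangle$. **Conventions.** $\binom{a}{k}=\frac{a(a-1)\cdots(a-k+1)}{k!}$ for $a\in\mathbb Z$. Infinite sums are taken in the ring of symmetric formal power series in $x_1,x_2,\dots$ (convergence with respect to the degree in the $x_i$). $\mathrm{Pf}(a_{i,j})_{1\le i<j\le 2s}=\sum_\sigma\mathrm{sgn}(\sigma)a_{\sigma(1),\sigma(2)}\cdots a_{\sigma(2s-1),\sigma(2s)}$, summed over $\sigma\in S_{2s}$ with $\sigma(1)<\sigma(3)<\dots<\sigma(2s-1)$ and $\sigma(2i-1)<\sigma(2i)$ for all $i$. *)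

(* Defs.v *)
From HB Require Import structures.
From mathcomp Require Import all_boot all_order all_algebra all_fingroup.
From mathcomp Require Import finmap multiset.
From mathcomp Require Import freeg mpoly.
From mathcomp Require Import mathcomp_extra boolp classical_sets functions.
From mathcomp Require Import cardinality fsbigop.
From mathcomp Require Import ring.

Set Implicit Arguments.
Unset Strict Implicit.
Unset Printing Implicit Defensive.

Import Order.TTheory GRing.Theory Num.Theory.

Local Open Scope classical_set_scope.
Local Open Scope ring_scope.

(* All locally finite sums below are finitely supported sums                  *)
(* \sum_(i \in A) F i of fsbigop, whose value is 0 if infinitely many terms   *)
(* are nonzero.                                                               *)

Definition K : fieldType := {fraction {poly rat}}.

Definition beta : K := tofrac 'X.

(* Monomials in x_1, x_2, ... are finite multisets of natural numbers: x_i is *)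
(* the singleton {i - 1}.  A series is the function giving its coefficients.  *)
Notation monom := {mset nat}%mset.

Definition series : Type := monom -> K^o.

HB.instance Definition _ := GRing.Lmodule.copy series (monom -> K^o).

(* Cauchy product of a scalar series with a series with coefficients in V.    *)
Definition conv (V : lmodType K) (f : series) (g : monom -> V) : monom -> V :=
  fun m => \sum_(q \in [set q : monom * monom | (q.1 `+` q.2)%mset = m])
    f q.1 *: g q.2.

Definition series_mul (f g : series) : series := conv f (g : monom -> K^o).

Definition series_one : series := fun m => (m == mset0)%:R.

Section SeriesRing.

Definition subm (m : monom) : set monom := [set d | (d `<=` m)%mset].

Lemma finite_subm m : finite_set (subm m).
Proof.
rewrite -(seq_mset_id m); elim: (enum_mset m) => [|a s IHs].
  apply: (sub_finite_set _ (finite_set1 (mset0 : monom))) => d /= /msubsetP h.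
  apply/msetP => x; have := h x.
  by rewrite mset_seqE leqn0 => /eqP ->; rewrite mset0E.
rewrite mset_cons.
have fU := finite_image (fun d : monom => (a +` d)%mset) IHs.
have : finite_set (subm (seq_mset s) `|`
   [set (a +` d)%mset | d in subm (seq_mset s)]) by rewrite finite_setU.
apply: sub_finite_set => d /= /msubsetP h.
have [ad|ad] := boolP (a \in d).
  right; exists (d `\ a)%mset; last by rewrite msetB1K.
  apply/msubsetP => x; have := h x; rewrite mset1DE msetB1E.
  by rewrite leq_subLR.
left; apply/msubsetP => x; have := h x; rewrite mset1DE.
case: (x =P a) => [->|_]; last by rewrite add0n.
by move: ad; rewrite -mset_eq0 => /eqP ->.
Qed.

Lemma convE (V : lmodType K) (f : series) (g : monom -> V) (M m : monom) :
  (m `<=` M)%mset ->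
  conv f g m = \sum_(a <- fset_set (subm M)) \sum_(b <- fset_set (subm M))
    (if (a `+` b)%mset == m then f a *: g b else 0).
Proof.
move=> mM; pose B := subm M; have fB : finite_set B by exact: finite_subm.
pose D := [set q : monom * monom | (q.1 `+` q.2)%mset = m].
have DB : D = (B `*` B) `&` D.
  apply/seteqP; split=> [[a b] /= abm|[a b] [] //]; split=> //.
  move: abm; rewrite /D /= => abm.
  split; apply/msubsetP => x; have /msubsetP/(_ x) := mM;
    by rewrite -abm msetE2 => /(leq_trans _); apply; rewrite ?leq_addr ?leq_addl.
rewrite /conv -/D DB fsbig_mkcondr.
transitivity (\sum_(a \in B) \sum_(b \in B)
    (if (a `+` b)%mset == m then f a *: g b else 0)).
  rewrite pair_fsbig//; apply: eq_fsbigr => -[a b] _ /=.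
  by have -> : ((a, b) \in D) = ((a `+` b)%mset == m)
    by apply/idP/eqP; rewrite inE.
by rewrite fsbig_finite//; apply: eq_bigr => a _; rewrite fsbig_finite.
Qed.

Lemma series_mulE (f g : series) (M m : monom) : (m `<=` M)%mset ->
  series_mul f g m =
  \sum_(a <- fset_set (subm M)) \sum_(b <- fset_set (subm M))
    (if (a `+` b)%mset == m then f a * g b else 0) :> K.
Proof. exact: (@convE K^o). Qed.

Lemma mem_subm (m M : monom) : (m \in fset_set (subm M)) = (m `<=` M)%mset.
Proof.
rewrite in_fset_set; last exact: finite_subm.
by apply/idP/idP; rewrite inE.
Qed.

Lemma sum_subm1 (M m : monom) (F : monom -> K) :
  \sum_(a <- fset_set (subm M)) (if m == a then F a else 0) =
  if (m `<=` M)%mset then F m else 0.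
Proof.
rewrite -big_mkcond -mem_subm; have [mM|mM] := boolP (_ \in _).
  rewrite (big_rem m)//= eqxx big_seq_cond big1 ?addr0// => a.
  by rewrite mem_rem_uniq ?fset_uniq// inE => /andP[/andP[+ _] /eqP mE];
    rewrite mE eqxx.
rewrite big_seq_cond big1// => a /andP[aM /eqP mE].
by rewrite mE aM in mM.
Qed.

Lemma series_mulC : commutative series_mul.
Proof.
move=> f g; apply/funext => m; rewrite !(series_mulE _ _ (msubset_refl m)).
rewrite exchange_big; apply: eq_bigr => a _; apply: eq_bigr => b _ /=.
by rewrite msetDC mulrC.
Qed.

Lemma series_mul1 : left_id series_one series_mul.
Proof.
move=> f; apply/funext => m; rewrite !(series_mulE _ _ (msubset_refl m)).
transitivity (\sum_(a <- fset_set (subm m))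
    (if mset0 == a then \sum_(b <- fset_set (subm m))
      (if m == b then f b else 0) else 0) : K).
  apply: eq_bigr => a _; have [<-|a0] := eqVneq mset0 a.
    by apply: eq_bigr => b _; rewrite mset0D /series_one eqxx mul1r eq_sym.
  by rewrite big1// => b _; rewrite /series_one [a == _]eq_sym (negPf a0) mul0r if_same.
by rewrite (sum_subm1 _ _ (fun=> _)) msub0set sum_subm1 msubset_refl.
Qed.

Lemma series_mulDl : left_distributive series_mul +%R.
Proof.
move=> f g h; apply/funext => m; rewrite [RHS]/GRing.add /=.
rewrite !(series_mulE _ _ (msubset_refl m)) -big_split; apply: eq_bigr => a _.
rewrite -big_split; apply: eq_bigr => b _ /=.
by case: ifP => _; rewrite ?addr0// mulrDl.
Qed.

Lemma series_mulA : associative series_mul.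
Proof.
move=> f g h; apply/funext => m.
have sub1 (a b : monom) : (a `<=` a `+` b)%mset.
  by apply/msubsetP => x; rewrite msetE2 leq_addr.
have sub2 (a b : monom) : (b `<=` a `+` b)%mset.
  by apply/msubsetP => x; rewrite msetE2 leq_addl.
pose S := fset_set (subm m).
transitivity (\sum_(a <- S) \sum_(b <- S) \sum_(c <- S)
  (if (a `+` (b `+` c))%mset == m then f a * (g b * h c) else 0) : K).
  rewrite (series_mulE _ _ (msubset_refl m)); apply: eq_bigr => a _.
  transitivity (\sum_(e <- S) \sum_(b <- S) \sum_(c <- S)
    (if (b `+` c)%mset == e then
       (if (a `+` e)%mset == m then f a * (g b * h c) else 0) else 0) : K).
    rewrite !big_seq; apply: eq_bigr => e; rewrite mem_subm => em.
    rewrite (series_mulE _ _ em); have [_|ne] := eqVneq; last first.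
      by rewrite big1// => b _; rewrite big1// => c _; rewrite if_same.
    rewrite mulr_sumr; apply: eq_bigr => b _.
    rewrite mulr_sumr; apply: eq_bigr => c _.
    by case: ifP => _; rewrite ?mulr0.
  rewrite exchange_big; apply: eq_bigr => b _.
  rewrite exchange_big; apply: eq_bigr => c _ /=.
  rewrite sum_subm1; case: eqP => [<-|_]; last by rewrite if_same.
  by rewrite sub2.
rewrite (series_mulE _ _ (msubset_refl m)).
transitivity (\sum_(e <- S) \sum_(c <- S) \sum_(a <- S) \sum_(b <- S)
    (if (a `+` b)%mset == e then
       (if (e `+` c)%mset == m then f a * (g b * h c) else 0) else 0) : K);
    last first.
  rewrite !big_seq; apply: eq_bigr => e; rewrite mem_subm => em.
  apply: eq_bigr => c _.
  rewrite (series_mulE _ _ em); have [_|ne] := eqVneq; last first.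
    by rewrite big1// => a _; rewrite big1// => b _; rewrite if_same.
  rewrite mulr_suml; apply: eq_bigr => a _.
  rewrite mulr_suml; apply: eq_bigr => b _.
  by case: ifP => _; rewrite ?mul0r// mulrA.
rewrite [RHS]exchange_big.
under [RHS]eq_bigr => c _.
  rewrite exchange_big; under eq_bigr => a _.
    rewrite exchange_big; under eq_bigr => b _.
      rewrite sum_subm1.
      have -> : (if (a `+` b `<=` m)%mset then
          if (a `+` b `+` c)%mset == m then f a * (g b * h c) else 0 else 0) =
         (if (a `+` (b `+` c))%mset == m then f a * (g b * h c) else 0 : K).
        rewrite msetDA; case: eqP => [<-|_]; last by rewrite if_same.
        by rewrite sub1.
      over.
    over.
  over.
rewrite [RHS]exchange_big; apply: eq_bigr => a _ /=.
by rewrite exchange_big.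
Qed.

Lemma series_one_neq0 : series_one != 0.
Proof.
apply/eqP => /(congr1 (@^~ mset0)); rewrite /series_one eqxx /=.
by move/eqP; rewrite oner_eq0.
Qed.

End SeriesRing.

HB.instance Definition _ := GRing.Zmodule_isComNzRing.Build series
  series_mulA series_mulC series_mul1 series_mulDl series_one_neq0.

Definition psum (p : nat) : series :=
  fun m => \sum_(i \in [set: nat]) ((m == msetn p i)%:R : K).

Definition ssum (F : nat -> series) : series :=
  fun m => \sum_(k \in [set: nat]) F k m.

(* The right A-module E = <0|A, given on its basis: for a finite set          *)
(* S = {s_1 < ... < s_t} of natural numbers, <<S>> is                         *)
(* <0| phi_{-s_1} ... phi_{-s_t}, and phi n w is the vector w phi_n.  The     *)
(* formula comes from anticommuting phi_n to its place in the product; the    *)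
(* lemmas below show that it defines a right action of A.                     *)
Definition fockE : Type := {freeg {fset nat} / K}.

HB.instance Definition _ := GRing.Lmodule.on fockE.

Definition vac : fockE := << fset0 >>.

Definition above (n : nat) (S : {fset nat}) : nat :=
  \sum_(s <- S) (n < s)%N.

Definition phi_basis (n : int) (S : {fset nat}) : fockE :=
  let p := `|n|%N in
  let e : K := (-1) ^+ above p S in
  if (0 < n)%R then
    if p \in S then (2 * (-1) ^+ p * e) *: << S `\ p >>%fset else 0
  else if p \notin S then e *: << p |` S >>%fset
  else if p == 0%N then e *: << S `\ p >>%fset else 0.

Definition phi (n : int) : fockE -> fockE := fglift (phi_basis n).

(* w |-> <w|0>, the coefficient of <0|: the other basis vectors end with      *)
(* phi_{-s}, where s > 0, or are equal to <0| phi_0.                          *)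
Definition vev (w : fockE) : K := coeff fset0 w.

Section FockLemmas.

Lemma fglift_linear (A : choiceType) (V : lmodType K) (f : A -> V) :
  linear (fglift f : {freeg A / K} -> V).
Proof.
have addf : {morph (fglift f : {freeg A / K} -> V) : x y / x - y >-> x - y}.
  exact: lift_is_additive.
pose g := GRing.isAdditive.Build _ _ _ addf.
pose h : {additive {freeg A / K} -> V} := HB.pack (fglift f) g.
have sumf (T : Type) (r : seq T) (F : T -> {freeg A / K}) :
    fglift f (\sum_(i <- r) F i) = \sum_(i <- r) fglift f (F i).
  exact: (raddf_sum h).
move=> a u v; transitivity (h (a *: u) + h v); first exact: (raddfD h).
congr (_ + _); change (fglift f (fgscale a u) = a *: fglift f u).
rewrite /fgscale sumf -[X in _ = _ *: fglift f X](freeg_sumE u) sumf.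
by rewrite scaler_sumr; apply: eq_bigr => x _; rewrite !liftU scalerA.
Qed.

Lemma phi_linear n : linear (phi n).
Proof. exact: fglift_linear. Qed.

HB.instance Definition _ n :=
  GRing.isLinear.Build K fockE fockE _ (phi n) (phi_linear n).

Lemma vev_linear : linear (vev : fockE -> K^o).
Proof. exact: (@fglift_linear _ K^o). Qed.

Lemma phiU n S : phi n << S >> = phi_basis n S.
Proof. by rewrite /phi liftU scale1r. Qed.

Let toggle (p : nat) (S : {fset nat}) : {fset nat} :=
  if p \in S then (S `\ p)%fset else (p |` S)%fset.

Let c (n : int) (b : bool) : K :=
  if b then (if (0 < n)%R then 2 * (-1) ^+ `|n|%N else (n == 0)%:R)
  else (~~ (0 < n)%R)%:R.

Let phi_basisE n S : phi_basis n S =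
  (c n (`|n|%N \in S) * (-1) ^+ above `|n| S) *: << toggle `|n|%N S >>.
Proof.
rewrite /phi_basis /toggle /c; case: (_ \in S); case: ifP => //=.
- by rewrite absz_eq0; case: ifP; rewrite ?mul1r// mul0r scale0r.
- by rewrite mul0r scale0r.
- by rewrite mul1r.
Qed.

Let in_toggle p q S : (q \in toggle p S) = (q == p) (+) (q \in S).
Proof.
rewrite /toggle; case: ifP => pS; rewrite !inE; case: eqP => [->|]//=;
  by rewrite pS.
Qed.

Let toggleC p q S : toggle p (toggle q S) = toggle q (toggle p S).
Proof. by apply/fsetP => x; rewrite !in_toggle addbCA. Qed.

Let toggleK p S : toggle p (toggle p S) = S.
Proof. by apply/fsetP => x; rewrite !in_toggle addbA addbb. Qed.

Let above_toggle p q S :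
  (-1) ^+ above q (toggle p S) = (-1) ^+ (q < p)%N * (-1) ^+ above q S :> K.
Proof.
rewrite /above /toggle; case: ifP => pS.
  by rewrite [in RHS](big_fsetD1 p)//= exprD mulrA -signr_addb addbb mul1r.
by rewrite big_fsetU1 ?pS// exprD.
Qed.

Lemma phi_clifford (m n : int) (w : fockE) :
  phi n (phi m w) + phi m (phi n w) =
  (if m + n == 0 then 2 * (-1) ^ m else 0) *: w.
Proof.
rewrite -[w]freeg_sumE !linear_sum -big_split /=.
apply: eq_bigr => S _.
have -> : << coeff S w *g S >> = coeff S w *: (<< S >> : fockE).
  apply/eqP/freeg_eqP => T; rewrite coeffZ !coeffU.
  by rewrite mul1r.
move: (coeff S w) => a; rewrite !linearZ /= !phiU !phi_basisE !linearZ /=.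
rewrite !phiU !phi_basisE !in_toggle !above_toggle.
have swap x (v : fockE) : x *: (a *: v) = a *: (x *: v).
  by rewrite !scalerA mulrC.
rewrite !swap -scalerDr; congr (_ *: _).
rewrite !scalerA; have [pq|pq] := eqVneq `|m|%N `|n|%N; last first.
  rewrite toggleC -scalerDl.
  have /negPf mn : m + n != 0.
    by apply: contra_neq pq => /eqP; rewrite addr_eq0 => /eqP ->; rewrite abszN.
  have /negPf qp : `|n|%N != `|m|%N by rewrite eq_sym.
  rewrite mn !scale0r addFb.
  set x := c _ _; set y := c _ _; set u := _ ^+ above _ _.
  set v := _ ^+ above _ _.
  rewrite [X in X *: _](_ : _ = 0) ?scale0r//.
  case: (ltngtP `|m|%N `|n|%N) pq => //= _ _; rewrite expr0 expr1; ring.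
rewrite -!pq !toggleK ltnn /= expr0 mul1r -scalerDl; congr (_ *: _).
set e := (-1) ^+ above _ _.
have e2 : e * e = 1 by rewrite -expr2 sqrr_sign.
transitivity (c m (`|m|%N \in S) * c n (~~ (`|m|%N \in S)) +
  c n (`|m|%N \in S) * c m (~~ (`|m|%N \in S))).
  rewrite -[RHS]mulr1 -e2; ring.
clear e e2; move: (_ \in S) pq => b; rewrite /c.
case: m n => [[|p]|p] [[|q]|q] //= pq.
- by rewrite expr0z; case: b; ring.
- by case: b; rewrite ?mulr0 ?mul0r addr0.
- case: pq => ->; rewrite NegzE subrr eqxx exprnP.
  by case: b; rewrite ?mulr0 ?mul0r ?mulr1 ?mul1r ?addr0 ?add0r.
- case: pq => ->; rewrite NegzE addNr eqxx -exprnN -exprVn invrN1.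
  by case: b; rewrite ?mulr0 ?mul0r ?mulr1 ?mul1r ?addr0 ?add0r.
- by case: b; rewrite ?mulr0 ?mul0r addr0.
Qed.

Lemma vac_phi (n : int) : (0 < n)%R -> phi n vac = 0.
Proof. by rewrite phiU /phi_basis => ->; rewrite in_fset0. Qed.

Lemma fockE_basis (s : seq nat) : sorted ltn s ->
  foldl (fun w p => phi (- p%:Z) w) vac s = << [fset p in s]%fset >>.
Proof.
elim/last_ind: s => [|s p IHs].
  by move=> _ /=; rewrite /vac; do 3 f_equal; apply/fsetP => x; rewrite !inE.
rewrite (sorted_pairwise ltn_trans) pairwise_rcons => /andP[/allP sp srt].
rewrite foldl_rcons {}IHs ?(sorted_pairwise ltn_trans)// phiU /phi_basis abszN.
have ps : p \notin s by apply/negP => /sp /=; rewrite ltnn.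
rewrite oppr_gt0 ltz_nat ltn0 !inE ps.
have -> : above p [fset q in s]%fset = 0%N.
  rewrite /above big_seq big1// => q; rewrite !inE => /sp /=.
  by rewrite ltnNge => /negPf; rewrite ltn_neqAle => -> ; rewrite andbF.
rewrite expr0 scale1r; do 3 f_equal.
by apply/fsetP => x; rewrite !inE mem_rcons inE.
Qed.

Lemma vev_vac : vev vac = 1.
Proof. by rewrite /vev coeffU eqxx mulr1. Qed.

Let fsetU1_eq0 (p : nat) (S : {fset nat}) : (p |` S == fset0)%fset = false.
Proof. by apply/negbTE/fset0Pn; exists p; rewrite !inE eqxx. Qed.

Lemma vev_phi0 : vev (phi 0 vac) = 0.
Proof.
rewrite phiU /phi_basis ltxx in_fset0 /= /vev coeffZ coeffU.
by rewrite fsetU1_eq0 !mulr0.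
Qed.

Lemma vev_phiN (n : int) (w : fockE) : (n < 0)%R -> vev (phi n w) = 0.
Proof.
move=> n0; rewrite -[w]freeg_sumE linear_sum /vev raddf_sum big1// => S _.
rewrite /= /phi liftU !coeffZ /phi_basis ltNge (ltW n0) /=.
case: ifP => _; last first.
  by rewrite absz_eq0 (lt_eqF n0) coeff0 mulr0.
by rewrite coeffZ coeffU fsetU1_eq0 !mulr0.
Qed.

End FockLemmas.

(* bos m w is w b_m, used for odd m only, and bosb m w is w b_m^(beta).        *)
Definition bos (m : int) (w : fockE) : fockE :=
  4^-1 *: \sum_(i \in [set: int]) ((-1) ^ i *: phi i (phi (- i - m) w)).

(* phib n w is w phi^(beta)_n.  The coefficient of u^q in                     *)
(* (u / (1 + (beta/2) u))^p is 'C(q - 1, p - 1) (- beta/2)^(q - p).           *)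
Definition phib (n : int) (w : fockE) : fockE :=
  match n with
  | Posz p => \sum_(m \in [set: nat])
      ((('X + (beta / 2)%:P) ^+ m)`_p *: phi m w)
  | Negz q' => let q := q'.+1 in \sum_(1 <= p < q.+1)
      ('C(q.-1, p.-1)%:R * (- (beta / 2)) ^+ (q - p) *: phi (- p%:Z) w)
  end.

Definition bos_poly (m : nat) : {poly K} :=
  2^-1 *: (('X - (beta / 2)%:P) ^+ m - (- 'X - (beta / 2)%:P) ^+ m).

Definition bosb (m : nat) (w : fockE) : fockE :=
  \sum_(l < size (bos_poly m)) (bos_poly m)`_l *: bos l w.

Definition Theta (w : fockE) : fockE :=
  2 *: \sum_(n \in [set n : nat | odd n])
    ((beta / 2) ^+ n / n%:R) *: bos (- n%:Z) w.

Definition exp_Theta (w : fockE) : fockE :=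
  \sum_(j \in [set: nat]) (j`!%:R)^-1 *: iter j Theta w.

(* Vectors of E with coefficients in the ring of series are functions         *)
(* monom -> fockE.                                                            *)
Definition Hbeta (W : monom -> fockE) : monom -> fockE :=
  fun m => 2 *: \sum_(n \in [set n : nat | (0 < n)%N])
    (n%:R)^-1 *: conv (psum n) (fun m' => bosb n (W m')) m.

Definition exp_H (W : monom -> fockE) : monom -> fockE :=
  fun m => \sum_(j \in [set: nat]) (j`!%:R)^-1 *: iter j Hbeta W m.

Definition vacs : monom -> fockE := fun m => if m == mset0 then vac else 0.

(* The coefficient of z_1^a z_2^b in Phi(z_1, z_2).                           *)
Definition Phi_coef (a b : int) : series :=
  fun m => vev (exp_Theta (phib b (exp_Theta (phib a (exp_H vacs m))))).

Definition GQ2 (a b : nat) : series := Phi_coef a b.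

Definition oplus (F : fieldType) (be x y : F) : F := x + y + be * x * y.

Definition ominus (F : fieldType) (be x y : F) : F := (x - y) / (1 + be * y).

Definition bpow (F : fieldType) (be x : F) (a : nat) : F :=
  if a == 0%N then 1 else (2 + be * x) * x ^+ a.

Definition GQ_term (F : fieldType) (be : F) (lambda : seq nat) (n : nat)
    (x : 'I_n -> F) : F :=
  (\prod_(i < n | (i < size lambda)%N) bpow be (x i) (nth 0%N lambda i)) *
  \prod_(i < n | (i < size lambda)%N) \prod_(j < n | (i < j)%N)
    (oplus be (x i) (x j) / ominus be (x i) (x j)).

Definition GQ_frac (lambda : seq nat) (n : nat) : {fraction {mpoly K[n]}} :=
  ((n - size lambda)`!%:R)^-1 *
  \sum_(w : 'S_n)
    GQ_term (tofrac (beta%:MP)) lambda (fun i => tofrac 'X_(w i)).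

(* GQ_frac lambda n is a polynomial when size lambda <= n.                    *)
Definition GQ_fin (lambda : seq nat) (n : nat) : {mpoly K[n]} :=
  xget 0 [set P : {mpoly K[n]} | tofrac P = GQ_frac lambda n].

Definition series_of_mpoly (n : nat) (P : {mpoly K[n]}) : series :=
  fun m => if all (fun i => i < n)%N (enum_mset m)
           then P@_[multinom m i | i < n] else 0.

Definition series_lim (u : nat -> series) (f : series) : Prop :=
  forall m : monom, exists N : nat, forall n : nat, (N <= n)%N -> u n m = f m.

Definition GQ (lambda : seq nat) : series :=
  xget 0 [set f | series_lim (fun n => series_of_mpoly (GQ_fin lambda n)) f].

Definition strict_partition (lambda : seq nat) : bool :=
  sorted gtn lambda && (0%N \notin lambda).

Definition binz (a : int) (k : nat) : K :=
  (\prod_(t < k) (a - t%:Z)%:~R) / k`!%:R.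

Lemma Pf_snd N (i : 'I_N./2) : (i.*2.+1 < N)%N.
Proof.
apply: leq_trans (_ : (N./2).*2 <= N)%N; first by rewrite -doubleS leq_double.
by rewrite -[leqRHS]odd_double_half leq_addl.
Qed.

Lemma Pf_fst N (i : 'I_N./2) : (i.*2 < N)%N.
Proof. exact: ltnW (Pf_snd i). Qed.

(* Meant for even N only.                                                     *)
Definition Pf (R : comNzRingType) (N : nat) (a : 'I_N -> 'I_N -> R) : R :=
  let fst i := Ordinal (Pf_fst i) in
  let snd i := Ordinal (Pf_snd i) in
  \sum_(w : 'S_N |
      [forall i : 'I_N./2, forall j : 'I_N./2,
        (i < j)%N ==> (w (fst i) < w (fst j))%N] &&
      [forall i : 'I_N./2, (w (fst i) < w (snd i))%N])
    (-1) ^+ w * \prod_(i < N./2) a (w (fst i)) (w (snd i)).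

Definition even_ceil (r : nat) : nat := (uphalf r).*2.

Lemma even_ceilP (r : nat) :
  [/\ ~~ odd (even_ceil r), (r <= even_ceil r)%N
    & forall t, ~~ odd t -> (r <= t)%N -> (even_ceil r <= t)%N].
Proof.
rewrite /even_ceil odd_double -leq_uphalf_double; split=> // t /even_halfK <-.
by rewrite -leq_uphalf_double leq_double.
Qed.

(* The indices i and j start from 1.                                          *)
Definition rho (lambda : seq nat) (i j : nat) : series :=
  let r := size lambda in
  let r' := (even_ceil r)%:Z in
  let li := nth 0%N lambda i.-1 in
  let lj := nth 0%N lambda j.-1 in
  if j != r.+1 then
    ssum (fun k => ssum (fun l =>
      (beta ^+ (k + l) * binz (i%:Z + 1 - r') k * binz (j%:Z - r') l) *:
        GQ2 (li + k) (lj + l)))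
  else
    ssum (fun k => (beta ^+ k * binz (i%:Z + 1 - r') k) *: GQ [:: (li + k)%N]).

(* Main.v *)
(* Write u_i = 1 + beta x_i, A(x, y) = (y - x) / (x (+) y), and let c_i be    *)
(* the product of (x_i (+) x_j) / (x_i (-) x_j) over j <> i.  In n variables  *)
(* the symmetrization defining GQ_lambda collapses to the sum over            *)
(* f : [r] -> [n] of the products over k of                                   *)
(* c_(f k) [[x_(f k)]]^lambda_k u_(f k)^(k - r) and over k < l of             *)
(* A(x_(f k), x_(f l)).  On the fermionic side, e^H acts on the two-point     *)
(* function as multiplication by G(z_1) G(z_2), where G has partial fractions *)
(* with residues c_i (2 + beta x_i) u_i, while e^Theta is encoded by a first  *)
(* order recurrence in each index; hence GQ_(a,b) is the sum over i, j of     *)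
(* c_i c_j [[x_i]]^a [[x_j]]^b u_i^-1 A(x_i, x_j).  The binomial sums in      *)
(* rho_(i,j) multiply this by the missing powers of u_i and u_j.  Since       *)
(* A(x, y) = (s' - s) / (s' + s) for s = beta x / (2 + beta x), the           *)
(* multilinear expansion of Pf(rho) is a sum of Schur Pfaffians, which are    *)
(* the products of the A(x_(f k), x_(f l)).                                   *)

From HB Require Import structures.
Require Import Defs.
From mathcomp Require Import all_boot all_order all_algebra all_fingroup.
From mathcomp Require Import finmap multiset.
From mathcomp Require Import freeg mpoly.
From mathcomp Require Import boolp classical_sets functions.
From mathcomp Require Import cardinality fsbigop.
From mathcomp Require Import zify ring.

Set Implicit Arguments.
Unset Strict Implicit.
Unset Printing Implicit Defensive.

Import Order.TTheory GRing.Theory Num.Theory.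

Local Open Scope classical_set_scope.
Local Open Scope ring_scope.


(** * Degrees in the Fock module *)

(** Series are compared after setting all but n variables to 0 ([res]) and passing to [Fr], the
    fraction field of the ring of series, which is an integral domain by [series_idomain]. The
    restrictions for all large n determine a series, and [GQ_eq] turns this into a criterion for a
    series to be [GQ lambda]. Below, u_i = 1 + beta x_i, c_i is [cfact] and A is [akl].

    Symmetrization. Permutations with the same restriction f to the first r places contribute
    equally, which cancels (n - r)!. The factors of row k that are missing from the full product
    c_(f k) are those of the earlier places l < k, and their inverses are A(x_(f l), x_(f k)) / u_(f
    l). As A(x, x) = 0, the sum may run over all maps f ([symmetrize]).

    Two-index functions. Weights make every sum of operators finite on a given vector. By [phi_bos]
    the bosons multiply phi(z) by powers of z, and by [bos_comm] they form a Heisenberg algebra.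
    Hence e^H multiplies the vacuum two-point function by G(z_1) G(z_2) ([corr_exp_H]): both sides
    satisfy the same Euler equation in the x_i. Moving e^Theta past a fermion costs z / (z + beta)
    ([exp_Theta_phib_rel]). With the recurrence [tau0_rel] of the two-point function without
    e^Theta, this determines [tau3]. In n variables G is a constant plus simple fractions with poles
    at 1 / x_i ([tofrac_res_Gcoef]), so its coefficients evaluate the generating series of [tau3] at
    the x_i ([tau_sum]). In the sum over the second pole the unwanted part is the value of the
    partial fraction at the inverse of x_i for the formal group law, which is 0 ([ysum_row]). This
    gives [tofrac_res_Phi_coef].

    Pfaffian. The binomial sums in [rho] are negative powers of u_i and u_j, so each entry is a
    double sum of weights times a kernel ([tofrac_res_rho]). In the coordinate s = beta x / (2 +
    beta x) this is the kernel of Schur's Pfaffian; when r is odd, the column r + 1 is the extra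
    node s = -1, whose kernel with the node of x_i is u_i. [Pf_sum] expands the Pfaffian
    multilinearly, [Pf_schur] evaluates each term, and [Pf_weight] recognizes the symmetrized
    sum. *)

Lemma fsbig_nat (V : zmodType) (F : nat -> V) N :
  (forall k, (N <= k)%N -> F k = 0) ->
  \sum_(k \in [set: nat]) F k = \sum_(k < N) F k.
Proof.
move=> F0; rewrite -(big_mkord xpredT).
rewrite (fsbigE (iota 0 N)) ?iota_uniq//; last first.
  by move=> i _; rewrite mem_iota add0n => /= iN; apply: F0; lia.
by rewrite /index_iota subn0; apply: eq_bigl => i; by rewrite in_setT.
Qed.

Lemma fsbig_int (V : zmodType) (F : int -> V) (M N : nat) :
  (forall i : int, i < - M%:Z -> F i = 0) ->
  (forall i : int, N%:Z - M%:Z <= i -> F i = 0) ->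
  \sum_(i \in [set: int]) F i = \sum_(k < N) F (k%:Z - M%:Z).
Proof.
move=> F1 F2; rewrite -(big_mkord xpredT (fun k => F (k%:Z - M%:Z))).
rewrite (fsbigE ([seq k%:Z - M%:Z | k <- iota 0 N])) //.
- rewrite big_map /index_iota subn0; apply: eq_bigl => i; by rewrite in_setT.
- by rewrite map_inj_uniq ?iota_uniq// => a b; lia.
- move=> i _ /= /negP ni; have [iM|iM] := ltP i (- M%:Z); first exact: F1.
  have [iN|iN] := leP (N%:Z - M%:Z) i; first exact: F2.
  case: ni; apply/mapP; exists (absz (i + M%:Z)); first by rewrite mem_iota; lia.
  by lia.
Qed.

Definition wt (S : {fset nat}) : nat := \sum_(s <- S) s.

(** The weight filtration. Since [phi n] lowers the bound by n, it kills every vector of weight at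
    most d < n; this cuts all infinite sums of operators to finite ones. The bound is an integer
    because a negative one forces w = 0. *)
Definition dle (d : int) (w : fockE) : bool :=
  all (fun S => (wt S)%:Z <= d) (dom w).

Lemma dleP d w :
  reflect (forall S, coeff S w != 0 -> (wt S)%:Z <= d) (dle d w).
Proof.
apply: (iffP allP) => h S; first by rewrite -mem_dom; apply: h.
by rewrite mem_dom; apply: h.
Qed.

Lemma dle0 d : dle d 0.
Proof. by apply/dleP => S; rewrite coeff0 eqxx. Qed.

Lemma dleD d v w : dle d v -> dle d w -> dle d (v + w).
Proof.
move=> /dleP hv /dleP hw; apply/dleP => S; rewrite coeffD => h; have [v0|/hv//] := eqVneq (coeff S v) 0.
by apply: hw; rewrite v0 add0r in h.
Qed.

Lemma dleZ d a w : dle d w -> dle d (a *: w).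
Proof.
by move=> /dleP hw; apply/dleP => S; rewrite coeffZ mulf_eq0 negb_or => /andP[_]; apply: hw.
Qed.

Lemma dle_sum d (I : Type) (r : seq I) (P : pred I) (F : I -> fockE) :
  (forall i, P i -> dle d (F i)) -> dle d (\sum_(i <- r | P i) F i).
Proof.
by move=> h; elim/big_rec: _ => [|i x Pi]; [exact: dle0|apply/dleD/h].
Qed.

Lemma dleW d d' w : dle d w -> d <= d' -> dle d' w.
Proof. by move=> /dleP h dd'; apply/dleP => S /h; lia. Qed.

Lemma dle_lt0 d w : d < 0 -> dle d w -> w = 0.
Proof.
move=> d0 /dleP h; apply/eqP/freeg_eqP => S; rewrite coeff0.
by apply/eqP/negPn/negP => /h; lia.
Qed.

Lemma fock_sumE (w : fockE) : w = \sum_(S <- dom w) coeff S w *: << S >>.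
Proof.
rewrite -[LHS]freeg_sumE; apply: eq_bigr => S _.
by apply/eqP/freeg_eqP => T; rewrite coeffZ !coeffU mul1r.
Qed.

Lemma dleU S : dle (wt S)%:Z << S >>.
Proof.
apply/dleP => T; rewrite coeffU mul1r; case: (S =P T) => [->//|_].
by rewrite eqxx.
Qed.

Lemma dle_exists w : exists d : nat, dle d%:Z w.
Proof.
exists (\max_(S <- dom w) wt S)%N; apply/dleP => S Sw; rewrite lez_nat.
by apply: leq_bigmax_seq => //; rewrite mem_dom.
Qed.

Lemma dle_phi_basis n S : dle ((wt S)%:Z - n) (phi_basis n S).
Proof.
rewrite /phi_basis; case: ifP => n0; case: ifP => nS; last first.
- case: ifP => [/eqP p0|_]; last exact: dle0.
  apply: dleZ; apply: dleW (dleU _) _; move/negbFE: nS => nS.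
  by rewrite /wt (big_fsetD1 _ nS) /=; lia.
- apply: dleZ; apply: dleW (dleU _) _; rewrite /wt big_fsetU1//= PoszD.
  by lia.
- exact: dle0.
- apply: dleZ; apply: dleW (dleU _) _; rewrite /wt (big_fsetD1 _ nS) /= PoszD.
  by lia.
Qed.

Lemma dle_phi d n w : dle d w -> dle (d - n) (phi n w).
Proof.
move=> /dleP h; rewrite (fock_sumE w) linear_sum big_seq.
apply: dle_sum => S; rewrite mem_dom linearZ /= => /h hS.
rewrite phiU; apply: dleZ; apply: dleW (dle_phi_basis n S) _; lia.
Qed.

Lemma phi_gt d n w : dle d w -> d < n -> phi n w = 0.
Proof. by move=> h dn; apply: (dle_lt0 _ (dle_phi n h)); lia. Qed.

Lemma dle_vac : dle 0 vac.
Proof. by apply: dleW (dleU _) _; rewrite /wt big_seq_fset0. Qed.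

Lemma phi_anticomm (m n : int) (w : fockE) : m + n != 0 ->
  phi n (phi m w) = - phi m (phi n w).
Proof.
move=> mn; apply/eqP; rewrite -addr_eq0 phi_clifford (negPf mn) scale0r.
by [].
Qed.

Definition oddz (m : int) : bool := odd `|m|%N.

Lemma signzN (n : int) : (-1 : K) ^ (- n) = (-1) ^ n.
Proof. by rewrite -exprz_inv invrN1. Qed.

Lemma signzD (m n : int) : (-1 : K) ^ (m + n) = (-1) ^ m * (-1) ^ n.
Proof. by rewrite expfzDr// oppr_eq0 oner_eq0. Qed.

Lemma signz_odd (m : int) : oddz m -> (-1 : K) ^ m = -1.
Proof.
rewrite /oddz; case: m => m /= mo; first by rewrite -exprnP -signr_odd mo.
by rewrite NegzE signzN -exprnP -signr_odd /= mo.
Qed.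

Lemma oddz_neq0 m : oddz m -> m != 0.
Proof. by rewrite /oddz; case: m => [[|]|]. Qed.

(** Outside the window one of the two fermions kills w: on the left the one applied first, on the
    right the other one after anticommutation, which produces no scalar since m is not 0. *)
Lemma bosE d m w (M N : nat) : oddz m -> dle d w ->
  d + m <= M%:Z -> d < N%:Z - M%:Z ->
  bos m w = 4^-1 *: \sum_(k < N) ((-1) ^ (k%:Z - M%:Z) *:
     phi (k%:Z - M%:Z) (phi (M%:Z - k%:Z - m) w)).
Proof.
move=> mo h dM dN; rewrite /bos (@fsbig_int _ _ M N).
- congr (_ *: _); apply: eq_bigr => k _; congr (_ *: phi _ (phi _ _)); lia.
- by move=> i iM; rewrite (phi_gt h) ?linear0 ?scaler0//; lia.
- move=> i iM; have m0 := oddz_neq0 mo.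
  rewrite phi_anticomm ?(phi_gt h (n := i)) ?linear0 ?oppr0 ?scaler0//; lia.
Qed.

(** * Commutation relations of the bosons *)

Lemma sqr_signz (n : int) : ((-1 : K) ^ n) ^+ 2 = 1.
Proof. by rewrite expr2 -{2}signzN -signzD addrN expr0z. Qed.

Lemma natK_eq0 n : (n%:R == 0 :> K) = (n == 0)%N.
Proof. by rewrite -(rmorph_nat (@tofrac {poly rat})) tofrac_eq0 -polyC_natr polyC_eq0 pnatr_eq0. Qed.

Lemma linP (V W : lmodType K) (f : V -> W) : linear f ->
  exists g : {linear V -> W}, f = g.
Proof.
move=> lf; pose m := GRing.isLinear.Build K V W *:%R f lf.
by exists (HB.pack f m : {linear V -> W}).
Qed.

Lemma lin_sum (V W : lmodType K) (f : V -> W) : linear f ->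
  forall (I : Type) (r : seq I) (P : pred I) (F : I -> V),
  f (\sum_(i <- r | P i) F i) = \sum_(i <- r | P i) f (F i).
Proof. by case/linP => g -> *; exact: linear_sum. Qed.

Lemma lin0 (V W : lmodType K) (f : V -> W) : linear f -> f 0 = 0.
Proof. by case/linP => g ->; exact: linear0. Qed.

Lemma linD (V W : lmodType K) (f : V -> W) : linear f ->
  forall u v, f (u + v) = f u + f v.
Proof. by case/linP => g -> u v; exact: linearD. Qed.

Lemma linB (V W : lmodType K) (f : V -> W) : linear f ->
  forall u v, f (u - v) = f u - f v.
Proof. by case/linP => g -> u v; exact: linearB. Qed.

Lemma linZ (V W : lmodType K) (f : V -> W) : linear f ->
  forall a u, f (a *: u) = a *: f u.
Proof. by case/linP => g -> a u; exact: linearZ_LR. Qed.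

(** One threshold serves two vectors and every larger window, so that the sums for both can be
    compared term by term. *)
Lemma bosE_exists (w1 w2 : fockE) (m : int) : oddz m ->
  exists A : nat, forall M N : nat, (A <= M)%N -> A%:Z <= N%:Z - M%:Z ->
   (bos m w1 = 4^-1 *: \sum_(k < N) ((-1) ^ (k%:Z - M%:Z) *:
     phi (k%:Z - M%:Z) (phi (M%:Z - k%:Z - m) w1)) /\
   bos m w2 = 4^-1 *: \sum_(k < N) ((-1) ^ (k%:Z - M%:Z) *:
     phi (k%:Z - M%:Z) (phi (M%:Z - k%:Z - m) w2))).
Proof.
move=> mo; have [d1 h1] := dle_exists w1; have [d2 h2] := dle_exists w2.
exists (d1 + d2 + `|m| + 1)%N => M N AM AN.
by split; [apply: bosE mo h1 _ _|apply: bosE mo h2 _ _]; lia.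
Qed.

Lemma bos_linear m : oddz m -> linear (bos m).
Proof.
move=> mo a u v; have [A1 h1] := bosE_exists u v mo.
have [A2 h2] := bosE_exists (a *: u + v) v mo.
have [] := h1 (A1 + A2)%N (A1 + A2 + (A1 + A2))%N; try lia.
have [] := h2 (A1 + A2)%N (A1 + A2 + (A1 + A2))%N; try lia.
move=> -> _ -> ->; rewrite scalerA mulrC -scalerA -scalerDr; congr (_ *: _).
rewrite scaler_sumr -big_split; apply: eq_bigr => k _ /=.
by rewrite !linearP /= !scalerA mulrC.
Qed.

Lemma dle_bos d m w : oddz m -> dle d w -> dle (d + m) (bos m w).
Proof.
move=> mo h; have [A hA] := bosE_exists w w mo.
have [||-> _] := hA A (A + A)%N; try lia.
apply: dleZ; apply: dle_sum => k _; apply: dleZ.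
by apply: dleW (dle_phi _ (dle_phi _ h)) _; lia.
Qed.

Lemma sum_int_delta (V : zmodType) (c : int) (M N : nat) (F : int -> V) :
  - M%:Z <= c -> c < N%:Z - M%:Z ->
  \sum_(k < N) (if k%:Z - M%:Z == c then F (k%:Z - M%:Z) else 0) = F c.
Proof.
move=> cM cN; have kN : (absz (c + M%:Z)%R < N)%N by lia.
rewrite (bigD1 (Ordinal kN))//= big1 ?addr0.
  have -> : (absz (c + M%:Z)%R)%:Z - M%:Z = c by lia.
  by rewrite eqxx.
move=> k kk; case: eqP => // kc; case/negP: kk; apply/eqP/val_inj => /=; lia.
Qed.

Lemma phi_phi (n i : int) (w : fockE) : phi n (phi i w) =
  (if i == - n then 2 * (-1) ^ i else 0) *: w - phi i (phi n w).
Proof. by apply/eqP; rewrite -subr_eq opprK phi_clifford addr_eq0. Qed.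

(** [phi n] is contracted once with each of the two fermions of b_m, at i = - n and at i = n - m. As
    m is odd, both contractions give 2 phi_(n-m), and the factor 1/4 leaves exactly one
    phi_(n-m). *)
Lemma phi_bos n m w : oddz m ->
  phi n (bos m w) = bos m (phi n w) + phi (n - m) w.
Proof.
move=> mo; have [A hA] := bosE_exists w (phi n w) mo.
(* The window has to contain the two contraction indices as well. *)
pose M := (A + `|n| + `|m| + 1)%N.
have [||-> ->] := hA M (M + M)%N; try lia.
rewrite linearZ linear_sum /=.
transitivity (4^-1 *: (\sum_(k < M + M) (-1) ^ (k%:Z - M%:Z) *:
     phi (k%:Z - M%:Z) (phi (M%:Z - k%:Z - m) (phi n w)) +
   (\sum_(k < M + M) (if k%:Z - M%:Z == - n then 2 *: phi (n - m) w else 0) +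
    \sum_(k < M + M) (if k%:Z - M%:Z == n - m then 2 *: phi (n - m) w else 0)))).
  congr (_ *: _); rewrite -!big_split; apply: eq_bigr => k _ /=.
  set i := k%:Z - M%:Z; have -> : M%:Z - k%:Z - m = - i - m by lia.
  clearbody i.
  rewrite linearZ /= phi_phi [phi n (phi (- i - m) w)]phi_phi.
  rewrite (linB (@phi_linear i)) (linZ (@phi_linear i)) opprB addrCA.
  rewrite 2!scalerDr scalerN !scalerA; congr (_ + (_ + _)).
    have [->|_] := eqVneq i (- n); last by rewrite mulr0 scale0r.
    by rewrite mulrCA -expr2 sqr_signz mulr1 opprK.
  have -> : (- i - m == - n) = (i == n - m) by lia.
  have [->|_] := eqVneq i (n - m); last by rewrite mulr0 scale0r oppr0.
  have -> : - (n - m) - m = - n by lia.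
  rewrite -scaleNr; congr (_ *: _); rewrite signzN mulrCA signzD signzN (signz_odd mo).
  by rewrite mulrN1 mulNr -expr2 sqr_signz mulrN mulr1 opprK.
rewrite (sum_int_delta (fun=> _)) ?(sum_int_delta (fun=> _)); try lia.
rewrite scalerDr; congr (_ + _); rewrite -scalerDl scalerA.
by rewrite [_ * _](_ : _ = 1) ?scale1r//; field; rewrite !natK_eq0.
Qed.

(** Telescoping with a nonzero limit on the right: the differences do not cancel to 0 but leave m
    copies of c. This is the origin of the central term in [bos_comm]. *)
Lemma sum_shift_diff (V : zmodType) (G : int -> V) (c : V) (A M N : nat)
  (m : int) :
  (forall i : int, i <= - A%:Z -> G i = 0) ->
  (forall i : int, A%:Z <= i -> G i = c) ->
  (A + `|m| <= M)%N -> A%:Z + `|m|%:Z < N%:Z - M%:Z ->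
  \sum_(k < N) (G (k%:Z - M%:Z) - G (k%:Z - M%:Z - m)) = c *~ m.
Proof.
move=> G0 Gc.
have step (s : int) : A%:Z <= M%:Z + s -> A%:Z < N%:Z - M%:Z - s ->
    \sum_(k < N) (G (k%:Z - M%:Z - s) - G (k%:Z - M%:Z - s - 1)) = c.
  move=> s1 s2; rewrite -(big_mkord xpredT
    (fun k => G (k%:Z - M%:Z - s) - G (k%:Z - M%:Z - s - 1))).
  transitivity (\sum_(0 <= k < N)
    (G (k.+1%:Z - M%:Z - s - 1) - G (k%:Z - M%:Z - s - 1))).
    by apply: eq_bigr => k _; congr (G _ - _); lia.
  rewrite (telescope_sumr (fun k => G (k%:Z - M%:Z - s - 1)))//.
  by rewrite Gc ?G0 ?subr0//; lia.
case: m => p; elim: p => [|p IH] mM mN.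
- by rewrite big1 ?mulr0z// => k _; rewrite subr0 subrr.
- rewrite -addn1 PoszD mulrzDr mulr1z -IH; try lia.
  rewrite -[X in _ = _ + X](step p); try lia.
  rewrite -big_split; apply: eq_bigr => k _ /=.
  by rewrite addrA subrK; congr (_ - G _); lia.
- rewrite NegzE mulrNz mulr1z -(step (-1)); try lia.
  rewrite -sumrN; apply: eq_bigr => k _; rewrite opprB; congr (G _ - G _); lia.
have -> : Negz p.+1 = Negz p - 1 by lia.
rewrite mulrzBr mulr1z -IH; try lia.
rewrite -(step (Negz p.+1)); try lia.
rewrite -sumrB; apply: eq_bigr => k _ /=.
have -> : k%:Z - M%:Z - Negz p.+1 - 1 = k%:Z - M%:Z - Negz p by lia.
by rewrite opprB addrA subrK; congr (_ - G _); lia.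
Qed.

(** The Heisenberg relation. By [phi_bos] the commutator is a sum of differences G(i) - G(i - m) for
    the summand G below. Far to the left G is 0; far to the right it is 2 w if l + m = 0, and 0
    otherwise. *)
Lemma bos_comm l m w : oddz l -> oddz m ->
  bos m (bos l w) =
  bos l (bos m w) + (if l + m == 0 then l%:~R / 2 else 0) *: w.
Proof.
move=> lo mo; have [d hd] := dle_exists w.
have [A hA] := bosE_exists w (bos m w) lo.
pose B := (d + `|l| + `|m| + 1)%N.
pose M := (A + B + `|m| + 1)%N.
have [||-> ->] := hA M (M + M)%N; try lia.
have lb := bos_linear mo.
pose G (i : int) := (-1) ^ i *: phi i (phi (- i - l - m) w).
pose c : K := if l + m == 0 then 2 else 0.
(* Once the central term is written as this telescoping sum, the claim holds summand by summand. *)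
have <- : - 4^-1 *: \sum_(k < M + M) (G (k%:Z - M%:Z) - G (k%:Z - M%:Z - m)) =
    (if l + m == 0 then l%:~R / 2 else 0) *: w.
  rewrite (@sum_shift_diff _ G (c *: w) B); try lia.
  - rewrite -scaler_int scalerA scalerA; congr (_ *: _); rewrite /c.
    case: eqP => [lm|_]; last by rewrite !mulr0.
    have -> : l = - m by lia.
    by rewrite mulrNz; move: (m%:~R) => x; field; rewrite !natK_eq0.
  - move=> i iB; rewrite /G (phi_gt hd) ?linear0 ?scaler0//; lia.
  - move=> i iB; rewrite /G phi_phi (phi_gt hd (n := i)); last by lia.
    rewrite linear0 subr0 scalerA /c.
    have -> : (- i - l - m == - i) = (l + m == 0) by lia.
    case: eqP => lm; last by rewrite mulr0.
    have -> : - i - l - m = - i by lia.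
    by rewrite signzN mulrCA -expr2 sqr_signz mulr1.
rewrite scaleNr -scalerN -scalerDr (linZ lb) (lin_sum lb); congr (_ *: _).
rewrite -sumrN -big_split; apply: eq_bigr => k _ /=.
set i := k%:Z - M%:Z; have -> : M%:Z - k%:Z - l = - i - l by lia.
clearbody i.
have bp (n : int) v : bos m (phi n v) = phi n (bos m v) - phi (n - m) v.
  by rewrite phi_bos// addrK.
rewrite (linZ lb) !bp (linB (@phi_linear i)) -addrA scalerDr; congr (_ + _).
rewrite -opprD scalerN scalerDr; congr (- (_ + _)).
rewrite /G signzD signzN (signz_odd mo) mulrN1 scaleNr opprK.
by congr (_ *: phi _ (phi _ _)); lia.
Qed.

(** * The exponential of artanh *)

Lemma fsbig_natP (V : zmodType) (P : pred nat) (F : nat -> V) N :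
  (forall k, P k -> (N <= k)%N -> F k = 0) ->
  \sum_(k \in [set k | P k]) F k = \sum_(k < N | P k) F k.
Proof.
move=> F0; rewrite fsbig_mkcond (@fsbig_nat _ _ N) => [|k Nk].
  rewrite [RHS]big_mkcond; apply: eq_bigr => k _.
  by rewrite /patch; congr (if _ then _ else _); apply/idP/idP; rewrite inE.
by rewrite /patch; case: ifP => //; rewrite inE => Pk; apply: F0.
Qed.

Lemma natK_neq0 n : n.+1%:R != 0 :> K.
Proof. by rewrite natK_eq0. Qed.

Lemma factK_neq0 n : n`!%:R != 0 :> K.
Proof. by rewrite natK_eq0 -lt0n fact_gt0. Qed.

Lemma deriv1 (R : nzRingType) : (1 : {poly R})^`() = 0.
Proof. by rewrite -polyC1 derivC. Qed.

Section ArtanhExp.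
Variables (F : fieldType) (s : F).
Hypothesis char0 : forall n, n.+1%:R != 0 :> F.

(** A truncation of 2 artanh(s X). Accordingly [exp_artanh] truncates exp(- 2 artanh(s X)) = (1 - s
    X) / (1 + s X). *)
Definition artanh_poly (M : nat) : {poly F} :=
  \sum_(m < M | odd m) (2 * s ^+ m / m%:R) *: 'X^m.

Definition exp_artanh (M : nat) : {poly F} :=
  \sum_(i < M) (i`!%:R)^-1 *: (- artanh_poly M) ^+ i.

Lemma artanh_poly_dvd M : exists Q, artanh_poly M = 'X * Q.
Proof.
rewrite /artanh_poly; elim/big_rec: _ => [|i p io [Q ->]].
  by exists 0; rewrite mulr0.
case: i io => [[|m]//= mM] _.
exists ((2 * s ^+ m.+1 / m.+1%:R) *: 'X^m + Q).
by rewrite mulrDr -scalerAr -exprS.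
Qed.

Lemma deriv_artanh_poly M :
  (1 - (s ^+ 2) *: 'X^2) * (artanh_poly M.+1)^`() =
  (2 * s)%:P - (if odd M then (2 * s ^+ M.+2) *: 'X^(M.+1)
                else (2 * s ^+ M.+1) *: 'X^M).
Proof.
elim: M => [|M IH].
  rewrite /artanh_poly big_mkcond big_ord1 /= deriv0 mulr0 expr0 expr1.
  by rewrite alg_polyC subrr.
rewrite /artanh_poly big_mkcond big_ord_recr -big_mkcond /= -/(artanh_poly M.+1).
have [Mo|Mo] := boolP (odd M); first by rewrite Mo addr0 in IH *.
rewrite (negPf Mo) in IH *; move: IH; rewrite /= => IH.
rewrite derivD mulrDr {}IH.
rewrite derivZ derivXn /= -scaler_nat scalerA divfK ?char0//.
rewrite mulrBl mul1r -scalerAl -scalerAr scalerA -exprD add2n.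
rewrite addrA subrK; congr (_ - _ *: _).
by rewrite mulrCA -exprD add2n.
Qed.

(** With L for [artanh_poly], this is E' = - L' E combined with (1 - s^2 X^2) L' = 2 s. The last
    term lost when the truncated exponential is differentiated and the tail of the geometric series
    are both multiples of X^M. *)
Lemma deriv_exp_artanh M : exists Q,
  (1 - (s ^+ 2) *: 'X^2) * (exp_artanh M.+1)^`() =
  - (2 * s) *: exp_artanh M.+1 + 'X^M * Q.
Proof.
set E := exp_artanh M.+1; set L := artanh_poly M.+1.
have dE : E^`() = - L^`() * (E - (M`!%:R)^-1 *: (- L) ^+ M).
  rewrite {2}/E /exp_artanh big_ord_recr /= -/L addrK.
  rewrite /E /exp_artanh -/L big_ord_recl /= derivD derivZ expr0 deriv1.
  rewrite scaler0 add0r raddf_sum mulr_sumr.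
  apply: eq_bigr => i _; rewrite /bump /= add1n derivZ deriv_exp derivN /=.
  rewrite -scalerAr -scaler_nat scalerA; congr (_ *: _).
  by rewrite factS natrM invfM -mulrA [_ * i.+1%:R]mulrC mulrA mulVf ?mul1r ?char0.
have [Q LQ] := artanh_poly_dvd M.+1; rewrite -/L in LQ.
have /= := deriv_artanh_poly M; rewrite -/L => dL.
pose P : {poly F} := if odd M then (2 * s ^+ M.+2) *: 'X else (2 * s ^+ M.+1)%:P.
have {dL} dL : (1 - s ^+ 2 *: 'X^2) * L^`() = (2 * s)%:P - 'X^M * P.
  rewrite dL /P; congr (_ - _); case: ifP => _.
    by rewrite -scalerAr -exprSr.
  by rewrite -mul_polyC mulrC.
exists (P * E - ((2 * s)%:P - 'X^M * P) * (- ((M`!%:R)^-1 *: (- Q) ^+ M))).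
rewrite dE mulrA mulrN dL LQ -mul_polyC.
rewrite -[- ('X * Q)]mulrN exprMn -!mul_polyC rmorphN /=.
move: (_%:P) ('X^M) (_%:P) ((- Q) ^+ M) => a X c q.
by ring.
Qed.

(** R = (1 + s X) E satisfies (1 - s X) R' = - s R modulo X^M. The resulting recurrence on
    coefficients carries the factor j - 1, so it stops after degree 1. *)
Lemma exp_artanhE M k : (k < M)%N ->
  ((1 + s *: 'X) * exp_artanh M)`_k = (1 - s *: 'X)`_k.
Proof.
case: M => // M kM; set E := exp_artanh M.+1; set R := _ * _.
have [Q dE] := deriv_exp_artanh M; rewrite -/E in dE.
have dR : (1 - s *: 'X) * R^`() = - s *: R + 'X^M * Q.
  rewrite /R {R}; move: E dE => E dE.
  rewrite derivM derivD derivZ derivX deriv1 add0r.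
  rewrite mulrDr [X in _ + X = _]mulrA.
  rewrite [(1 - _) * (1 + _)](_ : _ = 1 - s ^+ 2 *: 'X^2); last first.
    by rewrite -!mul_polyC rmorphXn /=; ring.
  rewrite dE -!mul_polyC !rmorphN rmorphM /=.
  have -> : (2 : F)%:P = 2 :> {poly F} by rewrite -polyC_natr.
  by ring.
have R0 : R`_0 = 1.
  rewrite /R mulrDl mul1r -scalerAl coefD coefZ coefXM /= mulr0 addr0.
  rewrite /E /exp_artanh coef_sum (bigD1 ord0)//= big1 => [|i i0].
    by rewrite coefZ expr0 coef1 fact0 invr1 mulr1 addr0.
  have [P ->] := artanh_poly_dvd M.+1.
  case: i i0 => [[|i] iM] // _ /=.
  by rewrite coefZ exprS mulNr -mulrA coefN coefXM oppr0 mulr0.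
clearbody R.
have step j : (j < M)%N -> j.+1%:R * R`_j.+1 = s * (j%:R - 1) * R`_j.
  move=> jM; have := congr1 (fun p : {poly F} => p`_j) dR.
  rewrite mulrBl mul1r -scalerAl coefB coefZ coefXM coefD coefZ coefXnM jM addr0.
  rewrite !coef_deriv mulr_natl.
  case: j jM => [|j] jM /=.
    by rewrite mulr0 subr0 => ->; ring.
  by move/eqP; rewrite subr_eq => /eqP ->; ring.
rewrite coefB coef1 coefZ coefX.
case: k kM => [|[|k]] kM; first by rewrite R0 mulr0 subr0.
  by have := step 0%N kM; rewrite R0 mul1r => ->; rewrite mulr1 !sub0r mulr1 mulrN1.
rewrite mulr0 subr0 /=.
elim: k kM => [|k IH] kM.
  have := step 1%N kM; rewrite subrr mulr0 mul0r => /eqP.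
  by rewrite mulf_eq0 (negPf (char0 _)) => /eqP.
have := step k.+2 kM; rewrite IH ?mulr0; last exact: ltnW.
by move/eqP; rewrite mulf_eq0 (negPf (char0 _)) => /eqP.
Qed.

End ArtanhExp.

(** * Conjugation by the exponential of Theta *)

Lemma linN (V W : lmodType K) (f : V -> W) : linear f ->
  forall u, f (- u) = - f u.
Proof. by move=> lf u; rewrite -sub0r (linB lf) (lin0 lf) sub0r. Qed.

Section Actf.
Variable V : lmodType K.
Implicit Types (p q : {poly K}) (y : int -> V).

(** X acts on sequences by the shift n -> n + 1; [actfM] makes them a module over polynomials. *)
Definition actf p y (n : int) : V := \sum_(k < size p) p`_k *: y (n + k%:Z).

Lemma actfE N p y n : (size p <= N)%N ->
  actf p y n = \sum_(k < N) p`_k *: y (n + k%:Z).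
Proof.
move=> pN; rewrite /actf (big_ord_widen N (fun k => p`_k *: y (n + k%:Z)) pN).
rewrite big_mkcond; apply: eq_bigr => k _ /=.
by case: ltnP => // pk; rewrite nth_default// scale0r.
Qed.

Lemma actf_linear y n : linear ((fun p => actf p y n) : {poly K} -> V).
Proof.
move=> a p q; pose N := maxn (size p) (size q).
have h : (size (a *: p + q)%R <= N)%N.
  rewrite (leq_trans (size_polyD _ _))// geq_max leq_maxr andbT.
  by rewrite (leq_trans (size_scale_leq _ _))// leq_maxl.
rewrite (actfE _ _ h) (@actfE N p) ?leq_maxl// (@actfE N q) ?leq_maxr//.
rewrite scaler_sumr -big_split; apply: eq_bigr => k _ /=.
by rewrite coefD coefZ scalerDl scalerA.
Qed.

Lemma actfC c y n : actf c%:P y n = c *: y n.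
Proof. by rewrite (@actfE 1) ?size_polyC_leq1// big_ord1 coefC eqxx addr0. Qed.

Lemma actf1 y n : actf 1 y n = y n.
Proof. by rewrite -polyC1 actfC scale1r. Qed.

Lemma actfXM p y n : actf ('X * p) y n = actf p y (n + 1).
Proof.
have h : (size ('X * p)%R <= (size p).+1)%N.
  have [->|p0] := eqVneq p 0; first by rewrite mulr0 size_poly0.
  by rewrite mulrC size_mulX.
rewrite (actfE _ _ h) big_ord_recl coefXM scale0r add0r.
apply: eq_bigr => k _; rewrite coefXM /=; congr (_ *: y _).
by rewrite /bump /= add1n; lia.
Qed.

Lemma eq_actf p y y' n : y =1 y' -> actf p y n = actf p y' n.
Proof. by move=> yy; apply: eq_bigr => k _; rewrite yy. Qed.

Lemma actfM p q y n : actf (p * q) y n = actf p (actf q y) n.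
Proof.
elim/poly_ind: p q y n => [|p c IH] q y n.
  by rewrite mul0r !(lin0 (actf_linear _ _)).
rewrite mulrDl -mulrA !(linD (actf_linear _ _)) !IH actfC; congr (_ + _).
  apply: eq_actf => m; rewrite actfXM.
  by rewrite -['X in RHS]mulr1 actfXM actf1.
by rewrite mul_polyC (linZ (actf_linear _ _)).
Qed.

Lemma actfXn_M m p y n : actf ('X^m * p) y n = actf p y (n + m%:Z).
Proof.
elim: m n => [|m IH] n; first by rewrite mul1r addr0.
by rewrite exprS -mulrA actfXM IH; congr actf; lia.
Qed.

Lemma actfXn m y n : actf 'X^m y n = y (n + m%:Z).
Proof. by rewrite -['X^m]mulr1 actfXn_M actf1. Qed.

End Actf.

(** Regroups the product of two truncated exponential series by total order; the terms beyond the
    triangle are those assumed to vanish. *)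
Lemma triangle_sum (V : zmodType) M (t : nat -> nat -> V) :
  (forall i k, (M <= i + k)%N -> t i k = 0) ->
  \sum_(j < M) \sum_(i < j.+1) t i (j - i)%N =
  \sum_(i < M) \sum_(k < M) t i k.
Proof.
move=> t0.
transitivity (\sum_(j < M) \sum_(i < M) (if (i <= j)%N then t i (j - i)%N else 0)).
  apply: eq_bigr => j _; rewrite -big_mkcond /=.
  by rewrite (big_ord_widen M (fun i => t i (j - i)%N)).
rewrite exchange_big; apply: eq_bigr => i _ /=.
rewrite -(big_mkord xpredT (fun j => if (i <= j)%N then t i (j - i)%N else 0)).
rewrite (big_cat_nat (n := i))//=; last exact: ltnW.
rewrite big_nat_cond big1 ?add0r => [|j]; last by case: leqP; rewrite // andbF.
rewrite -{1}[val i]add0n big_addn.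
rewrite -(big_mkord xpredT (t i)) [RHS](big_cat_nat (n := M - i))//= ?leq_subr//.
rewrite [X in _ + X]big_nat_cond [X in _ + X]big1 ?addr0; last first.
  by move=> k /andP[/andP[k1 k2] _]; apply: t0; lia.
by apply: eq_bigr => k _; rewrite leq_addl addnK.
Qed.

Lemma factS_cancel (F : fieldType) j (s : F) : j.+1%:R != 0 :> F ->
  (j.+1`!%:R)^-1 * (j.+1%:R * s) = (j`!%:R)^-1 * s.
Proof. by move=> j0; rewrite factS natrM invfM mulrACA mulVf// mul1r. Qed.

Section DividedPower.
Variables (V : lmodType K) (T B : V -> V) (s : K).
Hypotheses (linT : linear T) (linB : linear B).
Hypothesis TB : forall v, T (B v) = B (T v) + s *: v.

Lemma iter_comm j v :
  iter j.+1 T (B v) = B (iter j.+1 T v) + (j.+1%:R * s) *: iter j T v.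
Proof.
elim: j => [|j IH]; first by rewrite /= TB mul1r.
rewrite [LHS]iterS IH (linD linT) TB (linZ linT) -!iterS.
by rewrite -addrA -scalerDl; congr (_ + _ *: _); rewrite [in RHS]mulrSr; ring.
Qed.

Lemma dpow0_comm v : (0`!%:R)^-1 *: iter 0 T (B v) = B ((0`!%:R)^-1 *: iter 0 T v).
Proof. by rewrite (linZ linB). Qed.

(** Summed over j, with [dpow0_comm] for the first term, this becomes e^T B = (B + s) e^T. *)
Lemma dpow_comm j v : (j.+1`!%:R)^-1 *: iter j.+1 T (B v) =
  B ((j.+1`!%:R)^-1 *: iter j.+1 T v) + s *: ((j`!%:R)^-1 *: iter j T v).
Proof.
rewrite iter_comm scalerDr (linZ linB); congr (_ + _); rewrite !scalerA.
by congr (_ *: _); rewrite (factS_cancel _ (natK_neq0 j)) mulrC.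
Qed.

End DividedPower.

Section ThetaOp.

Local Notation hb := (beta / 2).

Lemma oddzN (n : nat) : odd n -> oddz (- n%:Z).
Proof. by rewrite /oddz abszN. Qed.

Lemma ThetaE d w N : dle d w -> d < N%:Z ->
  Theta w = 2 *: \sum_(n < N | odd n) (hb ^+ n / n%:R) *: bos (- n%:Z) w.
Proof.
move=> h dN; rewrite /Theta (@fsbig_natP _ odd _ N)// => k ko Nk.
have -> : bos (- k%:Z) w = 0; last by rewrite scaler0.
by apply: dle_lt0 (dle_bos (oddzN ko) h); lia.
Qed.

Lemma Theta_linear : linear Theta.
Proof.
move=> a u v; have [d hu] := dle_exists u; have [e hv] := dle_exists v.
have hu' : dle (d + e)%:Z u by apply: dleW hu _; lia.
have hv' : dle (d + e)%:Z v by apply: dleW hv _; lia.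
rewrite !(@ThetaE (d + e)%:Z _ (d + e).+1) ?ltz_nat//; last first.
  by apply: dleD => //; apply: dleZ.
rewrite scalerA [a * 2]mulrC -scalerA -scalerDr; congr (_ *: _).
rewrite scaler_sumr -big_split; apply: eq_bigr => n no /=.
by rewrite (bos_linear (oddzN no)) scalerDr !scalerA [a * _]mulrC.
Qed.

Lemma dle_Theta d w : dle d w -> dle (d - 1) (Theta w).
Proof.
move=> h; rewrite (@ThetaE d w (`|d|.+1)) //; last by lia.
apply/dleZ/dle_sum => n no; apply: dleZ.
by apply: dleW (dle_bos (oddzN no) h) _; case: (nat_of_ord n) no => // k _; lia.
Qed.

Lemma dle_iter_Theta d w j : dle d w -> dle (d - j%:Z) (iter j Theta w).
Proof.
move=> h; elim: j => [|j IH]; first by rewrite subr0.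
by apply: dleW (dle_Theta IH) _; lia.
Qed.

Lemma iter_Theta_linear j : linear (iter j Theta).
Proof. by elim: j => // j IH a u v; rewrite !iterS IH Theta_linear. Qed.

Definition dTheta j w := (j`!%:R)^-1 *: iter j Theta w.

Lemma exp_ThetaE d w N : dle d w -> d < N%:Z ->
  exp_Theta w = \sum_(j < N) dTheta j w.
Proof.
move=> h dN; apply: fsbig_nat => j Nj.
by rewrite (dle_lt0 _ (dle_iter_Theta j h)) ?scaler0//; lia.
Qed.

Lemma exp_Theta_linear : linear exp_Theta.
Proof.
move=> a u v; have [d hu] := dle_exists u; have [e hv] := dle_exists v.
have hu' : dle (d + e)%:Z u by apply: dleW hu _; lia.
have hv' : dle (d + e)%:Z v by apply: dleW hv _; lia.
rewrite !(@exp_ThetaE (d + e)%:Z _ (d + e).+1) ?ltz_nat//; last first.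
  by apply: dleD => //; apply: dleZ.
rewrite scaler_sumr -big_split; apply: eq_bigr => n no /=.
by rewrite /dTheta iter_Theta_linear scalerDr !scalerA [a * _]mulrC.
Qed.

Lemma dle_exp_Theta d w : dle d w -> dle d (exp_Theta w).
Proof.
move=> h; rewrite (@exp_ThetaE d w (`|d|.+1)) //; last by lia.
apply/dle_sum => n _; apply: dleZ.
by apply: dleW (dle_iter_Theta n h) _; lia.
Qed.

Lemma exp_Theta_vac : exp_Theta vac = vac.
Proof.
by rewrite (@exp_ThetaE 0 vac 1 dle_vac)// big_ord1 /dTheta invr1 scale1r.
Qed.

(** On phi(z) the commutator with Theta is multiplication by - 2 artanh(beta / (2 z)), and 1/z
    shifts the index by n -> n + 1. Terms of order N or more kill w, which allows the truncation. *)
Lemma Theta_phi d n w N : dle d w -> d < N%:Z -> d - n < N%:Z ->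
  Theta (phi n w) = phi n (Theta w) - actf (artanh_poly hb N) (phi^~ w) n.
Proof.
move=> h dN dnN; rewrite (ThetaE h dN) (ThetaE (dle_phi n h) dnN).
rewrite (linZ (@phi_linear n)) (lin_sum (@phi_linear n)).
rewrite /artanh_poly (lin_sum (actf_linear _ _)) !scaler_sumr.
apply/eqP; rewrite eq_sym subr_eq -big_split.
apply/eqP; apply: eq_bigr => m mo /=.
rewrite linearZ /= phi_bos ?oddzN// (linZ (actf_linear _ _)) actfXn opprK.
by rewrite !scalerDr !scalerA mulrA.
Qed.

Lemma Theta_actf d n v N (q : {poly K}) : dle d v -> d < N%:Z -> d - n < N%:Z ->
  Theta (actf q (phi^~ v) n) =
  actf q (phi^~ (Theta v)) n - actf (artanh_poly hb N * q) (phi^~ v) n.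
Proof.
move=> h dN dnN; rewrite mulrC actfM /actf (lin_sum Theta_linear) -sumrB.
apply: eq_bigr => k _; rewrite (linZ Theta_linear) (Theta_phi h dN); last by lia.
by rewrite scalerBr.
Qed.

Definition artanh_dpow N i : {poly K} := (i`!%:R)^-1 *: (- artanh_poly hb N) ^+ i.

Lemma dThetaS j w : j.+1%:R *: dTheta j.+1 w = Theta (dTheta j w).
Proof.
rewrite /dTheta (linZ Theta_linear) scalerA; congr (_ *: _).
by rewrite factS natrM invfM mulrA divff ?mul1r// natK_neq0.
Qed.

Lemma artanh_dpowS N i :
  i.+1%:R *: artanh_dpow N i.+1 = - artanh_poly hb N * artanh_dpow N i.
Proof.
rewrite /artanh_dpow scalerA -scalerAr -exprS; congr (_ *: _).
by rewrite factS natrM invfM mulrA divff ?mul1r// natK_neq0.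
Qed.

Lemma dle_dTheta d w j : dle d w -> dle (d - j%:Z) (dTheta j w).
Proof. by move=> h; apply/dleZ/dle_iter_Theta. Qed.

(** The Leibniz rule for divided powers: [Theta] acts on w and on the index of [phi], and the second
    action is the polynomial [- artanh_poly], which commutes with the first. *)
Lemma dTheta_phi d n w N j : dle d w -> d < N%:Z -> d - n < N%:Z ->
  dTheta j (phi n w) =
  \sum_(i < j.+1) actf (artanh_dpow N i) (phi^~ (dTheta (j - i) w)) n.
Proof.
move=> h dN dnN.
pose t i k := actf (artanh_dpow N i) (phi^~ (dTheta k w)) n.
rewrite -/(\sum_(i < j.+1) t i (j - i)%N).
elim: j => [|j IH].
  rewrite big_ord1 /t /artanh_dpow /dTheta fact0 invr1 scale1r expr0 scale1r.
  by rewrite actf1 scale1r.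
apply: (scalerI (natK_neq0 j)); rewrite dThetaS IH (lin_sum Theta_linear).
(* After reindexing, the two sums give each [t i (j.+1 - i)] the multiplicities j + 1 - i and i, in
   total j + 1. *)
transitivity (\sum_(i < j.+1) (j.+1 - i)%:R *: t i (j.+1 - i)%N +
              \sum_(i < j.+1) i.+1%:R *: t i.+1 (j - i)%N).
  rewrite -big_split; apply: eq_bigr => i _ /=.
  have hk := dle_dTheta (j - i) h.
  rewrite /t (@Theta_actf _ n _ N _ hk); [|lia|lia].
  have ij : (i <= j)%N by rewrite -ltnS.
  rewrite (subSn ij) -dThetaS.
  rewrite -[X in _ = _ + X](linZ (actf_linear _ _)) artanh_dpowS mulNr.
  rewrite (linN (actf_linear _ _)); congr (_ + _).
  rewrite /actf [RHS]scaler_sumr; apply: eq_bigr => k _.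
  by rewrite (linZ (@phi_linear _)) !scalerA mulrC.
transitivity (\sum_(i < j.+2) (j.+1 - i)%:R *: t i (j.+1 - i)%N +
              \sum_(i < j.+2) i%:R *: t i (j.+1 - i)%N).
  rewrite [in RHS]big_ord_recr /= subnn scale0r addr0.
  by rewrite [X in _ = _ + X]big_ord_recl /= scale0r add0r.
rewrite -big_split scaler_sumr; apply: eq_bigr => i _ /=.
by rewrite -scalerDl -natrD subnK// -ltnS.
Qed.

Lemma artanh_dpow_coef N i k : (k < i)%N -> (artanh_dpow N i)`_k = 0.
Proof.
move=> ki; rewrite coefZ; have [Q ->] := artanh_poly_dvd hb N.
by rewrite -mulrN exprMn coefXnM ki mulr0.
Qed.

Lemma exp_Theta_phi d n w M : dle d w -> d < M%:Z -> d - n < M%:Z ->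
  exp_Theta (phi n w) = actf (exp_artanh hb M) (phi^~ (exp_Theta w)) n.
Proof.
move=> h dM dnM; rewrite (exp_ThetaE (dle_phi n h) dnM) (exp_ThetaE h dM).
under eq_bigr => j _ do rewrite (dTheta_phi j h dM dnM).
pose t i k := actf (artanh_dpow M i) (phi^~ (dTheta k w)) n.
rewrite (triangle_sum (t := t)) => [|i k Mik].
  rewrite (lin_sum (actf_linear _ _)); apply: eq_bigr => i _.
  rewrite /t /actf exchange_big; apply: eq_bigr => k _ /=.
  by rewrite -/(artanh_dpow M i) (lin_sum (@phi_linear _)) scaler_sumr.
rewrite /t /actf big1// => c _; case: (ltnP c i) => ci.
  by rewrite artanh_dpow_coef ?scale0r.
by rewrite (phi_gt (dle_dTheta k h)) ?scaler0//; lia.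
Qed.

(* This is e^Theta phi(z) e^(-Theta) = exp (-2 artanh (beta / (2 z))) phi(z), *)
(* cleared of its denominator.                                               *)
Lemma exp_Theta_phi_rel n w :
  exp_Theta (phi n w) + hb *: exp_Theta (phi (n + 1) w) =
  phi n (exp_Theta w) - hb *: phi (n + 1) (exp_Theta w).
Proof.
have [d h] := dle_exists w; pose M := (d + `|n| + 2)%N.
rewrite !(@exp_Theta_phi d _ _ M h); try lia.
set w' := exp_Theta w; have h' : dle d%:Z w' by apply: dle_exp_Theta.
set E := exp_artanh hb M.
rewrite -(actfXM E) -(linZ (actf_linear _ _)) -(linD (actf_linear _ _)).
have -> : E + hb *: ('X * E) = (1 + hb *: 'X) * E.
  by rewrite mulrDl mul1r scalerAl.
transitivity (actf (1 - hb *: 'X) (phi^~ w') n); last first.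
  rewrite (linB (actf_linear _ _)) actf1 (linZ (actf_linear _ _)).
  by rewrite -['X]mulr1 actfXM actf1.
pose N := (size ((1 + hb *: 'X) * E)%R + size (1 - hb *: 'X)%R + M)%N.
rewrite (@actfE _ N) ?(@actfE _ N (1 - _)) /N;
  [|by rewrite -addnA addnCA leq_addr|by rewrite -addnA leq_addr].
(* Below M the coefficients agree by [exp_artanhE]; from M on the fermion kills w'. *)
apply: eq_bigr => k _; case: (ltnP k M) => kM.
  by rewrite exp_artanhE//; exact: natK_neq0.
by rewrite (phi_gt h') ?scaler0//; lia.
Qed.

(** Only the summand n = l of Theta fails to commute with b_l, and its central term is 2 times (beta
    / 2)^l / l times l / 2. *)
Lemma Theta_bos (l : nat) w : odd l ->
  Theta (bos l w) = bos l (Theta w) + hb ^+ l *: w.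
Proof.
move=> lo; have [d h] := dle_exists w; have lo' : oddz l%:Z by [].
rewrite (@ThetaE d%:Z w (d + l).+1)//; last by lia.
rewrite (@ThetaE (d%:Z + l%:Z) (bos l w) (d + l).+1); try lia; last first.
  exact: dle_bos.
rewrite (linZ (bos_linear lo')) (lin_sum (bos_linear lo')).
have ll : (l < (d + l).+1)%N by lia.
transitivity (2 *: (\sum_(n < (d + l).+1 | odd n) bos l ((hb ^+ n / n%:R) *: bos (- n%:Z) w)
   + \sum_(n < (d + l).+1 | odd n) (if n == Ordinal ll then (hb ^+ l / 2) *: w else 0))).
  congr (_ *: _); rewrite -big_split; apply: eq_bigr => n no /=.
  rewrite bos_comm ?oddzN// scalerDr [in RHS](linZ (bos_linear lo')); congr (_ + _).
  rewrite subr_eq0 eqz_nat -val_eqE /= [l == _]eq_sym.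
  case: eqP => [->|_]; last by rewrite scale0r scaler0.
  rewrite scalerA; congr (_ *: _).
  have l0 : l%:R != 0 :> K by rewrite natK_eq0; case: (l) lo.
  by rewrite -pmulrn mulrACA -mulrA; congr (_ * _); rewrite mulrA divff ?mul1r.
rewrite scalerDr; congr (_ + _).
rewrite (bigD1 (Ordinal ll)) //= eqxx big1 ?addr0 => [|n /andP[_ /negPf->//]].
by rewrite scalerA mulrCA divff ?mulr1// natK_neq0.
Qed.

Lemma exp_Theta_bos (l : nat) w : odd l ->
  exp_Theta (bos l w) = bos l (exp_Theta w) + hb ^+ l *: exp_Theta w.
Proof.
move=> lo; have [d h] := dle_exists w; have lo' : oddz l%:Z by [].
have lb := bos_linear lo'.
rewrite (@exp_ThetaE (d%:Z + l%:Z) (bos l w) (d + l).+2); last by lia.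
  rewrite {1}(@exp_ThetaE d%:Z w (d + l).+2 h); last by lia.
  rewrite (@exp_ThetaE d%:Z w (d + l).+1 h); last by lia.
  rewrite (lin_sum lb) [in LHS]big_ord_recl [in RHS]big_ord_recl /=.
  rewrite /dTheta -addrA; congr (_ + _); first exact: dpow0_comm.
  rewrite scaler_sumr -big_split; apply: eq_bigr => j _ /=.
  rewrite /bump leq0n add1n.
  exact: (dpow_comm Theta_linear lb (fun v => Theta_bos v lo)).
exact: dle_bos.
Qed.

End ThetaOp.

(** * The deformed fermions *)

Lemma scaler_swap (R : comNzRingType) (V : lmodType R) (a b : R) (v : V) :
  a *: (b *: v) = b *: (a *: v).
Proof. by rewrite !scalerA mulrC. Qed.

Section Binz.

Lemma binz0 a : binz a 0 = 1.
Proof. by rewrite /binz big_ord0 invr1 mulr1. Qed.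

Lemma binzS a k : binz a k.+1 = binz (a - 1) k.+1 + binz (a - 1) k.
Proof.
pose P : K := \prod_(t < k) (a - 1 - t%:Z)%:~R.
have e1 : binz a k.+1 = a%:~R * P / k.+1`!%:R.
  rewrite /binz big_ord_recl subr0; congr (_ * _ / _); apply: eq_bigr => t _.
  by congr (_%:~R); rewrite lift0; lia.
have e2 : binz (a - 1) k.+1 = P * (a - 1 - k%:Z)%:~R / k.+1`!%:R.
  by rewrite /binz big_ord_recr.
have e3 : binz (a - 1) k = P * k.+1%:R / k.+1`!%:R.
  have k0 := natK_neq0 k.
  by rewrite factS natrM invfM mulrA mulfK.
rewrite e1 e2 e3 -mulrDl -mulrDr; congr (_ / _); rewrite mulrC; congr (_ * _).
by rewrite pmulrn -intrD; congr (_%:~R); lia.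
Qed.

Lemma binz_nat n k : binz n%:Z k = 'C(n, k)%:R.
Proof.
elim: n k => [|n IH] [|k]; rewrite ?binz0 ?bin0//.
  by rewrite /binz big_ord_recl subrr mul0r mul0r bin0n.
rewrite binzS; have -> : n.+1%:Z - 1 = n%:Z by lia.
by rewrite !IH binS natrD.
Qed.

Lemma binz_opp n k : binz (- n.+1%:Z) k = (-1) ^+ k * 'C(n + k, k)%:R.
Proof.
elim: k n => [|k IHk] n; first by rewrite binz0 bin0 mulr1.
elim: n => [|n IHn].
  have := binzS 0 k; rewrite (binz_nat 0) bin0n sub0r => /eqP.
  rewrite eq_sym addr_eq0 => /eqP ->.
  by rewrite (IHk 0%N) add0n !binn exprS mulN1r !mulr1 .
have := binzS (- n.+1%:Z) k; have -> : - n.+1%:Z - 1 = - n.+2%:Z by lia.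
move/eqP; rewrite -subr_eq eq_sym => /eqP ->.
by rewrite IHn IHk !addSn !addnS [in RHS]binS natrD exprS; ring.
Qed.

End Binz.

Lemma coef_XaddC_exp (R : comNzRingType) (c : R) n p :
  (('X + c%:P) ^+ n)`_p = 'C(n, p)%:R * c ^+ (n - p).
Proof.
rewrite exprDn.
rewrite coef_sum; have [np|pn] := ltnP n p.
  rewrite bin_small// mul0r big1// => i _.
  rewrite coefMn -rmorphXn /= mulrC coefCM coefXn.
  by case: eqP => [|_]; rewrite ?mulr0 ?mul0rn//; have := ltn_ord i; lia.
have ip : (n - p < n.+1)%N by lia.
rewrite (bigD1 (Ordinal ip))//= big1 ?addr0 => [|i ii].
  rewrite coefMn -rmorphXn /= mulrC coefCM coefXn subKn// eqxx mulr1.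
  by rewrite bin_sub// mulr_natl.
rewrite coefMn -rmorphXn /= mulrC coefCM coefXn.
case: eqP => [e|_]; rewrite ?mulr0 ?mul0rn//.
case/negP: ii; apply/eqP/val_inj => /=; have := ltn_ord i; lia.
Qed.

Section Psi.
Local Notation hb := (beta / 2).

Lemma half_beta : hb + hb = beta.
Proof.
have h (F : fieldType) (x : F) : 2%:R != 0 :> F -> x / 2 + x / 2 = x.
  by move=> h2; field.
by apply: h; exact: natK_neq0.
Qed.

(** The coefficient of phi_(a+i) in phi^(beta)_a. One formula covers both signs of a, because both
    halves of phi^(beta)(z) are expansions of phi(z + beta / 2): the negative powers of z + beta / 2
    are expanded in 1/z. *)
Definition kap (a : int) (i : nat) : K := binz (a + i%:Z) i * hb ^+ i.

Lemma kap0 a : kap a 0 = 1.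
Proof. by rewrite /kap binz0 mulr1. Qed.

Lemma kapS a i : kap a i.+1 = kap (a - 1) i.+1 + hb * kap a i.
Proof.
rewrite /kap binzS; have -> : a + i.+1%:Z - 1 = a + i%:Z by lia.
have -> : a - 1 + i.+1%:Z = a + i%:Z by lia.
by rewrite mulrDl; congr (_ + _); rewrite exprS mulrCA.
Qed.

(** Pascal's rule in operator form: lowering the index of the undeformed fermion by one amounts to
    multiplying the deformed series by z + beta / 2. *)
Lemma kap_shift (V : lmodType K) (y : int -> V) (a : int) N :
  y (a + N%:Z - 1) = 0 ->
  \sum_(i < N) kap a i *: y (a + i%:Z - 1) =
  \sum_(i < N) kap (a - 1) i *: y (a - 1 + i%:Z) +
  hb *: \sum_(i < N) kap a i *: y (a + i%:Z).
Proof.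
case: N => [|N] y0; first by rewrite !big_ord0 scaler0 addr0.
rewrite [in LHS]big_ord_recl big_ord_recl [X in _ = _ + _ *: X]big_ord_recr /=.
have -> : a + N%:Z = a + N.+1%:Z - 1 by lia.
rewrite y0 scaler0 !addr0 !kap0 -addrA; congr (_ + _).
rewrite scaler_sumr -big_split; apply: eq_bigr => i _ /=.
rewrite /bump leq0n add1n kapS scalerDl scalerA.
by congr (_ *: y _ + _ *: y _); lia.
Qed.

Lemma phibE a d w N : dle d w -> d < a + N%:Z ->
  phib a w = \sum_(i < N) kap a i *: phi (a + i%:Z) w.
Proof.
move=> h dN; case: a dN => p dN.
  rewrite /phib (@fsbig_nat _ _ (p + N)) => [|k kN]; last first.
    by rewrite (phi_gt h) ?scaler0//; lia.
  rewrite big_split_ord /= big1 ?add0r => [|k _]; last first.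
    by rewrite coef_XaddC_exp bin_small ?mul0r ?scale0r.
  apply: eq_bigr => i _; rewrite coef_XaddC_exp -PoszD; congr (_ *: _).
  by rewrite /kap -PoszD binz_nat addKn -bin_sub ?leq_addr// addKn.
pose q := p.+1.
(* From i = q on, the upper entry of the binomial is a natural number smaller than i. *)
have kq i : (q <= i)%N -> kap (Negz p) i = 0.
  move=> qi; rewrite /kap; have -> : Negz p + i%:Z = (i - q)%N%:Z by lia.
  by rewrite binz_nat bin_small ?mul0r//; lia.
have cut M : (N <= M)%N -> \sum_(i < N) kap (Negz p) i *: phi (Negz p + i%:Z) w
   = \sum_(i < M) kap (Negz p) i *: phi (Negz p + i%:Z) w.
  move=> NM; rewrite (big_ord_widen M (fun i => kap (Negz p) i *: phi (Negz p + i%:Z) w) NM).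
  rewrite big_mkcond; apply: eq_bigr => i _ /=; case: ltnP => // Ni.
  by rewrite (phi_gt h) ?scaler0//; lia.
rewrite (cut (N + q)%N) ?leq_addr// addnC big_split_ord /=.
rewrite [X in _ = _ + X]big1 ?addr0 => [|i _]; last first.
  by rewrite kq ?scale0r// leq_addr.
rewrite big_nat_rev -/q big_add1 /= big_mkord; apply: eq_bigr => i _.
have iq : (i < q)%N by [].
have e1 : (1 + q.+1 - i.+2 = q - i)%N by lia.
rewrite e1 subKn; last exact: ltnW.
congr (_ *: phi _ w); last by lia.
rewrite /kap; have -> : Negz p + i%:Z = - (p - i).+1%:Z by lia.
rewrite binz_opp mulrAC -exprMn mulN1r mulrC; congr (_ * _%:R).
have ip : (i <= p)%N by rewrite -ltnS.
have -> : ((q - i).-1 = p - i)%N by rewrite /q; lia.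
by rewrite subnK// bin_sub.
Qed.

Lemma dle_phib a d w : dle d w -> dle (d - a) (phib a w).
Proof.
move=> h; rewrite (@phibE a d w (`|d|.+1 + `|a|)%N h); last by lia.
apply: dle_sum => i _; apply: dleZ; apply: dleW (dle_phi _ h) _; lia.
Qed.

Lemma phib_linear a : linear (phib a).
Proof.
move=> c u v; have [d hu] := dle_exists u; have [e hv] := dle_exists v.
have hu' : dle (d + e)%:Z u by apply: dleW hu _; lia.
have hv' : dle (d + e)%:Z v by apply: dleW hv _; lia.
pose N := ((d + e).+1 + `|a|)%N.
rewrite (@phibE a _ _ N (dleD (dleZ c hu') hv')); last by rewrite /N; lia.
rewrite (@phibE a _ _ N hu'); last by rewrite /N; lia.
rewrite (@phibE a _ _ N hv'); last by rewrite /N; lia.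
rewrite scaler_sumr -big_split; apply: eq_bigr => i _ /=.
rewrite (linD (@phi_linear _)) (linZ (@phi_linear _)) scalerDr.
by rewrite !scalerA [c * _]mulrC.
Qed.

(** Here X acts by a -> a - 1, which is multiplication by z on the series with coefficients Y a;
    [actf] shifts the other way. *)
Definition actz (V : lmodType K) (p : {poly K}) (Y : int -> V) (a : int) : V :=
  actf p (fun n => Y (- n)) (- a).

Lemma actzXD (V : lmodType K) c p (Y : int -> V) a :
  actz (('X + c%:P) * p) Y a = actz p Y (a - 1) + c *: actz p Y a.
Proof.
rewrite /actz mulrDl (linD (actf_linear _ _)) actfXM mul_polyC.
by rewrite (linZ (actf_linear _ _)); congr (actf _ _ _ + _); lia.
Qed.

(** Since phi^(beta)(z) is phi(z + beta / 2), the factor z^l on phi(z) turns into (z + beta /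
    2)^l. *)
Lemma phib_phi_shift a d w N l : dle d w -> d < a - l%:Z + N%:Z ->
  \sum_(i < N) kap a i *: phi (a + i%:Z - l%:Z) w =
  actz (('X + hb%:P) ^+ l) (phib^~ w) a.
Proof.
move=> h; elim: l a N => [|l IH] a N dN.
  rewrite /actz actf1 opprK (phibE h (N := N)); last by lia.
  by apply: eq_bigr => i _; rewrite subr0.
rewrite exprS actzXD -(IH _ N) -1?(IH _ N); try lia.
rewrite -(@kap_shift _ (fun m => phi (m - l%:Z) w)); last first.
  by rewrite (phi_gt h)//; lia.
by apply: eq_bigr => i _; congr (_ *: phi _ _); lia.
Qed.

Lemma phib_bos a (l : nat) w : odd l -> phib a (bos l w) =
  bos l (phib a w) + actz (('X + hb%:P) ^+ l) (phib^~ w) a.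
Proof.
move=> lo; have [d h] := dle_exists w; have lo' : oddz l%:Z by [].
pose N := (d + l + `|a| + 1)%N.
rewrite -(@phib_phi_shift a d w N l h); last by rewrite /N; lia.
rewrite (@phibE a _ _ N (dle_bos lo' h)); last by rewrite /N; lia.
rewrite (@phibE a _ _ N h); last by rewrite /N; lia.
rewrite (lin_sum (bos_linear lo')) -big_split; apply: eq_bigr => i _ /=.
by rewrite phi_bos// scalerDr [in RHS](linZ (bos_linear lo')).
Qed.

Lemma phib_shift1 a d v N : dle d v -> d < a + N%:Z - 1 ->
  phib (a - 1) v + hb *: phib a v = \sum_(i < N) kap a i *: phi (a + i%:Z - 1) v.
Proof.
move=> hv dN; rewrite (@phib_phi_shift a d v N 1 hv); last by lia.
rewrite expr1 -['X + _]mulr1 actzXD /actz !actf1 !opprK.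
by congr (phib _ _ + _); lia.
Qed.

(** Replacing z by z + beta / 2 in (z - beta / 2) / (z + beta / 2) gives z / (z + beta), the factor
    by which e^Theta passes phi^(beta)(z). It appears here cleared of its denominator. *)
Lemma exp_Theta_phib_rel a w :
  exp_Theta (phib (a - 1) w) + beta *: exp_Theta (phib a w) =
  phib (a - 1) (exp_Theta w).
Proof.
have [d h] := dle_exists w; have h' := dle_exp_Theta h.
pose N := (d + `|a| + 2)%N.
have dN : d%:Z < a + N%:Z - 1 by rewrite /N; lia.
rewrite -half_beta scalerDl addrA -(linZ exp_Theta_linear).
rewrite -(linD exp_Theta_linear) (phib_shift1 h dN) (@phibE a d w N h); last by rewrite /N; lia.
rewrite -(linD exp_Theta_linear) scaler_sumr -big_split.
rewrite (lin_sum exp_Theta_linear) /=.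
transitivity (\sum_(i < N) kap a i *: (phi (a + i%:Z - 1) (exp_Theta w) -
   hb *: phi (a + i%:Z) (exp_Theta w))).
  apply: eq_bigr => i _; rewrite [hb *: (_ *: _)]scaler_swap -scalerDr.
  rewrite (linZ exp_Theta_linear) (linD exp_Theta_linear) (linZ exp_Theta_linear).
  have := exp_Theta_phi_rel (a + i%:Z - 1) w.
  by rewrite subrK => ->.
apply/eqP; rewrite -(inj_eq (addIr (hb *: phib a (exp_Theta w)))) (phib_shift1 h' dN).
rewrite (@phibE a d _ N h'); last by rewrite /N; lia.
apply/eqP; rewrite scaler_sumr -big_split; apply: eq_bigr => i _ /=.
by rewrite [hb *: (_ *: _)]scaler_swap scalerBr subrK.
Qed.

End Psi.

(** * Two-point functions *)

Lemma coef_odd_part (R : comNzRingType) (c : R) n l :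
  (('X - c%:P) ^+ n - (- 'X - c%:P) ^+ n)`_l =
  if odd l then 2 * ('C(n, l)%:R * (- c) ^+ (n - l)) else 0.
Proof.
have e : (-1 : {poly R}) ^+ n = ((-1) ^+ n)%:P by rewrite rmorphXn rmorphN /= polyC1.
rewrite coefB -opprD [(- (_ + _)) ^+ n]exprNn e coefCM -polyCN !coef_XaddC_exp.
have [nl|ln] := ltnP n l; first by rewrite bin_small// !mul0r !mulr0 subrr if_same.
rewrite [(- c) ^+ _]exprNn; set d := c ^+ _; set C := _%:R.
have -> : (-1) ^+ n = (-1) ^+ (n - l) * (-1) ^+ l :> R by rewrite -exprD subnK.
by rewrite -[(-1) ^+ l]signr_odd; case: odd; rewrite ?expr1 ?expr0; ring.
Qed.

(** The polynomial p is the one defining b_n^(beta), with h = beta / 2. The substitution X + h comes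
    from passing a deformed fermion, the value p(h) from passing e^Theta; their sum depends on b
    only. *)
Lemma comp_odd_part (F : fieldType) (h b : F) (n : nat) :
  2%:R != 0 :> F -> h + h = b -> (0 < n)%N ->
  let p := 2^-1 *: (('X - h%:P) ^+ n - (- 'X - h%:P) ^+ n) in
  2 *: (p \Po ('X + h%:P)) + (2 * p.[h])%:P =
  'X^n - (- 'X - b%:P) ^+ n - ((- b) ^+ n)%:P.
Proof.
move=> h2 hb n0 /=; have d2 : 2 / 2 = 1 :> F by rewrite divff.
have eX : ('X + h%:P) - h%:P = 'X by rewrite addrK.
have eB : - ('X + h%:P) - h%:P = - 'X - b%:P.
  by rewrite -hb polyCD !opprD addrA.
rewrite comp_polyZ scalerA d2 scale1r rmorphB !rmorphXn /=.
rewrite !rmorphB rmorphN /= comp_polyX !comp_polyC eX eB.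
rewrite hornerZ mulrA d2 mul1r hornerD hornerN !horner_exp !hornerE subrr.
have -> : - h - h = - b by rewrite -opprD hb.
rewrite expr0n gtn_eqF// sub0r; congr (_ + _).
by rewrite polyCN rmorphXn.
Qed.

Section Tau.
Local Notation hb := (beta / 2).

(** b_l kills the right vacuum: in each summand one of the two fermions has negative index, and it
    can be placed at the right end. *)
Lemma vev_bos (l : nat) w : odd l -> vev (bos l w) = 0.
Proof.
move=> lo; have lo' : oddz l%:Z by [].
have [A hA] := bosE_exists w w lo'.
have [||-> _] := hA A (A + A)%N; try lia.
rewrite (linZ vev_linear) (lin_sum vev_linear) big1 ?scaler0// => k _.
rewrite (linZ vev_linear); set i := k%:Z - A%:Z.
have -> : A%:Z - k%:Z - l%:Z = - i - l%:Z by lia.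
clearbody i; have [i0|i0] := ltP i 0; first by rewrite vev_phiN ?scaler0.
rewrite phi_anticomm; last by case: (l) lo => [//|l' _]; lia.
rewrite (linN vev_linear) vev_phiN ?oppr0 ?scaler0//.
by case: (l) lo => [//|l' _]; lia.
Qed.

Definition ephib (a : int) (w : fockE) : fockE := exp_Theta (phib a w).

Lemma ephib_linear a : linear (ephib a).
Proof. by move=> c u v; rewrite /ephib phib_linear exp_Theta_linear. Qed.

Lemma dle_ephib a d w : dle d w -> dle (d - a) (ephib a w).
Proof. by move=> h; apply/dle_exp_Theta/dle_phib. Qed.

(** The two-point function started from an arbitrary w: the vacuum gives [tau3], and the
    coefficients of <0| e^H give [Phi_coef]. *)
Definition corr (w : fockE) (a b : int) : K := vev (ephib b (ephib a w)).

Lemma corr_linear a b : linear ((fun w => corr w a b) : fockE -> K^o).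
Proof.
by move=> c u v; rewrite /corr !ephib_linear vev_linear.
Qed.

Lemma vev_dle_lt0 d w : dle d w -> d < 0 -> vev w = 0.
Proof. by move=> h d0; rewrite (dle_lt0 d0 h) /vev coeff0. Qed.

Lemma corr_gt0 a b d w : dle d w -> d < a + b -> corr w a b = 0.
Proof.
move=> h dab; by apply: (vev_dle_lt0 (dle_ephib b (dle_ephib a h))); lia.
Qed.

Lemma phib_gt a d w : dle d w -> d < a -> phib a w = 0.
Proof. by move=> h da; apply: dle_lt0 (dle_phib a h); lia. Qed.

Lemma corr_gt0l a b d w : dle d w -> d < a -> corr w a b = 0.
Proof.
move=> h da; rewrite /corr; have -> : ephib a w = 0 by apply: dle_lt0 (dle_ephib a h); lia.
by rewrite (lin0 (ephib_linear b)) /vev coeff0.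
Qed.

Lemma actz_lin (V W : lmodType K) (f : V -> W) (p : {poly K}) (Y : int -> V) a :
  linear f -> f (actz p Y a) = actz p (fun k => f (Y k)) a.
Proof.
move=> lf; rewrite /actz /actf (lin_sum lf).
by apply: eq_bigr => k _; rewrite (linZ lf).
Qed.

(** What b_l picks up in passing phi^(beta)(z) e^Theta: the power comes from the fermion, the
    constant from the exponential. *)
Definition tpoly (l : nat) : {poly K} := ('X + hb%:P) ^+ l + (hb ^+ l)%:P.

Lemma ephib_bos a (l : nat) w : odd l ->
  ephib a (bos l w) = bos l (ephib a w) + actz (tpoly l) (ephib^~ w) a.
Proof.
move=> lo; rewrite /ephib phib_bos// (linD exp_Theta_linear) exp_Theta_bos//.
rewrite -addrA; congr (_ + _); rewrite (actz_lin _ _ _ exp_Theta_linear) addrC.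
by rewrite /actz (linD (actf_linear _ _)) actfC opprK.
Qed.

Lemma corr_bos (l : nat) w a b : odd l ->
  corr (bos l w) a b = actz (tpoly l) (fun k => corr w k b : K^o) a +
                       actz (tpoly l) (fun k => corr w a k : K^o) b.
Proof.
move=> lo; rewrite /corr (ephib_bos _ _ lo); set u := ephib a w.
set r := actz _ _ _; rewrite (linD (ephib_linear b)) (ephib_bos _ _ lo).
rewrite !(linD vev_linear) vev_bos// add0r addrC; congr (_ + _).
  rewrite /r (actz_lin _ _ _ (ephib_linear b)).
  by rewrite (actz_lin _ _ _ vev_linear).
by rewrite (actz_lin _ _ _ vev_linear).
Qed.

Lemma bos_poly_coef_even n l : ~~ odd l -> (bos_poly n)`_l = 0.
Proof. by move=> /negPf lo; rewrite coefZ coef_odd_part lo mulr0. Qed.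

Definition varpi (n : nat) : {poly K} :=
  'X^n - (- 'X - beta%:P) ^+ n - ((- beta) ^+ n)%:P.

Lemma varpiE n : (0 < n)%N ->
  2 *: (bos_poly n \Po ('X + hb%:P)) + (2 * (bos_poly n).[hb])%:P = varpi n.
Proof.
by move=> n0; apply: comp_odd_part (natK_neq0 1) half_beta n0.
Qed.

(** Pushing 2 b_n^(beta) to the right vacuum, where it vanishes, leaves its multiplier [varpi n]
    once in z_1 and once in z_2. *)
Lemma corr_bosb n w a b : (0 < n)%N ->
  2 *: (corr (bosb n w) a b : K^o) =
  actz (varpi n) (fun k => corr w k b : K^o) a +
  actz (varpi n) (fun k => corr w a k : K^o) b.
Proof.
move=> n0; rewrite /bosb (lin_sum (corr_linear a b)).
pose q : {poly K} := 2 *: \sum_(l < size (bos_poly n)) (bos_poly n)`_l *: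
   tpoly l.
have -> : varpi n = q.
  rewrite -varpiE// /q.
  transitivity (2 *: (\sum_(l < size (bos_poly n)) (bos_poly n)`_l *: ('X + hb%:P) ^+ l
    + \sum_(l < size (bos_poly n)) (bos_poly n)`_l *: (hb ^+ l)%:P)).
    rewrite scalerDr -comp_polyE; congr (_ + _).
    rewrite horner_coef polyCM -mul_polyC; congr (_ * _).
    by rewrite rmorph_sum; apply: eq_bigr => l _; rewrite /= polyCM mul_polyC.
  by rewrite -big_split; congr (_ *: _); apply: eq_bigr => l _; rewrite /= scalerDr.
rewrite /q /actz !(linZ (actf_linear _ _)) !(lin_sum (actf_linear _ _)).
rewrite -scalerDr -big_split; congr (_ *: _); apply: eq_bigr => l _ /=.
rewrite (linZ (corr_linear a b)) !(linZ (actf_linear _ _)) -scalerDr.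
have [lo|lo] := boolP (odd l); last by rewrite bos_poly_coef_even// !scale0r.
by congr (_ *: _); rewrite corr_bos.
Qed.

(** The two binary digits of the suffixes 3, 2, 1, 0 record whether e^Theta stands after the first
    and after the second fermion. The relations below move the exponentials to the left until <0|
    absorbs them. *)
Definition tau3 (a b : int) : K := corr vac a b.
Definition tau2 (a b : int) : K := vev (phib b (exp_Theta (phib a vac))).
Definition tau1 (a b : int) : K := vev (exp_Theta (phib b (phib a vac))).
Definition tau0 (a b : int) : K := vev (phib b (phib a vac)).

Lemma tau3_rel a b : tau3 (a - 1) b + beta * tau3 a b = tau1 (a - 1) b.
Proof.
rewrite /tau3 /tau1 /corr /ephib.
rewrite -[beta * _]/(beta *: (_ : K^o)) -(linZ vev_linear) -(linD vev_linear).
rewrite -(linZ exp_Theta_linear) -(linD exp_Theta_linear).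
rewrite -(linZ (phib_linear b)) -(linD (phib_linear b)).
by rewrite exp_Theta_phib_rel exp_Theta_vac.
Qed.

Lemma tau1_rel a b : tau1 a (b - 1) + beta * tau1 a b = tau2 a (b - 1).
Proof.
rewrite /tau1 /tau2.
rewrite -[beta * _]/(beta *: (_ : K^o)) -(linZ vev_linear) -(linD vev_linear).
by rewrite exp_Theta_phib_rel.
Qed.

Lemma tau2_rel a b : tau2 (a - 1) b + beta * tau2 a b = tau0 (a - 1) b.
Proof.
rewrite /tau0 /tau2.
rewrite -[beta * _]/(beta *: (_ : K^o)) -(linZ vev_linear) -(linD vev_linear).
rewrite -(linZ (phib_linear b)) -(linD (phib_linear b)).
by rewrite exp_Theta_phib_rel exp_Theta_vac.
Qed.

Lemma phib_vac_gt0 a : 0 < a -> phib a vac = 0.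
Proof. by move=> a0; apply: phib_gt dle_vac a0. Qed.

Lemma tau3_gt0 a b : 0 < a -> tau3 a b = 0.
Proof. exact: corr_gt0l dle_vac. Qed.

Lemma tau3_ltD a b : 0 < a + b -> tau3 a b = 0.
Proof. exact: corr_gt0 dle_vac. Qed.

Lemma tau1_ltD a b : 0 < a + b -> tau1 a b = 0.
Proof.
move=> ab; apply: (vev_dle_lt0 (dle_exp_Theta (dle_phib b (dle_phib a dle_vac)))).
by lia.
Qed.

Lemma tau2_gt0 a b : 0 < a -> tau2 a b = 0.
Proof.
move=> a0; rewrite /tau2 phib_vac_gt0// (lin0 exp_Theta_linear).
by rewrite (lin0 (phib_linear b)) /vev coeff0.
Qed.

Lemma tau0_ltD a b : 0 < a + b -> tau0 a b = 0.
Proof.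
by move=> ab; apply: (vev_dle_lt0 (dle_phib b (dle_phib a dle_vac))); lia.
Qed.

Lemma tau0_lt0 a b : b < 0 -> tau0 a b = 0.
Proof.
case: b => // q _; rewrite /tau0 /phib (lin_sum vev_linear) big_nat big1// => p.
by case: p => // p _; rewrite (linZ vev_linear) vev_phiN ?scaler0.
Qed.

Lemma vev_phi_phi_vac (n m : int) : m < 0 ->
  vev (phi n (phi m vac)) = if (m == - n) && (0 < n) then 2 * (-1) ^ m else 0.
Proof.
move=> m0; case: (ltgtP n 0) => [n0|n0|->]; rewrite ?andbF ?andbT.
- by rewrite vev_phiN.
- rewrite phi_phi vac_phi// linear0 subr0 (linZ vev_linear) vev_vac.
  by rewrite -[_ *: _]/(_ * _) mulr1.
- rewrite phi_phi oppr0 lt_eqF// scale0r sub0r (linN vev_linear).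
  by rewrite vev_phiN ?oppr0.
Qed.

Lemma vev_phi_phi_vac_rel (m n : int) : m < 0 ->
  vev (phi n (phi (m - 1) vac)) + vev (phi (n - 1) (phi m vac)) = 0.
Proof.
move=> m0; rewrite !vev_phi_phi_vac//; last by lia.
have -> : (m - 1 == - n) = (m == - (n - 1)) by lia.
case: eqP => [mn|_]; last by rewrite addr0.
have n1 : 0 < n - 1 by lia.
have n0 : 0 < n by lia.
rewrite n0 n1.
by rewrite /= signzD signzN expr1z; ring.
Qed.

Lemma kap_one a : kap (- a.+1%:Z) a.+1 = 0.
Proof. by rewrite /kap addNr (binz_nat 0) mul0r. Qed.

(** By [vev_phi_phi_vac_rel], z_1 + z_2 annihilates the undeformed two-point series in negative
    degrees of z_1. Shifting both variables by beta / 2 turns this factor into z_1 + z_2 + beta. *)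
Lemma tau0_rel_lt0 a b : a < 0 ->
  tau0 (a - 1) b + tau0 a (b - 1) + beta * tau0 a b = 0.
Proof.
move=> a0; pose q := `|a|%N; pose N := (`|b| + q + q + 3)%N.
(* For a < 0 only undeformed fermions of negative index occur in [phib a], as [vev_phi_phi_vac_rel]
   requires. *)
have kq i : (q <= i)%N -> kap a i = 0.
  move=> qi; rewrite /kap; have -> : a + i%:Z = (i - q)%N%:Z by rewrite /q; lia.
  by rewrite binz_nat bin_small ?mul0r//; rewrite /q in qi *; lia.
have e1 : phib (a - 1) vac + hb *: phib a vac =
    \sum_(i < N) kap a i *: phi (a + i%:Z - 1) vac.
  by apply: phib_shift1 dle_vac _; rewrite /N /q; lia.
have e2 : phib a vac = \sum_(i < N) kap a i *: phi (a + i%:Z) vac.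
  by apply: phibE dle_vac _; rewrite /N /q; lia.
have f1 : tau0 (a - 1) b + hb * tau0 a b =
    \sum_(i < N) \sum_(j < N) (kap a i * kap b j) *
      vev (phi (b + j%:Z) (phi (a + i%:Z - 1) vac)).
  rewrite /tau0 -[hb * _]/(hb *: (_ : K^o)) -(linZ vev_linear) -(linD vev_linear).
  rewrite -(linZ (phib_linear b)) -(linD (phib_linear b)) e1.
  rewrite (lin_sum (phib_linear b)) (lin_sum vev_linear); apply: eq_bigr => i _.
  rewrite (linZ (phib_linear b)) (linZ vev_linear).
  rewrite (phibE (N := N) (dle_phi _ dle_vac)); last by rewrite /N /q; lia.
  rewrite (lin_sum vev_linear) scaler_sumr; apply: eq_bigr => j _.
  by rewrite (linZ vev_linear) scalerA.
have f2 : tau0 a (b - 1) + hb * tau0 a b =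
    \sum_(i < N) \sum_(j < N) (kap a i * kap b j) *
      vev (phi (b + j%:Z - 1) (phi (a + i%:Z) vac)).
  rewrite /tau0 -[hb * _]/(hb *: (_ : K^o)) -(linZ vev_linear) -(linD vev_linear).
  rewrite (@phib_shift1 _ _ _ N (dle_phib a dle_vac)); last by rewrite /N /q; lia.
  rewrite (lin_sum vev_linear) exchange_big; apply: eq_bigr => j _.
  rewrite (linZ vev_linear) e2 linear_sum (lin_sum vev_linear) scaler_sumr.
  apply: eq_bigr => i _; rewrite linearZ /= (linZ vev_linear).
  by rewrite scalerA [kap b j * _]mulrC.
(* One half of beta goes to each variable, completing its shift. *)
transitivity ((tau0 (a - 1) b + hb * tau0 a b) + (tau0 a (b - 1) + hb * tau0 a b)).
  by rewrite -[in LHS]half_beta; ring.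
rewrite f1 f2 -big_split big1// => i _; rewrite -big_split big1// => j _ /=.
case: (ltnP i q) => iq; last by rewrite kq// !mul0r addr0.
by rewrite -mulrDr vev_phi_phi_vac_rel ?mulr0//; rewrite /q in iq; lia.
Qed.

Lemma phib0_vac : phib 0 vac = phi 0 vac.
Proof. by rewrite (@phibE _ _ _ 1 dle_vac)// big_ord1 kap0 scale1r addr0. Qed.

Lemma phi0_phi0_vac : phi 0 (phi 0 vac) = vac.
Proof.
have := phi_clifford 0 0 vac; rewrite addr0 eqxx expr0z mulr1 -mulr2n -scaler_nat.
exact: (scalerI (natK_neq0 1)).
Qed.

Lemma tau0_0 b : tau0 0 b = (b == 0)%:R.
Proof.
rewrite /tau0 phib0_vac; case: (ltgtP b 0) => [b0|b0|->].
- by rewrite -phib0_vac; exact: tau0_lt0.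
- by rewrite -phib0_vac; apply: tau0_ltD; rewrite add0r.
rewrite (@phibE _ 0 _ 1)//; last by rewrite -[X in dle X]subr0; exact: dle_phi dle_vac.
by rewrite big_ord1 kap0 scale1r addr0 phi0_phi0_vac vev_vac.
Qed.

Lemma phibN1_vac : phib (-1) vac = phi (-1) vac.
Proof.
rewrite (@phibE _ _ _ 2 dle_vac)// big_ord_recr big_ord1 /= kap0 scale1r addr0.
by rewrite -[-1]/(- 1%:Z) kap_one scale0r addr0.
Qed.

Lemma tau0_N1 b : tau0 (-1) b = - (b == 1)%:R * 2 - beta * (b == 0)%:R.
Proof.
have h1 : dle 1 (phi (-1) vac) by apply: dleW (dle_phi _ dle_vac) _.
have [b0|] := ltP b 0.
  have [-> ->] : (b == 1) = false /\ (b == 0) = false by split; lia.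
  by rewrite tau0_lt0//=; ring.
case: b => // [[|[|b]]] _.
- rewrite /tau0 phibN1_vac (@phibE _ 1 _ 2)//.
  rewrite big_ord_recr big_ord1 /= kap0 scale1r addr0 (linD vev_linear).
  rewrite (linZ vev_linear) !vev_phi_phi_vac//=.
  rewrite /kap (binz_nat 1) bin1 expr1 mul1r signzN expr1z.
  by rewrite -[in RHS]half_beta -[_ *: _]/(_ * _); ring.
- rewrite /tau0 phibN1_vac (@phibE _ 1 _ 1)// big_ord1 kap0 scale1r addr0.
  by rewrite vev_phi_phi_vac//= signzN expr1z; ring.
by rewrite tau0_ltD//=; ring.
Qed.

(** The boundary case a = 0 is computed from [tau0_N1] and [tau0_0], and contributes a single source
    term. *)
Lemma tau0_rel a b : a <= 0 ->
  tau0 (a - 1) b + tau0 a (b - 1) + beta * tau0 a b =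
  - ((a == 0) && (b == 1))%:R.
Proof.
move=> a0; have [->|an0] := eqVneq a 0; last first.
  by rewrite tau0_rel_lt0 ?oppr0//; lia.
rewrite sub0r tau0_N1 !tau0_0 subr_eq0 /=; ring.
Qed.

End Tau.

(** * The action of the exponential of H *)

Section Monomials.
Local Open Scope nat_scope.

Definition degm (m : monom) : nat := size (enum_mset m).

Definition bnd (N : nat) (m : monom) : bool := all (fun i => i < N) (enum_mset m).

Lemma degmD (a b : monom) : degm (a `+` b)%mset = degm a + degm b.
Proof.
rewrite /degm -size_cat; apply: perm_size; apply/allP => x _ /=.
by rewrite count_cat !count_mem_mset msetE2.
Qed.

Lemma degm_msetn n i : degm (msetn n i) = n.
Proof. by rewrite /degm enum_msetn size_nseq. Qed.

Lemma degm0 : degm mset0 = 0.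
Proof. by rewrite /degm enum_mset0. Qed.

Lemma degm_eq0 (m : monom) : (degm m == 0) = (m == mset0).
Proof. by rewrite /degm size_mset_eq0. Qed.

Lemma degmB (a m : monom) : (a `<=` m)%mset -> degm (m `\` a)%mset = degm m - degm a.
Proof. by move=> am; rewrite -{2}(msetBDK am) degmD addnK. Qed.

Lemma degm_sub (a m : monom) : (a `<=` m)%mset -> degm a <= degm m.
Proof. by move=> am; rewrite -(msetBDK am) degmD leq_addl. Qed.

Lemma bndP N (m : monom) : reflect (forall i, N <= i -> m i = 0) (bnd N m).
Proof.
apply: (iffP allP) => [h i Ni|h i im]; last first.
  by rewrite ltnNge; apply/negP => /h/eqP; rewrite mset_eq0 im.
by apply/eqP; rewrite mset_eq0; apply/negP => /h /=; rewrite ltnNge Ni.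
Qed.

Lemma bndD N (a b : monom) : bnd N (a `+` b)%mset = bnd N a && bnd N b.
Proof.
apply/bndP/andP => [h|[/bndP ha /bndP hb] i Ni]; last first.
  by rewrite msetE2 ha// hb.
split; apply/bndP => i /h; rewrite msetE2 => /eqP; rewrite addn_eq0.
  by move=> /andP[/eqP].
by move=> /andP[_ /eqP].
Qed.

Lemma bnd_sub N (a m : monom) : (a `<=` m)%mset -> bnd N m -> bnd N a.
Proof. by move=> am; rewrite -(msetBDK am) bndD => /andP[]. Qed.

Lemma bndB N (a m : monom) : (a `<=` m)%mset -> bnd N m -> bnd N (m `\` a)%mset.
Proof. by move=> am; rewrite -{1}(msetBDK am) bndD => /andP[]. Qed.

Lemma bnd_exists (m : monom) : exists N, bnd N m.
Proof.
rewrite /bnd; elim: (enum_mset m) => [|a s [N IH]]; first by exists 0.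
exists (maxn a.+1 N); rewrite /= leq_maxl /=.
by apply: sub_all IH => i iN; exact: leq_trans iN (leq_maxr _ _).
Qed.

Lemma bndW N N' (m : monom) : N <= N' -> bnd N m -> bnd N' m.
Proof. by move=> NN /allP h; apply/allP => i /h hi; exact: leq_trans hi NN. Qed.

Lemma msub_split (a b m : monom) :
  (a `<=` m)%mset && (b `<=` m `\` a)%mset = (a `+` b `<=` m)%mset.
Proof.
apply/andP/idP => [[am bm]|abm].
  by rewrite -(msetBDK am) msetDC msetSD.
have am : (a `<=` m)%mset.
  by apply: msubset_trans abm; apply/msubsetP => x; rewrite msetE2 leq_addr.
split=> //; apply/msubsetP => x; have /msubsetP/(_ x) := abm.
by rewrite !msetE2; lia.
Qed.

End Monomials.

Section Convolution.

Lemma conv_sub (V : lmodType K) (f : series) (g : monom -> V) (m : monom) :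
  conv f g m = \sum_(a <- fset_set (subm m)) f a *: g (m `\` a)%mset.
Proof.
rewrite (convE _ _ (msubset_refl m)) !big_seq; apply: eq_bigr => a.
rewrite mem_subm => am.
have bm : (m `\` a)%mset \in fset_set (subm m).
  by rewrite mem_subm; apply/msubsetP => x; rewrite msetE2 leq_subr.
rewrite (big_rem _ bm) /= msetBDKC// eqxx big1_seq ?addr0// => b /andP[_].
rewrite mem_rem_uniq ?fset_uniq// inE => /andP[ba _].
case: eqP => // abm; case/negP: ba; apply/eqP/msetP => x.
by rewrite -abm !msetE2 addKn.
Qed.

Lemma psumE n (a : monom) N : (0 < n)%N -> bnd N a ->
  psum n a = \sum_(i < N) (a == msetn n (i : nat))%:R.
Proof.
move=> n0 /bndP ba; rewrite /psum; apply: fsbig_nat => i Ni.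
case: eqP => // /(congr1 (fun m : monom => m i)); rewrite msetnxx ba//.
by move=> n0'; rewrite -n0' in n0.
Qed.

Lemma conv_psum (V : lmodType K) n (G : monom -> V) (m : monom) N :
  (0 < n)%N -> bnd N m ->
  conv (psum n) G m = \sum_(i < N)
    (if (msetn n (i : nat) `<=` m)%mset then G (m `\` msetn n (i : nat))%mset else 0).
Proof.
move=> n0 bm; rewrite conv_sub.
transitivity (\sum_(a <- fset_set (subm m)) \sum_(i < N)
    ((a == msetn n (i : nat))%:R : K) *: G (m `\` a)%mset).
  rewrite !big_seq; apply: eq_bigr => a; rewrite mem_subm => am.
  by rewrite (psumE n0 (bnd_sub am bm)) scaler_suml.
rewrite exchange_big; apply: eq_bigr => i _ /=.
rewrite -mem_subm; have [im|im] := boolP (_ \in _); last first.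
  rewrite big_seq big1// => a am; case: eqP => [e|_]; last by rewrite scale0r.
  by rewrite e (negPf im) in am.
rewrite (big_rem _ im) /= eqxx scale1r big1_seq ?addr0// => a /andP[_].
rewrite mem_rem_uniq ?fset_uniq// inE => /andP[/negPf-> _].
by rewrite scale0r.
Qed.

End Convolution.

(** * Exponentials of commuting operators with monomial coefficients *)

Section ExpFlow.
Variables (V : lmodType K) (I : finType) (e : I -> monom) (B : I -> V -> V).
Hypothesis linB : forall p, linear (B p).
Hypothesis commB : forall p q v, B p (B q v) = B q (B p v).
Hypothesis deg_e : forall p, (0 < degm (e p))%N.

(** Multiplication of W by the operator series sum_p c_p x^(e_p) B_p. With [cdeg] it plays the role
    of H, with [cone] that of the Euler derivative of H, since that derivative multiplies x^(e_p) by
    its degree. *)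
Definition flow (c : I -> K) (W : monom -> V) (m : monom) : V :=
  \sum_(p : I) if (e p `<=` m)%mset then c p *: B p (W (m `\` e p)%mset) else 0.

Definition cdeg (p : I) : K := (degm (e p))%:R^-1.
Definition cone (p : I) : K := 1.

Lemma flow_eq c W W' m : (forall m', (m' `<=` m)%mset -> W m' = W' m') ->
  flow c W m = flow c W' m.
Proof.
move=> h; apply: eq_bigr => p _; case: ifP => // pm; rewrite h//.
by apply/msubsetP => x; rewrite msetE2 leq_subr.
Qed.

Lemma flow_degZ W m : (degm m)%:R *: flow cdeg W m =
  flow cone W m + flow cdeg (fun m' => (degm m')%:R *: W m') m.
Proof.
rewrite /flow scaler_sumr -big_split; apply: eq_bigr => p _ /=.
case: ifP => pm; last by rewrite scaler0 addr0.
rewrite (linZ (linB p)) scale1r scaler_swap -[X in X + _]scale1r.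
have d0 : (degm (e p))%:R != 0 :> K by rewrite natK_eq0 -lt0n.
rewrite -[X in X *: _ + _](mulVf d0) -[in RHS]scalerA -scalerDr -scalerDl.
by congr (_ *: (_ *: _)); rewrite -natrD degmB// addnC subnK// degm_sub.
Qed.

Lemma flowZ c (a : K) W m : flow c (fun m' => a *: W m') m = a *: flow c W m.
Proof.
rewrite /flow scaler_sumr; apply: eq_bigr => p _.
by case: ifP => _; rewrite ?scaler0// (linZ (linB p)) scaler_swap.
Qed.

Lemma flow_sum c J (W : nat -> monom -> V) m :
  flow c (fun m' => \sum_(j < J) W j m') m = \sum_(j < J) flow c (W j) m.
Proof.
rewrite /flow exchange_big; apply: eq_bigr => p _ /=.
case: ifP => _; last by rewrite big1.
by rewrite (lin_sum (linB p)) scaler_sumr.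
Qed.

Lemma flow_comm c c' W m : flow c (flow c' W) m = flow c' (flow c W) m.
Proof.
have E (a b : I -> K) : flow a (flow b W) m = \sum_p \sum_q
    if (e p `+` e q `<=` m)%mset
    then (a p * b q) *: B p (B q (W (m `\` (e p `+` e q))%mset)) else 0.
  rewrite /flow; apply: eq_bigr => p _; case: ifP => pm; last first.
    by rewrite big1// => q _; rewrite -msub_split pm.
  rewrite (lin_sum (linB p)) scaler_sumr; apply: eq_bigr => q _.
  rewrite -msub_split pm /=; case: ifP => _.
    by rewrite (linZ (linB p)) scalerA msetBDA.
  by rewrite (lin0 (linB p)) scaler0.
rewrite !E exchange_big; apply: eq_bigr => p _; apply: eq_bigr => q _ /=.
by rewrite msetDC commB mulrC.
Qed.

Variable v : V.
Definition init (m : monom) : V := if m == mset0 then v else 0.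

Lemma iter_flow_eq0 j m : (degm m < j)%N -> iter j (flow cdeg) init m = 0.
Proof.
elim: j m => // j IH m mj; rewrite iterS {1}/flow big1// => p _.
case: ifP => // pm; rewrite IH ?(lin0 (linB p)) ?scaler0// degmB//.
by have := deg_e p; have := degm_sub pm; lia.
Qed.

(** The Euler derivative of H^(j+1) applied to a constant vector: H' can be pulled to the front
    because the operators commute. *)
Lemma iter_flow_deg j m : (degm m)%:R *: iter j.+1 (flow cdeg) init m =
  j.+1%:R *: flow cone (iter j (flow cdeg) init) m.
Proof.
elim: j m => [|j IH] m.
  rewrite iterS flow_degZ scale1r [X in _ + X](_ : _ = 0) ?addr0//.
  rewrite /flow big1// => p _; case: ifP => // _.
  rewrite /= /init; case: eqP => [->|_]; last by rewrite scaler0 (lin0 (linB p)) scaler0.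
  by rewrite degm0 scale0r (lin0 (linB p)) scaler0.
rewrite iterS flow_degZ [X in _ + X](_ : _ =
    flow cdeg (fun m' => j.+1%:R *: flow cone (iter j (flow cdeg) init) m') m).
  rewrite flowZ flow_comm -[X in X + _]scale1r -scalerDl.
  by have -> : 1 + j.+1%:R = j.+2%:R :> K by rewrite [RHS]mulrS.
by apply: flow_eq => m' _; rewrite IH.
Qed.

Definition expflow J (m : monom) : V :=
  \sum_(j < J) (j`!%:R)^-1 *: iter j (flow cdeg) init m.

Lemma expflow_widen J J' m : (degm m < J)%N -> (J <= J')%N ->
  expflow J m = expflow J' m.
Proof.
move=> mJ JJ; rewrite /expflow.
rewrite (big_ord_widen J' (fun j => (j`!%:R)^-1 *: iter j (flow cdeg) init m) JJ).
rewrite big_mkcond; apply: eq_bigr => j _ /=; case: ltnP => // Jj.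
by rewrite iter_flow_eq0 ?scaler0// (leq_trans mJ).
Qed.

Lemma expflow_ode J m : (degm m < J)%N ->
  (degm m)%:R *: expflow J m = flow cone (expflow J) m.
Proof.
case: J => // J mJ; rewrite {1}/expflow big_ord_recl scalerDr.
rewrite [X in X + _](_ : _ = 0) ?add0r; last first.
  rewrite invr1 scale1r /= /init; case: eqP => [->|_]; last by rewrite scaler0.
  by rewrite degm0 scale0r.
rewrite scaler_sumr.
transitivity (flow cone (expflow J) m); last first.
  (* Dividing by x^(e_p) lowers the degree, so one term of the exponential fewer suffices there. *)
  apply: eq_bigr => p _; case: ifP => // pm; rewrite (@expflow_widen J J.+1)//.
  by rewrite degmB//; have := deg_e p; have := degm_sub pm; lia.
rewrite -[flow cone (expflow J) m]/(flow cone (fun m' => \sum_(j < J)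
  (j`!%:R)^-1 *: iter j (flow cdeg) init m') m).
rewrite (flow_sum cone J (fun j m' => (j`!%:R)^-1 *: iter j (flow cdeg) init m')).
apply: eq_bigr => j _.
rewrite scaler_swap lift0 iter_flow_deg scalerA flowZ; congr (_ *: _).
by have := factS_cancel 1 (natK_neq0 j); rewrite !mulr1.
Qed.

Lemma expflow0 J : (0 < J)%N -> expflow J mset0 = v.
Proof.
case: J => // J _; rewrite /expflow big_ord_recl big1 => [|j _].
  by rewrite invr1 scale1r addr0 /= /init eqxx.
by rewrite iter_flow_eq0 ?scaler0// degm0.
Qed.

End ExpFlow.

Lemma scale_swap_eq (R : idomainType) (V : lmodType R) (a b : R) (u v : V) :
  (a != 0 -> b != 0 -> u = v) -> (b * a) *: u = (a * b) *: v.
Proof.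
have [->|a0] := eqVneq a 0; first by rewrite mulr0 mul0r !scale0r.
have [->|b0] := eqVneq b 0; first by rewrite mulr0 mul0r !scale0r.
by move=> ->//; rewrite mulrC.
Qed.

Section ExpH.

Lemma bosb_linear n : linear (bosb n).
Proof.
move=> c u v; rewrite /bosb scaler_sumr -big_split; apply: eq_bigr => l _ /=.
have [lo|lo] := boolP (odd l); last by rewrite bos_poly_coef_even// !scale0r scaler0 addr0.
have lo' : oddz (l : nat)%:Z by [].
by rewrite (bos_linear lo') scalerDr scaler_swap.
Qed.

Lemma bosb_comm n m w : bosb n (bosb m w) = bosb m (bosb n w).
Proof.
have E a b : bosb a (bosb b w) = \sum_(k < size (bos_poly a))
    \sum_(l < size (bos_poly b)) ((bos_poly a)`_k * (bos_poly b)`_l) *: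
       bos k (bos l w).
  rewrite {1}/bosb; apply: eq_bigr => k _.
  have [ko|ko] := boolP (odd k); last first.
    rewrite bos_poly_coef_even// scale0r big1// => l _.
    by rewrite mul0r scale0r.
  have ko' : oddz (k : nat)%:Z by [].
  rewrite /bosb (lin_sum (bos_linear ko')) scaler_sumr; apply: eq_bigr => l _.
  by rewrite (linZ (bos_linear ko')) scalerA.
rewrite !E exchange_big; apply: eq_bigr => k _; apply: eq_bigr => l _ /=.
apply: scale_swap_eq => k0 l0.
have ko : odd k by apply: contraNT k0 => /bos_poly_coef_even ->.
have lo : odd l by apply: contraNT l0 => /bos_poly_coef_even ->.
rewrite bos_comm//; case: eqP => [kl|_]; last by rewrite scale0r addr0.
by case: (nat_of_ord k) ko kl => // k' _; lia.
Qed.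

Section Fixed.
Variables N D : nat.
Let I : finType := ('I_N * 'I_D)%type.
(** H is split into its terms x_i^(n+1) b_(n+1)^(beta), indexed by pairs (i, n); on monomials in N
    variables of degree at most D finitely many pairs matter. *)
Definition he (p : I) : monom := msetn p.2.+1 (p.1 : nat).
Definition hB (p : I) (w : fockE) : fockE := 2 *: bosb p.2.+1 w.

Lemma hB_linear p : linear (hB p).
Proof. by move=> c u v; rewrite /hB bosb_linear scalerDr scaler_swap. Qed.

Lemma hB_comm p q w : hB p (hB q w) = hB q (hB p w).
Proof.
by rewrite /hB !(linZ (bosb_linear _)) bosb_comm.
Qed.

Lemma deg_he p : (0 < degm (he p))%N.
Proof. by rewrite /he degm_msetn. Qed.

Lemma Hbeta_flow W m : bnd N m -> (degm m <= D)%N ->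
  Hbeta W m = flow he hB (cdeg he) W m.
Proof.
move=> bm mD; rewrite /Hbeta (@fsbig_natP _ (fun n => (0 < n)%N) _ D.+1); last first.
  move=> n n0 Dn; rewrite (conv_psum _ n0 bm) big1 ?scaler0// => i _.
  by case: ifP => // /degm_sub; rewrite degm_msetn; lia.
rewrite big_mkcond big_ord_recl /= add0r scaler_sumr /flow.
rewrite -(pair_bigA _ (fun (i : 'I_N) (n : 'I_D) => if (msetn n.+1 (i : nat) `<=` m)%mset then
   (degm (msetn n.+1 (i : nat)))%:R^-1 *: hB (i, n) (W (m `\` msetn n.+1 (i : nat))%mset) else 0)) /=.
rewrite exchange_big; apply: eq_bigr => n _ /=.
rewrite /bump leq0n add1n (conv_psum _ _ bm)// [_^-1 *: _]scaler_sumr.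
rewrite scaler_sumr; apply: eq_bigr => i _.
case: ifP => _; last by rewrite !scaler0.
by rewrite scaler_swap degm_msetn.
Qed.

Lemma iter_Hbeta_flow j m : bnd N m -> (degm m <= D)%N ->
  iter j Hbeta vacs m = iter j (flow he hB (cdeg he)) (init vac) m.
Proof.
elim: j m => [//|j IH] m bm mD.
rewrite -[LHS]/(Hbeta (iter j Hbeta vacs) m) (Hbeta_flow _ bm mD).
rewrite -[RHS]/(flow he hB (cdeg he) (iter j (flow he hB (cdeg he)) (init vac)) m).
by apply: flow_eq => m' mm; apply: IH; rewrite ?(bnd_sub mm)// (leq_trans (degm_sub mm)).
Qed.

Lemma exp_H_flow m : bnd N m -> (degm m <= D)%N ->
  exp_H vacs m = expflow he hB vac D.+1 m.
Proof.
move=> bm mD; rewrite /exp_H /expflow.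
rewrite (@fsbig_nat _ _ D.+1) => [|j Dj].
  by apply: eq_bigr => j _; rewrite iter_Hbeta_flow.
rewrite iter_Hbeta_flow// (iter_flow_eq0 hB_linear deg_he) ?scaler0//.
exact: leq_ltn_trans Dj.
Qed.

Lemma exp_H_ode m : bnd N m -> (degm m <= D)%N ->
  (degm m)%:R *: exp_H vacs m = \sum_(i < N) \sum_(n < D)
    if (msetn n.+1 (i : nat) `<=` m)%mset
    then 2 *: bosb n.+1 (exp_H vacs (m `\` msetn n.+1 (i : nat))%mset) else 0.
Proof.
move=> bm mD; rewrite exp_H_flow// (expflow_ode hB_linear hB_comm deg_he)//.
rewrite /flow -(pair_bigA _ (fun (i : 'I_N) (n : 'I_D) => if (msetn n.+1 (i : nat) `<=` m)%mset then
   1 *: hB (i, n) (expflow he hB vac D.+1 (m `\` msetn n.+1 (i : nat))%mset) else 0)) /=.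
apply: eq_bigr => i _; apply: eq_bigr => n _; case: ifP => // im.
rewrite scale1r /hB exp_H_flow//; first exact: bndB.
by rewrite degmB//; lia.
Qed.

End Fixed.

Lemma exp_H0 : exp_H vacs mset0 = vac.
Proof.
rewrite (@exp_H_flow 0 0) ?degm0// ?expflow0//; [exact: hB_linear|exact: deg_he|].
by rewrite /bnd enum_mset0.
Qed.

End ExpH.

(** * The generating function G and its Euler equation *)

Section GSeq.
Variables (R : comNzRingType) (z b : R).

(* Coefficients of (1 + b x) (1 + x (z + b)) / (1 - z x). *)
Definition gseq (k : nat) : R :=
  match k with
  | 0 => 1
  | 1 => 2 * z + 2 * b
  | k'.+2 => z ^+ k' * (2 * z ^+ 2 + 3 * b * z + b ^+ 2)
  end.

(** The coefficient of x^n in x g' / g, where g is the series with coefficients [gseq]. For z = 'X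
    and b = beta it is the multiplier [varpi n] of the bosons. *)
Definition wseq (n : nat) : R := z ^+ n - (- z - b) ^+ n - (- b) ^+ n.

Lemma gseq_step k : gseq k.+3 = z * gseq k.+2.
Proof. by rewrite /= exprS mulrA. Qed.

Lemma wseq_step k : wseq k.+3 + (z + 2 * b) * wseq k.+2 +
   b * (z + b) * wseq k.+1 = z * gseq k.+2.
Proof.
rewrite /wseq /= !exprS; move: (z ^+ k) ((_ - _) ^+ k) ((- b) ^+ k) => A B C.
by ring.
Qed.

(** The coefficient of x^k in x g' = (x g' / g) g. From degree 2 on [gseq] is geometric with ratio
    z, so passing from k to k + 1 multiplies the convolution by z, up to its last terms, which
    [wseq_step] accounts for. *)
Lemma gseq_ode k :
  k%:R * gseq k = \sum_(n < k) wseq n.+1 * gseq (k - n.+1).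
Proof.
case: k => [|[|k]].
- by rewrite big_ord0 mul0r.
- by rewrite big_ord1 mul1r /= mulr1 /wseq !expr1; ring.
elim: k => [|k IH].
  by rewrite big_ord_recr big_ord1 /= mul1r mulr1 /wseq !expr1; ring.
have -> : \sum_(n < k.+3) wseq n.+1 * gseq (k.+3 - n.+1) =
    z * (\sum_(n < k.+2) wseq n.+1 * gseq (k.+2 - n.+1)) +
    (wseq k.+3 + (z + 2 * b) * wseq k.+2 + b * (z + b) * wseq k.+1).
  rewrite 3![in LHS]big_ord_recr [in RHS]big_ord_recr [in RHS]big_ord_recr /=.
  have -> : (k.+3 - k.+1 = 2)%N by lia.
  have -> : (k.+3 - k.+2 = 1)%N by lia.
  have -> : (k.+3 - k.+3 = 0)%N by lia.
  have -> : (k.+2 - k.+1 = 1)%N by lia.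
  have -> : (k.+2 - k.+2 = 0)%N by lia.
  have -> : \sum_(i < k) wseq i.+1 * gseq (k.+3 - i.+1) =
     z * \sum_(i < k) wseq i.+1 * gseq (k.+2 - i.+1).
    rewrite mulr_sumr; apply: eq_bigr => i _; rewrite mulrCA; congr (_ * _).
    have ik := ltn_ord i.
    have -> : (k.+3 - i.+1 = (k - i.+1).+3)%N by lia.
    have -> : (k.+2 - i.+1 = (k - i.+1).+2)%N by lia.
    exact: gseq_step.
  rewrite /=; move: (\sum_(_ < _) _) (wseq _) (wseq _) (wseq _) => S A B C.
  by ring.
by rewrite wseq_step -IH gseq_step -natr1; ring.
Qed.

End GSeq.

Local Notation gp := (gseq ('X : {poly K}) beta%:P).

Lemma size_gp k : (size (gp k) <= k.+1)%N.
Proof.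
have h2 (c : {poly K}) : (size c <= 1)%N -> (size (c * 'X)%R <= 2)%N.
  have [->|c0] := eqVneq c 0; first by rewrite mul0r size_poly0.
  by rewrite size_mulX.
have e n : n%:R = (n%:R)%:P :> {poly K} by rewrite polyC_natr.
case: k => [|[|k]]; first by rewrite size_poly1.
  apply: (leq_trans (size_polyD _ _)); rewrite geq_max h2 ?e ?size_polyC_leq1//.
  by rewrite -polyCM (leq_trans (size_polyC_leq1 _)).
rewrite /= (leq_trans (size_polyMleq _ _))// size_polyXn /=.
suff : (size (2 * 'X^2 + 3 * beta%:P * 'X + beta%:P ^+ 2)%R <= 3)%N.
  by move: (size _) => s; lia.
rewrite (leq_trans (size_polyD _ _))// geq_max (leq_trans (size_polyD _ _)) ?geq_max.
  by rewrite -rmorphXn (leq_trans (size_polyC_leq1 _)).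
rewrite [X in _ && X](leq_trans (h2 _ _)) ?e -?polyCM ?size_polyC_leq1//.
by rewrite mul_polyC (leq_trans (size_scale_leq _ _))// size_polyXn.
Qed.

(** The coefficient of the monomial m in G, the product over i of (1 + beta x_i) (1 + (z + beta)
    x_i) / (1 - z x_i), as a polynomial in z. *)
Definition Gp (m : monom) : {poly K} := \prod_(i <- finsupp m) gp (m i).

Lemma big_finsupp (R : Type) (idx : R) (op : Monoid.com_law idx) (F : nat -> R)
    N (m : monom) : bnd N m -> (forall i, m i = 0%N -> F i = idx) ->
  \big[op/idx]_(i <- finsupp m) F i = \big[op/idx]_(i < N) F i.
Proof.
move=> /bndP bm F0; rewrite -(big_mkord xpredT F).
rewrite [RHS](bigID (fun i => i \in finsupp m)) /= [X in _ = op _ X]big1 => [|i].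
  rewrite Monoid.mulm1 -[RHS]big_filter; apply: perm_big; apply: uniq_perm.
  - exact: fset_uniq.
  - by rewrite filter_uniq// iota_uniq.
  move=> i; rewrite mem_filter mem_index_iota /=; case: (boolP (_ \in _)) => //=.
  rewrite multiset.msuppE => im; apply/esym; rewrite ltnNge.
  by apply/negP => /bm /eqP; rewrite mset_eq0 im.
by rewrite multiset.msuppE -mset_eq0 => /eqP /F0.
Qed.

Lemma GpE N m : bnd N m -> Gp m = \prod_(i < N) gp (m i).
Proof.
move=> bm; rewrite /Gp (big_finsupp _ (F := fun i => gp (m i)) bm)// => i ->.
by [].
Qed.

Lemma degmE N (m : monom) : bnd N m -> degm m = (\sum_(i < N) m i)%N.
Proof. by move=> bm; rewrite /degm size_mset (big_finsupp _ bm). Qed.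

Lemma msetn_sub n (i : nat) (m : monom) : (0 < n)%N ->
  (msetn n i `<=` m)%mset = (n <= m i)%N.
Proof.
move=> n0; apply/msubsetP/idP => [/(_ i)|h x]; first by rewrite msetnxx.
by rewrite msetnE; case: eqP => [->|].
Qed.

Lemma size_Gp m : (size (Gp m) <= (degm m).+1)%N.
Proof.
have [N bm] := bnd_exists m; rewrite (GpE bm) (degmE bm).
elim/big_rec2: _ => [|i p d _ IH]; first by rewrite size_poly1.
rewrite (leq_trans (size_polyMleq _ _))//.
by move: (size_gp (m i)) IH; move: (size _) (size _) => x y; lia.
Qed.

Lemma varpi_wseq n : varpi n = wseq 'X beta%:P n.
Proof. by rewrite /varpi /wseq rmorphXn rmorphN. Qed.

Lemma Gp_ode N D (m : monom) : bnd N m -> (degm m <= D)%N ->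
  (degm m)%:R * Gp m = \sum_(i < N) \sum_(n < D)
    if (msetn n.+1 (i : nat) `<=` m)%mset
    then varpi n.+1 * Gp (m `\` msetn n.+1 (i : nat))%mset else 0.
Proof.
move=> bm mD; rewrite {1}(degmE bm) natr_sum mulr_suml; apply: eq_bigr => i _.
rewrite (GpE bm) (bigD1 i)//= mulrA gseq_ode mulr_suml.
have miD : (m i <= D)%N.
  by rewrite (leq_trans _ mD)// (degmE bm) (bigD1 i)//= leq_addr.
rewrite (big_ord_widen D (fun n => wseq 'X beta%:P n.+1 * gp (m i - n.+1) *
   \prod_(i0 < N | i0 != i) gp (m i0)) miD) big_mkcond.
apply: eq_bigr => n _; rewrite msetn_sub//; case: ifP => // im.
have bm' : bnd N (m `\` msetn n.+1 (i : nat))%mset.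
  by apply: bndB bm; rewrite msetn_sub.
rewrite varpi_wseq -mulrA (GpE bm') [in RHS](bigD1 i)//= msetE2 msetnxx.
congr (_ * (_ * _)); apply: eq_bigr => j ji.
rewrite msetE2 msetnE; case: eqP => [ij|_]; last by rewrite subn0.
by case/negP: ji; apply/eqP/val_inj.
Qed.

Lemma Gp0 : Gp mset0 = 1.
Proof. by rewrite (@GpE 0) ?big_ord0// /bnd enum_mset0. Qed.

Section Bilinear.
Variable Y : int -> int -> K.

Definition act2 (p q : {poly K}) (a b : int) : K :=
  actz p (fun k => actz q (fun l => Y k l : K^o) b : K^o) a.

Lemma act2E p q a b : act2 p q a b =
  \sum_(k < size p) \sum_(l < size q) p`_k * q`_l * Y (a - k%:Z) (b - l%:Z).
Proof.
rewrite /act2 /actz /actf; apply: eq_bigr => k _.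
rewrite -[_ *: _]/(_ * _) mulr_sumr; apply: eq_bigr => l _.
rewrite -[_ *: _]/(_ * _) mulrA; congr (_ * Y _ _); lia.
Qed.

Lemma act2_linl q a b : linear ((fun p => act2 p q a b) : {poly K} -> K^o).
Proof. by move=> c u v; rewrite /act2 /actz actf_linear. Qed.

Lemma actzM (V : lmodType K) p q (Z : int -> V) a :
  actz (p * q) Z a = actz p (actz q Z) a.
Proof.
by rewrite /actz actfM; apply: eq_actf => n; rewrite /actz opprK.
Qed.

Lemma act2Ml r p q a b :
  act2 (r * p) q a b = actz r (fun k => act2 p q k b : K^o) a.
Proof. by rewrite /act2 actzM. Qed.

End Bilinear.

Lemma act2_swap Y p q a b : act2 Y p q a b = act2 (fun k l => Y l k) q p b a.
Proof.
rewrite /act2 /actz /actf; under eq_bigr do rewrite scaler_sumr.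
rewrite exchange_big; apply: eq_bigr => l _; rewrite scaler_sumr.
by apply: eq_bigr => k _; rewrite scaler_swap.
Qed.

Lemma sum_subm_shift (V : zmodType) (e m : monom) (F : monom -> monom -> V) :
  \sum_(q <- fset_set (subm m))
     (if (e `<=` q)%mset then F (q `\` e)%mset (m `\` q)%mset else 0) =
  if (e `<=` m)%mset then \sum_(q <- fset_set (subm (m `\` e)%mset))
     F q ((m `\` e) `\` q)%mset else 0.
Proof.
case: ifP => em; last first.
  rewrite big_seq big1// => q; rewrite mem_subm => qm; case: ifP => // eq.
  by rewrite (msubset_trans eq qm) in em.
rewrite -big_mkcond /= -big_filter.
rewrite (perm_big [seq (e `+` q)%mset | q <- fset_set (subm (m `\` e)%mset)]) /=.
  rewrite big_map; apply: eq_bigr => q _; congr (F _ _).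
    by apply/msetP => x; rewrite !msetE2 addKn.
  by rewrite msetBDA.
apply: uniq_perm; first by rewrite filter_uniq// fset_uniq.
  rewrite map_inj_uniq ?fset_uniq// => q q' /msetP h; apply/msetP => x.
  by have := h x; rewrite !msetE2 => /addnI.
move=> q; rewrite mem_filter mem_subm; apply/andP/mapP => [[eq qm]|[q']].
  exists (q `\` e)%mset; last by rewrite msetBDKC.
  rewrite mem_subm; apply/msubsetP => x; have /msubsetP/(_ x) := qm.
  by rewrite !msetE2; lia.
rewrite mem_subm => q'm ->; split.
  by apply/msubsetP => x; rewrite msetE2 leq_addr.
by rewrite -msub_split em.
Qed.

Lemma sum_subm_swap (V : zmodType) (m : monom) (F : monom -> monom -> V) :
  \sum_(q <- fset_set (subm m)) F q (m `\` q)%mset =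
  \sum_(q <- fset_set (subm m)) F (m `\` q)%mset q.
Proof.
rewrite (perm_big [seq (m `\` q)%mset | q <- fset_set (subm m)]) /=.
  rewrite big_map !big_seq; apply: eq_bigr => q; rewrite mem_subm => qm.
  by rewrite msetBBK.
apply: uniq_perm; first exact: fset_uniq.
  rewrite map_inj_in_uniq ?fset_uniq// => q q'; rewrite !mem_subm => qm q'm h.
  by rewrite -(msetBBK qm) h msetBBK.
move=> q; rewrite mem_subm; apply/idP/mapP => [qm|[q' _ ->]].
  exists (m `\` q)%mset; last by rewrite msetBBK.
  by rewrite mem_subm msubsetDl.
exact: msubsetDl.
Qed.

(** The coefficient of m and z_1^a z_2^b in G(z_1) G(z_2) times the series with coefficients Y. *)
Definition Rsum (Y : int -> int -> K) (m : monom) (a b : int) : K :=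
  \sum_(q <- fset_set (subm m)) act2 Y (Gp q) (Gp (m `\` q)%mset) a b.

Lemma Rsum_swap Y m a b : Rsum (fun k l => Y l k) m b a = Rsum Y m a b.
Proof.
rewrite /Rsum (sum_subm_swap m (fun q q' => act2 _ (Gp q) (Gp q') b a)).
by apply: eq_bigr => q _; rewrite [RHS]act2_swap.
Qed.

Lemma Rsum_ode_l Y N D m a b : bnd N m -> (degm m <= D)%N ->
  \sum_(q <- fset_set (subm m)) (degm q)%:R * act2 Y (Gp q) (Gp (m `\` q)%mset) a b =
  \sum_(i < N) \sum_(n < D) if (msetn n.+1 (i : nat) `<=` m)%mset
    then actz (varpi n.+1) (fun k => Rsum Y (m `\` msetn n.+1 (i : nat))%mset k b : K^o) a
    else 0.
Proof.
move=> bm mD.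
transitivity (\sum_(q <- fset_set (subm m)) \sum_(i < N) \sum_(n < D)
   if (msetn n.+1 (i : nat) `<=` q)%mset then
     act2 Y (varpi n.+1 * Gp (q `\` msetn n.+1 (i : nat))%mset) (Gp (m `\` q)%mset) a b
   else 0).
  rewrite !big_seq; apply: eq_bigr => q; rewrite mem_subm => qm.
  rewrite -[LHS]/(_ *: (act2 _ _ _ _ _ : K^o)) -(linZ (act2_linl Y _ a b)).
  rewrite scaler_nat -mulr_natl.
  rewrite (Gp_ode (bnd_sub qm bm) (leq_trans (degm_sub qm) mD)).
  rewrite (lin_sum (act2_linl _ _ _ _)); apply: eq_bigr => i _.
  rewrite (lin_sum (act2_linl _ _ _ _)); apply: eq_bigr => n _.
  by case: ifP => // _; rewrite (lin0 (act2_linl _ _ _ _)).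
rewrite exchange_big; apply: eq_bigr => i _.
rewrite exchange_big; apply: eq_bigr => n _ /=.
rewrite (sum_subm_shift _ _ (fun q q' => act2 Y (varpi n.+1 * Gp q) (Gp q') a b)).
case: ifP => // _; rewrite /Rsum /actz /actf.
under eq_bigr do rewrite act2Ml /actz /actf.
by rewrite exchange_big; apply: eq_bigr => k _; rewrite scaler_sumr.
Qed.

Lemma Rsum_ode Y N D m a b : bnd N m -> (degm m <= D)%N ->
  (degm m)%:R * Rsum Y m a b = \sum_(i < N) \sum_(n < D)
    if (msetn n.+1 (i : nat) `<=` m)%mset
    then actz (varpi n.+1) (fun k => Rsum Y (m `\` msetn n.+1 (i : nat))%mset k b : K^o) a
       + actz (varpi n.+1) (fun l => Rsum Y (m `\` msetn n.+1 (i : nat))%mset a l : K^o) b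
    else 0.
Proof.
move=> bm mD.
transitivity (\sum_(q <- fset_set (subm m)) (degm q)%:R * act2 Y (Gp q) (Gp (m `\` q)%mset) a b +
   \sum_(q <- fset_set (subm m)) (degm q)%:R *
     act2 (fun k l => Y l k) (Gp q) (Gp (m `\` q)%mset) b a).
  rewrite -(sum_subm_swap m (fun q q' => (degm q')%:R *
    act2 (fun k l => Y l k) (Gp q') (Gp q) b a)).
  rewrite /Rsum mulr_sumr -big_split !big_seq; apply: eq_bigr => q /=.
  rewrite mem_subm => qm; rewrite -act2_swap.
  by rewrite -mulrDl -natrD degmB// addnC subnK// degm_sub.
rewrite !(Rsum_ode_l _ _ _ bm mD) -big_split; apply: eq_bigr => i _; rewrite -big_split.
apply: eq_bigr => n _ /=; case: ifP => _; last exact: addr0.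
by congr (_ + _); apply: (@eq_actf K^o) => k; rewrite Rsum_swap.
Qed.

(** Both sides satisfy the same Euler equation in the x_i, with multipliers varpi_n(z_1) +
    varpi_n(z_2) ([corr_bosb] on the left, [Rsum_ode] on the right), and both are [tau3] in degree
    0. As varpi_n only meets monomials of smaller degree, induction on the degree applies. *)
Lemma corr_exp_H m a b : corr (exp_H vacs m) a b = Rsum tau3 m a b.
Proof.
have [D mD] := ubnP (degm m); elim: D m mD a b => // D IH m mD a b.
have [N bm] := bnd_exists m.
have [/eqP m0|m0] := boolP (degm m == 0)%N.
  move/eqP: m0; rewrite degm_eq0 => /eqP ->; rewrite exp_H0 /Rsum.
  have -> : fset_set (subm mset0) = [fset mset0]%fset.
    by apply/fsetP => q; rewrite mem_subm msubset0 !inE.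
  by rewrite big_seq_fset1 msetBxx Gp0 /act2 /actz !actf1 !opprK.
have d0 : (degm m)%:R != 0 :> K by rewrite natK_eq0.
apply: (mulfI d0); rewrite (@Rsum_ode _ N D)//.
rewrite -[LHS]/(_ *: (corr _ a b : K^o)) -(linZ (corr_linear a b)).
rewrite (@exp_H_ode N D)// (lin_sum (corr_linear a b)); apply: eq_bigr => i _.
rewrite (lin_sum (corr_linear a b)); apply: eq_bigr => n _.
case: ifP => im; last by rewrite (lin0 (corr_linear a b)).
rewrite (linZ (corr_linear a b)) corr_bosb//.
have small : (degm (m `\` msetn n.+1 (i : nat))%mset < D)%N.
  by rewrite degmB// degm_msetn; move: mD m0; lia.
by congr (_ + _); apply: (@eq_actf K^o) => k; rewrite IH.
Qed.

(* The coefficient of z^k in                                                  *)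
(* prod_i (1 + beta x_i) (1 + (z + beta) x_i) / (1 - z x_i).                  *)
Definition Gcoef (k : nat) : series := fun m => (Gp m)`_k.

Lemma Gcoef_eq0 k m : (degm m < k)%N -> Gcoef k m = 0.
Proof. by move=> mk; rewrite /Gcoef nth_default// (leq_trans (size_Gp m)). Qed.

Lemma Phi_coefE a b m L : (degm m < L)%N ->
  Phi_coef a b m = \sum_(k < L) \sum_(l < L)
    (Gcoef k * Gcoef l) m * tau3 (a - k%:Z) (b - l%:Z).
Proof.
move=> mL; rewrite -[LHS]/(corr _ a b) corr_exp_H /Rsum.
transitivity (\sum_(q <- fset_set (subm m)) \sum_(k < L) \sum_(l < L)
   (Gp q)`_k * (Gp (m `\` q)%mset)`_l * tau3 (a - k%:Z) (b - l%:Z)).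
  rewrite !big_seq; apply: eq_bigr => q; rewrite mem_subm => qm.
  have s1 : (size (Gp q) <= L)%N.
    by rewrite (leq_trans (size_Gp q))// (leq_ltn_trans (degm_sub qm)).
  have s2 : (size (Gp (m `\` q)%mset) <= L)%N.
    by rewrite (leq_trans (size_Gp _))// (leq_ltn_trans _ mL)// degm_sub// msubsetDl.
  rewrite act2E (big_ord_widen L (fun k => \sum_(l < size (Gp (m `\` q)%mset))
    (Gp q)`_k * (Gp (m `\` q)%mset)`_l * tau3 (a - k%:Z) (b - l%:Z)) s1).
  rewrite big_mkcond; apply: eq_bigr => k _; case: ltnP => [_|qk]; last first.
    by rewrite big1// => l _; rewrite nth_default// !mul0r.
  rewrite (big_ord_widen L (fun l =>
    (Gp q)`_k * (Gp (m `\` q)%mset)`_l * tau3 (a - k%:Z) (b - l%:Z)) s2).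
  rewrite big_mkcond; apply: eq_bigr => l _; case: ltnP => // ql.
  by rewrite [X in _ * X * _]nth_default// mulr0 mul0r.
rewrite exchange_big; apply: eq_bigr => k _; rewrite exchange_big.
apply: eq_bigr => l _ /=; rewrite -mulr_suml; congr (_ * _).
by rewrite -[RHS]/(conv _ (_ : monom -> K^o) m) conv_sub.
Qed.

(** * The integral domain of series *)

Lemma seriesD (f g : series) m : (f + g) m = f m + g m :> K.
Proof. by []. Qed.

Lemma seriesZ (c : K) (f : series) m : (c *: f) m = c * f m :> K.
Proof. by []. Qed.

Lemma seriesM (f g : series) m :
  (f * g) m = \sum_(a <- fset_set (subm m)) f a * g (m `\` a)%mset :> K.
Proof. exact: (conv_sub f (g : monom -> K^o)). Qed.

Lemma series_scaleAl (c : K) (f g : series) : c *: (f * g) = (c *: f) * g.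
Proof.
apply/funext => m; rewrite seriesZ !seriesM mulr_sumr.
by apply: eq_bigr => a _; rewrite mulrA.
Qed.

HB.instance Definition _ := GRing.Lmodule_isLalgebra.Build K series series_scaleAl.
HB.instance Definition _ := GRing.Lalgebra_isComAlgebra.Build K series.

Definition mono (a : monom) : series := fun m => (m == a)%:R.

Lemma mono0 : mono mset0 = 1.
Proof. by []. Qed.

Lemma monoM (a : monom) (f : series) m :
  (mono a * f) m = if (a `<=` m)%mset then f (m `\` a)%mset else 0.
Proof.
rewrite seriesM -(sum_subm1 m a (fun b => f (m `\` b)%mset)).
by apply: eq_bigr => b _; rewrite /mono eq_sym; case: eqP; rewrite ?mul1r ?mul0r.
Qed.

Lemma monoD (a b : monom) : mono (a `+` b)%mset = mono a * mono b.
Proof.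
apply/funext => m; rewrite monoM /mono; case: ifP => am.
  congr (nat_of_bool _)%:R; apply/eqP/eqP => [->|<-]; first by rewrite msetDKB.
  by rewrite msetBDKC.
case: eqP => // e; move/negP: am; case; rewrite e.
by apply/msubsetP => x; rewrite msetE2 leq_addr.
Qed.

Section SeriesOfMpoly.
Variable n : nat.
Implicit Types P Q : {mpoly K[n]}.

Definition mset_of (a : 'X_{1..n}) : monom :=
  \big[msetD/mset0]_(i < n) msetn (a i) (i : nat).

Lemma mset_ofE a x : mset_of a x = (\sum_(i < n) if x == i then a i else 0)%N.
Proof.
rewrite /mset_of (big_morph (fun m : monom => m x) (op1 := addn) (id1 := 0%N)).
- by apply: eq_bigr => i _; rewrite msetnE.
- by move=> m m'; rewrite msetE2.
by rewrite mset0E.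
Qed.

Lemma mset_of_ord a (i : 'I_n) : mset_of a i = a i.
Proof.
rewrite mset_ofE (bigD1 i)//= eqxx big1 ?addn0// => j ji.
by rewrite val_eqE eq_sym (negPf ji).
Qed.

Lemma bnd_mset_of a : bnd n (mset_of a).
Proof.
apply/bndP => x nx; rewrite mset_ofE big1// => i _.
by case: eqP => // e; rewrite e leqNgt ltn_ord in nx.
Qed.

Lemma mset_ofK (m : monom) : bnd n m -> mset_of [multinom m i | i < n] = m.
Proof.
move=> bm; apply/msetP => x; case: (ltnP x n) => xn.
  by rewrite (mset_of_ord _ (Ordinal xn)) mnmE.
by rewrite (bndP _ _ bm)// (bndP _ _ (bnd_mset_of _)).
Qed.

Lemma multinom_mset_of a : [multinom mset_of a i | i < n] = a.
Proof. by apply/mnmP => i; rewrite mnmE mset_of_ord. Qed.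

Lemma degm_mset_of a : degm (mset_of a) = mdeg a.
Proof.
rewrite (degmE (bnd_mset_of a)) mdegE; apply: eq_bigr => i _.
by rewrite mset_of_ord.
Qed.

Lemma mset_ofD a b : mset_of (a + b)%MM = (mset_of a `+` mset_of b)%mset.
Proof.
apply/msetP => x; rewrite msetE2 !mset_ofE -big_split; apply: eq_bigr => i _ /=.
by rewrite mnmDE; case: eqP.
Qed.

Lemma somE P m : series_of_mpoly P m =
  if bnd n m then P@_[multinom m i | i < n] else 0.
Proof. by []. Qed.

Lemma som_coef P a : series_of_mpoly P (mset_of a) = P@_a.
Proof. by rewrite somE bnd_mset_of multinom_mset_of. Qed.

Lemma som_zmod : zmod_morphism (@series_of_mpoly n).
Proof.
move=> P Q; apply/funext => m; rewrite [RHS]/GRing.add /= /GRing.opp /= !somE.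
by case: ifP => _; rewrite ?mcoeffB// subr0.
Qed.

HB.instance Definition _ :=
  GRing.isZmodMorphism.Build _ _ (@series_of_mpoly n) som_zmod.

Lemma somZ c P : series_of_mpoly (c *: P) = c *: series_of_mpoly P.
Proof.
apply/funext => m; rewrite seriesZ !somE.
by case: ifP => _; rewrite ?mcoeffZ ?mulr0.
Qed.

Lemma somX a : series_of_mpoly 'X_[a] = mono (mset_of a).
Proof.
apply/funext => m; rewrite somE /mono; case: ifP => [bm|bm].
  rewrite mcoeffX; congr (nat_of_bool _)%:R; apply/eqP/eqP => [->|->].
    by rewrite mset_ofK.
  by rewrite multinom_mset_of.
by case: eqP => // e; rewrite e bnd_mset_of in bm.
Qed.

Lemma som_monoid : monoid_morphism (@series_of_mpoly n).
Proof.
split=> [|P Q].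
  rewrite -[1]/(1%:MP) mpolyC1 -mpolyX0 somX -mono0; congr mono.
  by apply/msetP => x; rewrite mset_ofE mset0E big1// => i _; rewrite mnm0E if_same.
elim/mpolyind: P => [|c a P _ _ IH]; first by rewrite mul0r raddf0 mul0r.
rewrite mulrDl !raddfD /= mulrDl IH; congr (_ + _) => {P IH}.
rewrite -scalerAl !somZ -scalerAl; congr (_ *: _).
elim/mpolyind: Q => [|d b Q _ _ IH]; first by rewrite mulr0 raddf0 mulr0.
rewrite mulrDr !raddfD /= mulrDr IH; congr (_ + _).
by rewrite -scalerAr !somZ -scalerAr -mpolyXD !somX mset_ofD monoD.
Qed.

HB.instance Definition _ :=
  GRing.isMonoidMorphism.Build _ _ (@series_of_mpoly n) som_monoid.

Lemma somM P Q :
  series_of_mpoly (P * Q) = series_of_mpoly P * series_of_mpoly Q.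
Proof. exact: rmorphM. Qed.

Lemma som_inj : injective (@series_of_mpoly n).
Proof. by move=> P Q e; apply/mpolyP => a; rewrite -!som_coef e. Qed.

Lemma som_finite D (f : series) : exists P, forall m,
  series_of_mpoly P m = if bnd n m && (degm m < D)%N then f m else 0.
Proof.
exists (\sum_(a : 'X_{1..n < D}) f (mset_of a) *: 'X_[a]) => m.
rewrite somE; case: ifP => //= bm.
rewrite raddf_sum /=; set mu := [multinom m i | i < n].
under eq_bigr => a _ do rewrite mcoeffZ mcoeffX.
have dm : degm m = mdeg mu by rewrite -degm_mset_of mset_ofK.
case: ltnP => mD.
  have muD : (mdeg mu < D)%N by rewrite -dm.
  rewrite (bigD1 (BMultinom muD))//= eqxx mulr1 mset_ofK// big1 ?addr0// => a ane.
  rewrite (_ : (_ == _) = false) ?mulr0//; apply: contraNF ane => /eqP e.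
  by apply/eqP/val_inj.
rewrite big1// => a _; rewrite (_ : (_ == _) = false) ?mulr0//.
apply/eqP => e; have := bmdeg a; rewrite e -dm; by rewrite ltnNge mD.
Qed.

End SeriesOfMpoly.

Lemma series_min_deg (f : series) : f != 0 -> exists m,
  f m != 0 /\ forall m', (degm m' < degm m)%N -> f m' = 0.
Proof.
move=> f0; pose p d := `[< exists m, degm m = d /\ f m != 0 >].
have ep : exists d, p d.
  apply: contrapT => h; move/eqP: f0; case; apply/funext => m.
  apply/eqP/negP => /negP fm; apply: h; exists (degm m); apply/asboolP.
  by exists m.
case: (ex_minnP ep) => d /asboolP[m [dm fm]] dmin; exists m; split=> // m' m'd.
apply/eqP/negP => /negP fm'; have : p (degm m') by apply/asboolP; exists m'.
by move/dmin; rewrite -dm leqNgt m'd.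
Qed.

(** The lowest homogeneous components of f and g, cut down to enough variables to remain nonzero,
    are polynomials whose product is a component of f g. *)
Lemma series_idomain (f g : series) : f * g = 0 -> (f == 0) || (g == 0).
Proof.
move=> fg; apply/negP => /negP; rewrite negb_or => /andP[f0 g0].
have [m1 [fm1 fmin]] := series_min_deg f0.
have [m2 [gm2 gmin]] := series_min_deg g0.
have [N] := bnd_exists (m1 `+` m2)%mset; rewrite bndD => /andP[b1 b2].
pose part d (h : series) : series := fun m => if (degm m == d)%N then h m else 0.
have partE d h : exists P : {mpoly K[N]}, forall m,
    series_of_mpoly P m = if bnd N m && (degm m == d)%N then h m else 0.
  have [P PE] := som_finite N d.+1 (part d h); exists P => m.
  rewrite PE /part ltnS; case: (bnd N m) => //=.
  by case: eqP => [->|_]; rewrite ?leqnn// if_same.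
have [P PE] := partE (degm m1) f; have [Q QE] := partE (degm m2) g.
have nz (R : {mpoly K[N]}) m : series_of_mpoly R m != 0 -> R != 0.
  by apply: contraNneq => ->; rewrite raddf0.
have P0 : P != 0 by apply: (nz P m1); rewrite PE b1 (eqxx (degm m1)); exact: fm1.
have Q0 : Q != 0 by apply: (nz Q m2); rewrite QE b2 (eqxx (degm m2)); exact: gm2.
have : P * Q == 0; last by rewrite mulf_eq0 (negPf P0) (negPf Q0).
apply/eqP/som_inj; rewrite raddf0 somM; apply/funext => m.
have fgm : (f * g) m = 0 by rewrite fg.
rewrite seriesM; have [bm|bm] := boolP (bnd N m); last first.
  rewrite big_seq big1// => a; rewrite mem_subm => am; rewrite PE QE.
  case: ifP => [/andP[ba _]|]; last by rewrite mul0r.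
  case: ifP => [/andP[bb _]|]; last by rewrite mulr0.
  by case/negP: bm; rewrite -(msetBDKC am) bndD ba bb.
have [dm|dm] := eqVneq (degm m) (degm m1 + degm m2)%N; last first.
  rewrite big_seq big1// => a; rewrite mem_subm => am; rewrite PE QE.
  case: ifP => [/andP[_ /eqP da]|]; last by rewrite mul0r.
  case: ifP => [/andP[_ /eqP db]|]; last by rewrite mulr0.
  by move: dm; rewrite -da -db -degmD msetBDKC// eqxx.
rewrite -[RHS]fgm seriesM big_seq [RHS]big_seq; apply: eq_bigr => a.
rewrite mem_subm => am; rewrite PE QE (bnd_sub am bm) (bndB am bm) /=.
have : (degm a + degm (m `\` a)%mset = degm m1 + degm m2)%N.
  by rewrite -degmD msetBDKC.
case: (ltngtP (degm a) (degm m1)) => [ltd|gtd|-> /addnI ->].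
- by rewrite fmin// !mul0r.
- move=> e; have ltd : (degm (m `\` a)%mset < degm m2)%N by lia.
  by rewrite gmin// (ltn_eqF ltd) !mulr0.
by rewrite eqxx.
Qed.

Section SeriesUnit.

(** Inverses are chosen classically; they only supply the structure of unit ring underlying that of
    integral domain. *)
Let unit : {pred series} := [pred f : series | `[< exists g : series, g * f = 1 >]].

Let inv (f : series) : series := xget f [set g | g * f = 1].

Let inv_out (f : series) : ~ (exists g : series, g * f = 1) -> inv f = f.
Proof.
by move=> h; rewrite /inv; case: xgetP => // g _ gf; case: h; exists g.
Qed.

Lemma series_mulVr : {in unit, left_inverse 1 inv *%R}.
Proof.
move=> f /asboolP h; rewrite /inv; case: xgetP => [g _ //|no].
by case: h => g gf; case: (no g).
Qed.

Lemma series_unitPl (f g : series) : g * f = 1 -> unit f.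
Proof. by move=> gf; apply/asboolP; exists g. Qed.

Lemma series_invr_out : {in [predC unit], inv =1 id}.
Proof. by move=> f /negP h; apply: inv_out => e; apply: h; apply/asboolP. Qed.

HB.instance Definition _ := GRing.ComNzRing_hasMulInverse.Build series
  series_mulVr series_unitPl series_invr_out.

End SeriesUnit.

HB.instance Definition _ :=
  GRing.ComUnitRing_isIntegral.Build series series_idomain.

Definition Fr : fieldType := {fraction series}.

(** * Schur's Pfaffian *)

Local Notation lift := fintype.lift.

Section Interpolation.
Variable F : fieldType.

Lemma lagrange_interp n (t : 'I_n -> F) (p : {poly F}) v :
  injective t -> (size p <= n)%N ->
  p.[v] = \sum_(i < n) p.[t i] * \prod_(k < n | k != i) ((v - t k) / (t i - t k)).
Proof.
move=> tinj pn.
pose l i : {poly F} := \prod_(k < n | k != i) ((t i - t k)^-1 *: ('X - (t k)%:P)).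
have lE i u : (l i).[u] = \prod_(k < n | k != i) ((u - t k) / (t i - t k)).
  rewrite horner_prod; apply: eq_bigr => k _.
  by rewrite hornerZ hornerXsubC mulrC.
have sl i : (size (l i) <= n)%N.
  rewrite (leq_trans (size_prod_leq _ _))//.
  have sk k : (size ((t i - t k)^-1 *: ('X - (t k)%:P))%R <= 2)%N.
    by rewrite (leq_trans (size_scale_leq _ _))// size_XsubC.
  have : (\sum_(k < n | k != i) size ((t i - t k)^-1 *: ('X - (t k)%:P))%R <=
          \sum_(k < n | k != i) 2)%N by apply: leq_sum.
  rewrite sum_nat_const cardC1 card_ord; have := ltn_ord i.
  by move: (\sum_(_ < _ | _) _)%N => s; lia.
pose q := \sum_(i < n) p.[t i] *: l i.
have qE u : q.[u] = \sum_(i < n) p.[t i] * (l i).[u].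
  by rewrite horner_sum; apply: eq_bigr => i _; rewrite hornerZ.
suff pq : p - q = 0.
  transitivity (q.[v]); first by rewrite -[p](subrK q) pq add0r.
  by rewrite qE; apply: eq_bigr => i _; rewrite lE.
apply: (roots_geq_poly_eq0 (rs := codom t)).
- apply/allP => _ /codomP[j ->]; rewrite rootE hornerD hornerN qE subr_eq0.
  rewrite (bigD1 j)//= lE big1 ?mulr1; last first.
    by move=> k kj; rewrite divff// subr_eq0 (inj_eq tinj) eq_sym.
  rewrite big1 ?addr0// => i ij; rewrite lE (bigD1 j) 1?eq_sym//=.
  by rewrite subrr !mul0r mulr0.
- by rewrite map_inj_uniq ?enum_uniq.
rewrite size_codom card_ord (leq_trans (size_polyD _ _))// geq_max pn size_polyN.
rewrite (leq_trans (size_sum _ _ _))//; apply/bigmax_leqP => i _.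
by rewrite (leq_trans (size_scale_leq _ _)).
Qed.

End Interpolation.

(** * Expansion of a Pfaffian along its first row *)

Lemma sum_lift_perm (R : nmodType) n (i : 'I_n.+1) (P : pred 'S_n.+1)
    (G : 'S_n.+1 -> R) :
  \sum_(s | P s) G s =
  \sum_(j < n.+1) \sum_(s : 'S_n | P (lift_perm i j s)) G (lift_perm i j s).
Proof.
rewrite pair_big_dep /= (reindex (fun p : 'I_n.+1 * 'S_n => lift_perm i p.1 p.2)) //=.
apply: onW_bij; apply: inj_card_bij.
  move=> [j s] [j' s'] /= e; have jj : j = j'.
    by have := congr1 (fun w : 'S_n.+1 => w i) e; rewrite /= !lift_perm_id.
  rewrite -jj in e *; congr (_, _); apply/permP => k; apply: (@lift_inj _ j).
  by rewrite -!(lift_perm_lift i) e.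
by rewrite card_prod card_ord !card_Sn factS.
Qed.

Section PfaffianRec.
Variables (R : comNzRingType) (n : nat).
Hypothesis n_even : ~~ odd n.

Let cond N (w : 'S_N) :=
  [forall i : 'I_N./2, forall j : 'I_N./2,
    (i < j)%N ==> (w (Ordinal (Pf_fst i)) < w (Ordinal (Pf_fst j)))%N] &&
  [forall i : 'I_N./2, (w (Ordinal (Pf_fst i)) < w (Ordinal (Pf_snd i)))%N].

Let fst0 : Ordinal (Pf_fst (ord0 : 'I_n.+2./2)) = ord0.
Proof. exact: val_inj. Qed.

Let snd0 : Ordinal (Pf_snd (ord0 : 'I_n.+2./2)) = lift ord0 ord0.
Proof. exact: val_inj. Qed.

Let fstS (i : 'I_n./2) : Ordinal (Pf_fst (lift ord0 i : 'I_n.+2./2)) =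
  lift ord0 (lift ord0 (Ordinal (Pf_fst i))).
Proof. exact: val_inj. Qed.

Let sndS (i : 'I_n./2) : Ordinal (Pf_snd (lift ord0 i : 'I_n.+2./2)) =
  lift ord0 (lift ord0 (Ordinal (Pf_snd i))).
Proof. exact: val_inj. Qed.

Let ltn_bump2 h a b : (bump h a < bump h b)%N = (a < b)%N.
Proof. by rewrite !ltnNge leq_bump2. Qed.

Let condS (b : 'I_n.+1) (s : 'S_n) :
  cond (lift_perm ord0 ord0 (lift_perm ord0 b s)) = cond s.
Proof.
rewrite /cond; congr (_ && _).
  apply/forallP/forallP => [h i|h i]; apply/forallP => j.
    have /forallP/(_ (lift ord0 j)) := h (lift ord0 i).
    by rewrite !fstS !lift_perm_lift /= !ltn_bump2.
  case: (unliftP ord0 i) => [i'|] ->; case: (unliftP ord0 j) => [j'|] -> //.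
    have /forallP/(_ j') := h i'; by rewrite !fstS !lift_perm_lift /= !ltn_bump2.
  by rewrite fst0 fstS !lift_perm_lift lift_perm_id.
apply/forallP/forallP => [h i|h i].
  by have := h (lift ord0 i); rewrite fstS sndS !lift_perm_lift /= !ltn_bump2.
case: (unliftP ord0 i) => [i'|] ->.
  by have := h i'; rewrite fstS sndS !lift_perm_lift /= !ltn_bump2.
by rewrite fst0 snd0 lift_perm_lift !lift_perm_id.
Qed.

(** The value 0, being the least, is first in its pair, and its pair comes first. As n is even,
    every position belongs to a pair. *)
Let cond0 (w : 'S_n.+2) : cond w -> w ord0 = ord0.
Proof.
move=> /andP[/forallP h1 /forallP h2]; apply: val_inj => /=.
apply/eqP; rewrite -leqn0 leqNgt; apply/negP => w0.
pose p := (w^-1)%g ord0; have wp : w p = ord0 by rewrite permKV.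
have p0 : (0 < p)%N.
  rewrite lt0n; apply: contraTneq w0 => p0; have e : p = ord0 by exact: val_inj.
  by rewrite -{1}e wp.
have hp : (p./2 < n.+2./2)%N.
  have := ltn_ord p; have := odd_double_half p; have := odd_double_half n.
  by rewrite (negPf n_even) -!muln2 /=; lia.
pose i := Ordinal hp.
have [po|pe] := boolP (odd p).
  have := h2 i; rewrite (_ : Ordinal (Pf_snd i) = p) ?wp//.
  by apply: val_inj => /=; rewrite -[RHS]odd_double_half po.
have fp : Ordinal (Pf_fst i) = p.
  by apply: val_inj => /=; rewrite -[RHS]odd_double_half (negPf pe).
have := forallP (h1 ord0) i; rewrite fp wp ltn0 implybF -leqNgt leqn0 => /eqP i0.
have i0' : p./2 = 0%N := i0.
by move: p0; rewrite -[nat_of_ord p]odd_double_half (negPf pe) i0'.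
Qed.

(** A matching in normal form begins with a pair {0, b + 1} and continues with a matching of the
    other points; bringing b + 1 to second place costs the sign (-1)^b. *)
Lemma Pf_rec (a : 'I_n.+2 -> 'I_n.+2 -> R) :
  Pf a = \sum_(b < n.+1) (-1) ^+ b * a ord0 (lift ord0 b) *
    Pf (fun i j : 'I_n => a (lift ord0 (lift b i)) (lift ord0 (lift b j))).
Proof.
rewrite /Pf -/(@cond n.+2) (sum_lift_perm ord0) (bigD1 ord0)//=.
rewrite [X in _ + X]big1 ?addr0; last first.
  move=> j j0; rewrite big_pred0// => s; apply/negP => /cond0.
  by rewrite lift_perm_id => jE; rewrite jE eqxx in j0.
rewrite (sum_lift_perm ord0); apply: eq_bigr => b _.
rewrite mulr_sumr; apply: eq_big => [s|s _]; first exact: condS.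
rewrite -[LHS]/((-1) ^+ _ * \prod_(i < n./2.+1) a
   (lift_perm ord0 ord0 (lift_perm ord0 b s) (Ordinal (Pf_fst (i : 'I_n.+2./2))))
   (lift_perm ord0 ord0 (lift_perm ord0 b s) (Ordinal (Pf_snd (i : 'I_n.+2./2))))).
rewrite big_ord_recl fst0 snd0 lift_perm_lift !lift_perm_id.
rewrite !odd_lift_perm /= !signr_addb signr_odd.
rewrite mulrACA; congr (_ * (_ * _)).
by apply: eq_bigr => i _; rewrite fstS sndS !lift_perm_lift.
Qed.

End PfaffianRec.

Lemma Pf0 (R : comNzRingType) (a : 'I_0 -> 'I_0 -> R) : Pf a = 1.
Proof.
rewrite /Pf (big_pred1 1%g) => [|w]; first by rewrite big_ord0 mulr1 odd_perm1.
rewrite /= (_ : w = 1%g) ?eqxx; last by apply/permP => -[].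
by apply/andP; split; apply/forallP => -[].
Qed.

Section SchurPfaffian.
Variable F : fieldType.
Implicit Types x y : F.

Definition sker x y : F := (y - x) / (y + x).

Lemma sker_anti x y : sker x y = - sker y x.
Proof. by rewrite /sker -mulNr opprB [y + x]addrC. Qed.

Definition sprod n (s : 'I_n -> F) : F :=
  \prod_(i < n) \prod_(j < n | (i < j)%N) sker (s i) (s j).

Lemma sprod_recl n (s : 'I_n.+1 -> F) :
  sprod s = (\prod_(j < n) sker (s ord0) (s (lift ord0 j))) *
            sprod (fun i => s (lift ord0 i)).
Proof.
rewrite /sprod big_ord_recl; congr (_ * _).
  by rewrite big_mkcond big_ord_recl /= mul1r.
by apply: eq_bigr => i _; rewrite big_mkcond big_ord_recl /= mul1r -big_mkcond.
Qed.

Lemma prod_pairsD1 n (h : 'I_n.+1 -> 'I_n.+1 -> F) (b : 'I_n.+1) :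
  \prod_(i < n.+1) \prod_(j < n.+1 | (i < j)%N) h i j =
  \prod_(k < n) (if (k < b)%N then h (lift b k) b else h b (lift b k)) *
  \prod_(i < n) \prod_(j < n | (i < j)%N) h (lift b i) (lift b j).
Proof.
rewrite (bigD1_ord b)//= [X in X * _]big_mkcond (bigD1_ord b)//= ltnn mul1r.
under [X in _ * X]eq_bigr => i _.
  rewrite big_mkcond (bigD1_ord b)//=; over.
rewrite big_split /= mulrA; congr (_ * _).
  rewrite -big_split; apply: eq_bigr => k _ /=.
  rewrite /bump; case: (leqP b k) => bk; rewrite ?add1n ?add0n.
    by rewrite ltnS bk ltnNge (leqW bk) mulr1.
  by rewrite ltnNge (ltnW bk) bk mul1r.
by apply: eq_bigr => i _; rewrite -big_mkcond; apply: eq_bigl => j; rewrite !ltnNge leq_bump2.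
Qed.

(** Moving the node b to the front reverses its b pairs with earlier nodes, and [sker] is
    antisymmetric. *)
Lemma sprod_move n (s : 'I_n.+1 -> F) (b : 'I_n.+1) :
  sprod s = (-1) ^+ b * \prod_(k < n) sker (s b) (s (lift b k)) *
            sprod (fun i => s (lift b i)).
Proof.
rewrite /sprod (prod_pairsD1 _ b); congr (_ * _).
have -> : (-1) ^+ b = \prod_(k < n) (if (k < b)%N then -1 else 1) :> F.
  have bn : (b <= n)%N by rewrite -ltnS.
  rewrite -big_mkcond -(big_ord_widen n (fun=> -1) bn) prodr_const card_ord.
  by [].
rewrite -big_split; apply: eq_bigr => k _ /=.
by case: ifP => _; rewrite ?mul1r// sker_anti mulN1r.
Qed.

Lemma sprod_eq0 n (s : 'I_n -> F) (i j : 'I_n) : i != j -> s i = s j -> sprod s = 0.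
Proof.
wlog ij : i j / (i < j)%N.
  move=> h ne e; case: (ltngtP i j) => [ij|ji|/val_inj ij].
  - exact: h ij ne e.
  - by apply: h ji _ (esym e); rewrite eq_sym.
  - by rewrite ij eqxx in ne.
move=> _ e; rewrite /sprod (bigD1 i)//= (bigD1 j)//= {1}/sker e subrr.
by rewrite !mul0r.
Qed.

(** Deleting either of two equal nodes leaves the same nodes in a different order. When the survivor
    is moved to the front, the signs are (-1)^(l-1) and (-1)^k, so the two terms are opposite. *)
Lemma sprod_cancel n (t : 'I_n.+2 -> F) (k l : 'I_n.+2) : k != l -> t k = t l ->
  (-1) ^+ k * sprod (fun i => t (lift k i)) +
  (-1) ^+ l * sprod (fun i => t (lift l i)) = 0.
Proof.
wlog kl : k l / (k < l)%N.
  move=> h ne e; case: (ltngtP k l) => [kl|lk|/val_inj kl].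
  - exact: h kl ne e.
  - by rewrite addrC; apply: h lk _ (esym e); rewrite eq_sym.
  - by rewrite kl eqxx in ne.
move=> _ e.
have l1 : (l.-1 < n.+1)%N by have := ltn_ord l; lia.
have k1 : (k < n.+1)%N by have := ltn_ord l; lia.
pose l' := Ordinal l1; pose k' := Ordinal k1.
have El : lift k l' = l.
  apply: val_inj => /=; rewrite /bump; have -> : (k <= l.-1)%N by lia.
  by lia.
have Ek : lift l k' = k.
  by apply: val_inj => /=; rewrite /bump; case: leqP => //; lia.
rewrite (sprod_move _ l') (sprod_move (fun i => t (lift l i)) k') El Ek e.
have -> : (fun i : 'I_n => t (lift k (lift l' i))) = (fun i => t (lift l (lift k' i))).
  apply/funext => i; congr t; apply: val_inj => /=; rewrite /bump.
  by lia.
have -> : \prod_(j < n) sker (t l) (t (lift k (lift l' j))) =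
          \prod_(j < n) sker (t l) (t (lift l (lift k' j))).
  apply: eq_bigr => i _; congr (sker _ (t _)); apply: val_inj => /=; rewrite /bump.
  by lia.
have -> : (-1) ^+ l = - (-1) ^+ l' :> F.
  by rewrite -[in LHS](prednK (leq_ltn_trans (leq0n _) kl)) exprS mulN1r.
rewrite /=; move: (\prod_(_ < _) _) (sprod _) => X Y; ring.
Qed.

(** Lagrange interpolation at the points - t_b of the polynomial P below, whose degree is less than
    n because for odd n the leading terms cancel. At - t_b one of its two products vanishes. *)
Lemma sker_interp n (t : 'I_n -> F) x : odd n -> 2%:R != 0 :> F -> injective t ->
  (forall i, t i != 0) -> (forall i, t i + x != 0) ->
  \sum_(b < n) sker x (t b) * \prod_(k < n | k != b) (sker (t b) (t k))^-1 =
  \prod_(k < n) sker x (t k).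
Proof.
move=> no h2 tinj t0 tx.
pose P : {poly F} := \prod_(k < n) ((t k)%:P - 'X) + \prod_(k < n) ((t k)%:P + 'X).
have PE v : P.[v] = \prod_(k < n) (t k - v) + \prod_(k < n) (t k + v).
  rewrite hornerD !horner_prod; congr (_ + _); apply: eq_bigr => k _;
  by rewrite !hornerE.
have sP : (size P <= n)%N.
  have e1 : \prod_(k < n) ((t k)%:P + 'X) = \prod_(k < n) ('X - (- t k)%:P).
    by apply: eq_bigr => k _; rewrite polyCN opprK addrC.
  have e2 : \prod_(k < n) ((t k)%:P - 'X) = - \prod_(k < n) ('X - (t k)%:P).
    rewrite (eq_bigr (fun k => - ('X - (t k)%:P))); last by move=> k _; rewrite opprB.
    by rewrite prodrN card_ord -signr_odd no expr1 mulN1r.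
  rewrite /P e1 e2; set A := \prod_(_ < _) _; set B := \prod_(_ < _) _.
  have mA : A \is monic by apply: monic_prod_XsubC.
  have mB : B \is monic by apply: monic_prod_XsubC.
  have sA : size A = n.+1 by rewrite size_prod_XsubC /index_enum -enumT size_enum_ord.
  have sB : size B = n.+1 by rewrite size_prod_XsubC /index_enum -enumT size_enum_ord.
  apply/leq_sizeP => j nj; rewrite coefD coefN; move: nj; rewrite leq_eqVlt.
  case/predU1P => [<-|nj]; last by rewrite !nth_default ?sA ?sB// oppr0 addr0.
  have := monicP mA; have := monicP mB; rewrite !lead_coefE sA sB /= => -> ->.
  by rewrite addNr.
have tinj' : injective (fun i => - t i) by move=> i j /oppr_inj /tinj.
pose C b : F := \prod_(k < n | k != b) ((t k + t b) / (t k - t b)).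
have L v : \prod_(k < n) (t k - v) + \prod_(k < n) (t k + v) =
    \sum_(b < n) (t b + t b) * C b * \prod_(k < n | k != b) (t k + v).
  rewrite -PE (lagrange_interp _ tinj' sP); apply: eq_bigr => b _.
  rewrite PE [X in _ + X](bigD1 b)//= subrr mul0r addr0 (bigD1 b)//= opprK.
  rewrite -!mulrA; congr (_ * _); rewrite /C -!big_split; apply: eq_bigr => k _ /=.
  by rewrite !opprK [v + _]addrC [- _ + _]addrC mulrA [RHS]mulrAC.
(* The case v = 0 of [L], divided by twice the product of all nodes. *)
have C1 : \sum_(b < n) C b = 1.
  pose Q := \prod_(k < n) t k; have Q0 : Q != 0 by apply/prodf_neq0 => k _.
  have e1 : \prod_(k < n) (t k - 0) = Q by apply: eq_bigr => k _; rewrite subr0.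
  have e2 : \prod_(k < n) (t k + 0) = Q by apply: eq_bigr => k _; rewrite addr0.
  have := L 0; rewrite e1 e2 (eq_bigr (fun b => (Q + Q) * C b)) => [|b _]; last first.
    have -> : \prod_(k < n | k != b) (t k + 0) = \prod_(k < n | k != b) t k.
      by apply: eq_bigr => k _; rewrite addr0.
    have -> : Q = t b * \prod_(k < n | k != b) t k by rewrite /Q (bigD1 b).
    by move: (C b) (\prod_(_ < _ | _) _) => X Y; ring.
  rewrite -mulr_sumr -[LHS]mulr1 => /mulfI <-//.
  by rewrite -mulr2n -mulr_natl mulf_neq0.
have CE b : \prod_(k < n | k != b) (sker (t b) (t k))^-1 = C b.
  by apply: eq_bigr => k _; rewrite invf_div.
pose T := \prod_(k < n) (t k + x); have T0 : T != 0 by apply/prodf_neq0 => k _.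
(* Here sker x t = 2 t / (t + x) - 1. The first part is summed by [L] at v = x, the second by
   [C1]. *)
transitivity (\sum_(b < n) ((t b + t b) / (t b + x) * C b - C b)).
  apply: eq_bigr => b _; rewrite CE -[X in _ = _ - X]mul1r -mulrBl; congr (_ * _).
  by rewrite /sker -(divff (tx b)) -mulrBl opprD addrACA subrr add0r.
rewrite sumrB C1 /sker prodf_div -/T; apply/eqP; rewrite subr_eq; apply/eqP.
apply: (mulIf T0); rewrite mulrDl divfK// mul1r {2}/T L mulr_suml.
apply: eq_bigr => b _; rewrite {1}/T (bigD1 b)//=; move: (tx b) (C b).
by move: (t b + x) (\prod_(_ < _ | _) _) => Y Z Y0 X; field.
Qed.

(** For distinct nodes, division by [sprod t] leads to [sker_interp]. Equal nodes do occur later,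
    when f runs over all maps; then all terms vanish except two, which cancel by [sprod_cancel]. *)
Lemma sum_sprod n (t : 'I_n.+1 -> F) x : ~~ odd n -> 2%:R != 0 :> F ->
  (forall i, t i != 0) -> (forall i, t i + x != 0) ->
  (forall i j, t i + t j != 0) ->
  \sum_(b < n.+1) (-1) ^+ b * sker x (t b) * sprod (fun i => t (lift b i)) =
  (\prod_(k < n.+1) sker x (t k)) * sprod t.
Proof.
move=> ne h2 t0 tx tt; have [/injectiveP tinj|] := boolP (injectiveb (finfun t)).
  have {}tinj : injective t by move=> i j e; apply: tinj; rewrite !ffunE.
  have sk0 i j : i != j -> sker (t i) (t j) != 0.
    by move=> ij; rewrite mulf_neq0 ?invr_eq0// subr_eq0 (inj_eq tinj) eq_sym.
  rewrite -(sker_interp _ h2 tinj t0 tx)//= mulr_suml; apply: eq_bigr => b _.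
  rewrite (sprod_move t b) big_mkcond (bigD1_ord b)//= eqxx mul1r.
  rewrite (eq_bigr (fun k => (sker (t b) (t (lift b k)))^-1)) => [|k _]; last first.
    by rewrite eq_sym neq_lift.
  rewrite prodfV; set D := \prod_(_ < _) _.
  have D0 : D != 0 by apply/prodf_neq0 => k _; apply: sk0; exact: neq_lift.
  move: D D0 (sker x (t b)) (sprod _) => D D0 A V.
  by move: ((-1) ^+ b) => S; field; exact: D0.
case/injectivePn => k [l kl]; rewrite !ffunE => tkl.
rewrite (sprod_eq0 kl tkl) mulr0.
case: n ne t t0 tx tt k l kl tkl => [_|n' ne] t t0 tx tt k l kl tkl.
  by rewrite !ord1 eqxx in kl.
rewrite (bigD1 k)//= (bigD1 l) 1?eq_sym//= [X in _ + (_ + X)]big1 ?addr0.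
  have := congr1 (fun z => sker x (t l) * z) (sprod_cancel kl tkl).
  rewrite mulr0 tkl mulrDr => <-.
  by congr (_ + _); rewrite [RHS]mulrA; congr (_ * _); rewrite mulrC.
move=> b /andP[bk bl].
have [k' ek _] := unlift_some bk; have [l' el _] := unlift_some bl.
have kl' : k' != l' by apply: contraNneq kl => e; rewrite ek el e.
by rewrite (@sprod_eq0 _ _ k' l')// ?mulr0// -ek -el.
Qed.

(** Induction on n: the expansion along the first row is exactly the sum evaluated by
    [sum_sprod]. *)
Theorem Pf_schur n (s : 'I_n -> F) : ~~ odd n -> 2%:R != 0 :> F ->
  (forall i, s i != 0) -> (forall i j, s i + s j != 0) ->
  Pf (fun i j => sker (s i) (s j)) = sprod s.
Proof.
move=> + h2; have [h nh] := ubnP n; elim: h n nh s => // h IH [|[|n]] nh s ne s0 ss.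
- by rewrite /sprod big_ord0 Pf0.
- by [].
rewrite /= negbK in ne; rewrite Pf_rec// sprod_recl.
rewrite -(sum_sprod (x := s ord0))//.
apply: eq_bigr => b _; congr (_ * _).
by rewrite (IH n (leq_ltn_trans (leqnSn n) nh) (fun i => s (lift ord0 (lift b i)))).
Qed.

End SchurPfaffian.

(** * Limits in the fraction field of series *)

Definition eqd (L : nat) (f g : series) : Prop :=
  forall m, (degm m < L)%N -> f m = g m.

Lemma eqd_refl L f : eqd L f f.
Proof. by []. Qed.

Lemma eqd_sym L f g : eqd L f g -> eqd L g f.
Proof. by move=> h m mL; rewrite h. Qed.

Lemma eqd_trans L f g h : eqd L f g -> eqd L g h -> eqd L f h.
Proof. by move=> h1 h2 m mL; rewrite h1// h2. Qed.

Lemma eqdW L L' f g : (L <= L')%N -> eqd L' f g -> eqd L f g.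
Proof. by move=> LL h m mL; rewrite h// (leq_trans mL). Qed.

Lemma eqd_eq L0 f g : (forall L, (L0 <= L)%N -> eqd L f g) -> f = g.
Proof.
move=> h; apply/funext => m; apply: (h (maxn L0 (degm m).+1)).
  exact: leq_maxl.
exact: leq_maxr.
Qed.

Lemma eqdD L f f' g g' : eqd L f f' -> eqd L g g' -> eqd L (f + g) (f' + g').
Proof. by move=> h1 h2 m mL; rewrite !seriesD h1// h2. Qed.

Lemma eqdM L f f' g g' : eqd L f f' -> eqd L g g' -> eqd L (f * g) (f' * g').
Proof.
move=> h1 h2 m mL; rewrite !seriesM !big_seq; apply: eq_bigr => a.
rewrite mem_subm => am; rewrite h1 ?(leq_ltn_trans (degm_sub am))// h2//.
by rewrite degmB//; apply: leq_ltn_trans mL; exact: leq_subr.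
Qed.

Lemma eqd_sum L (I : Type) (r : seq I) (P : pred I) (F G : I -> series) :
  (forall i, P i -> eqd L (F i) (G i)) ->
  eqd L (\sum_(i <- r | P i) F i) (\sum_(i <- r | P i) G i).
Proof.
move=> h; elim/big_rec2: _ => [|i f g Pi IH]; first exact: eqd_refl.
exact: eqdD (h i Pi) IH.
Qed.

Lemma eqdM0 a b f g : eqd a f 0 -> eqd b g 0 -> eqd (a + b) (f * g) 0.
Proof.
move=> h1 h2 m mL; rewrite seriesM big_seq big1// => c; rewrite mem_subm => cm.
have [ca|ca] := ltnP (degm c) a; first by rewrite h1// mul0r.
by rewrite h2 ?mulr0// degmB//; have := degm_sub cm; move: mL ca; lia.
Qed.

Lemma eqdX0 f k : eqd 1 f 0 -> eqd k (f ^+ k) 0.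
Proof.
move=> h; elim: k => [|k IH]; first by [].
by rewrite exprS -add1n; apply: eqdM0.
Qed.

Definition var (i : nat) : series := mono (msetn 1 i).

Lemma varX i k : var i ^+ k = mono (msetn k i).
Proof.
elim: k => [|k IH]; first by rewrite msetn0.
rewrite exprS IH -monoD; congr mono; apply/msetP => x.
by rewrite msetE2 !msetnE; case: eqP.
Qed.

Lemma var_eqd i : eqd 1 (var i) 0.
Proof.
move=> m; rewrite ltnS leqn0 degm_eq0 => /eqP ->.
rewrite /var /mono (_ : (_ == _) = false)//; apply/eqP => /(congr1 (fun m : monom => m i)).
by rewrite mset0E msetnxx.
Qed.

Lemma mono_neq0 a : mono a != 0.
Proof.
apply/eqP => /(congr1 (fun f : series => f a)); rewrite /mono eqxx.
by move/eqP; rewrite oner_eq0.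
Qed.

Lemma var_inj i j : var i = var j -> i = j.
Proof.
move/(congr1 (fun f : series => f (msetn 1 i))); rewrite /var /mono eqxx.
case: eqP => [e _|_ /eqP]; last by rewrite oner_eq0.
have := congr1 (fun m : monom => m i) e; rewrite msetnxx msetnE.
by case: eqP => // ->.
Qed.

Section Restriction.
Variable N : nat.

(** Sets the variables of index at least N to 0; it is a ring morphism by [resM]. *)
Definition res (f : series) : series := fun m => if bnd N m then f m else 0.

Lemma res_zmod : zmod_morphism res.
Proof.
by move=> f g; apply/funext => m; rewrite /res [RHS]/GRing.add /= /GRing.opp /=;
  case: ifP => // _; rewrite subr0.
Qed.

HB.instance Definition _ := GRing.isZmodMorphism.Build _ _ res res_zmod.

Lemma res1 : res 1 = 1.
Proof.
apply/funext => m; rewrite /res; case: ifP => // bm; rewrite -mono0 /mono.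
by case: eqP => // e; rewrite e /bnd enum_mset0 in bm.
Qed.

Lemma resM f g : res (f * g) = res f * res g.
Proof.
apply/funext => m; rewrite {1}/res !seriesM; case: ifP => bm.
  rewrite !big_seq; apply: eq_bigr => a; rewrite mem_subm => am.
  by rewrite /res (bnd_sub am bm) (bndB am bm).
rewrite big_seq big1// => a; rewrite mem_subm => am; rewrite /res.
case: ifP => ba; last by rewrite mul0r.
case: ifP => bb; last by rewrite mulr0.
by move: bm; rewrite -(msetBDKC am) bndD ba bb.
Qed.

HB.instance Definition _ := GRing.isMonoidMorphism.Build _ _ res (conj res1 resM).

Lemma resZ c f : res (c *: f) = c *: res f.
Proof.
by apply/funext => m; rewrite seriesZ /res; case: ifP => // _; rewrite mulr0.
Qed.

Lemma res_eqd L f g : eqd L f g -> eqd L (res f) (res g).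
Proof. by move=> h m mL; rewrite /res h. Qed.

End Restriction.

Definition kf (c : K) : Fr := tofrac (c%:A : series).

HB.instance Definition _ := GRing.RMorphism.copy kf
  (@FracField.tofrac series \o in_alg series).

Lemma tofracZ c (f : series) : tofrac (c *: f) = kf c * tofrac f.
Proof. by rewrite /kf -tofracM -scalerAl mul1r. Qed.

Definition xf (i : nat) : Fr := tofrac (var i).

(* Multiplying by a common denominator d reduces limits in the fraction field *)
(* to congruences of series modulo terms of high degree.                      *)
Definition flim (u : nat -> Fr) (v : Fr) : Prop :=
  exists (d V : series) (U : nat -> series) (L0 : nat),
    [/\ d != 0, v * tofrac d = tofrac V
      & forall L, (L0 <= L)%N -> u L * tofrac d = tofrac (U L) /\ eqd L (U L) V].

Lemma flim_tofrac (U : nat -> series) V L0 :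
  (forall L, (L0 <= L)%N -> eqd L (U L) V) ->
  flim (fun L => tofrac (U L)) (tofrac V).
Proof.
move=> h; exists 1, V, U, L0; split; rewrite ?oner_neq0 ?tofrac1 ?mulr1//.
by move=> L /h; rewrite mulr1.
Qed.

Lemma fracE (R : idomainType) (z : {fraction R}) :
  exists a b : R, b != 0 /\ z * tofrac b = tofrac a.
Proof.
elim/quotW: z => x; exists (frac x).1, (frac x).2.
split; first exact: denom_ratioP.
unlock FracField.tofrac; rewrite -[LHS]FracField.pi_mul.
apply/eqmodP; rewrite /= FracField.equivfE /FracField.mulf.
by rewrite !numden_Ratio ?mulr1 ?oner_neq0 ?denom_ratioP// mulrC.
Qed.

Lemma flim_cst (v : Fr) : flim (fun=> v) v.
Proof.
have [a [b [b0 e]]] : exists a b : series, b != 0 /\ v * tofrac b = tofrac a.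
  exact: fracE.
by exists b, a, (fun=> a), 0%N; split.
Qed.

Lemma flimD u u' v v' : flim u v -> flim u' v' -> flim (fun L => u L + u' L) (v + v').
Proof.
move=> [d [V [U [L0 [d0 vE uE]]]]] [d' [V' [U' [L0' [d0' vE' uE']]]]].
exists (d * d'), (V * d' + V' * d), (fun L => U L * d' + U' L * d), (maxn L0 L0').
split; first by rewrite mulf_neq0.
  by rewrite tofracD !tofracM -vE -vE'; move: (tofrac d) (tofrac d') => x y; ring.
move=> L; rewrite geq_max => /andP[/uE[e1 c1] /uE'[e2 c2]]; split.
  by rewrite tofracD !tofracM -e1 -e2; move: (tofrac d) (tofrac d') => x y; ring.
by apply: eqdD; apply: eqdM.
Qed.

Lemma flimM u u' v v' : flim u v -> flim u' v' -> flim (fun L => u L * u' L) (v * v').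
Proof.
move=> [d [V [U [L0 [d0 vE uE]]]]] [d' [V' [U' [L0' [d0' vE' uE']]]]].
exists (d * d'), (V * V'), (fun L => U L * U' L), (maxn L0 L0').
split; first by rewrite mulf_neq0.
  by rewrite !tofracM -vE -vE' mulrACA.
move=> L; rewrite geq_max => /andP[/uE[e1 c1] /uE'[e2 c2]]; split.
  by rewrite !tofracM -e1 -e2 mulrACA.
exact: eqdM.
Qed.

Lemma flim_sum (I : Type) (r : seq I) (P : pred I) (u : I -> nat -> Fr) v :
  (forall i, P i -> flim (u i) (v i)) ->
  flim (fun L => \sum_(i <- r | P i) u i L) (\sum_(i <- r | P i) v i).
Proof.
move=> h; elim: r => [|i r IH].
  have -> : (fun L => \sum_(i <- [::] | P i) u i L) = fun=> 0.
    by apply/funext => L; rewrite big_nil.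
  by rewrite big_nil; exact: flim_cst.
rewrite big_cons; case: ifP => Pi; last first.
  by under eq_fun => L do rewrite big_cons Pi.
under eq_fun => L do rewrite big_cons Pi.
exact: flimD (h i Pi) IH.
Qed.

Lemma flim_eq L0 u u' v : (forall L, (L0 <= L)%N -> u L = u' L) ->
  flim u v -> flim u' v.
Proof.
move=> h [d [V [U [L1 [d0 vE uE]]]]]; exists d, V, U, (maxn L0 L1); split=> // L.
by rewrite geq_max => /andP[/h <- /uE].
Qed.

Lemma flim_unique u v v' : flim u v -> flim u v' -> v = v'.
Proof.
move=> [d [V [U [L0 [d0 vE uE]]]]] [d' [V' [U' [L0' [d0' vE' uE']]]]].
have VV : V * d' = V' * d.
  apply: (@eqd_eq (maxn L0 L0')) => L.
  rewrite geq_max => /andP[/uE[e1 c1] /uE'[e2 c2]].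
  have UU : U L * d' = U' L * d.
    apply/eqP; rewrite -tofrac_eq !tofracM -e1 -e2 mulrAC//.
  apply: eqd_trans (eqdM (eqd_sym c1) (eqd_refl _)) _; rewrite UU.
  exact: eqdM c2 (eqd_refl _).
have nz : tofrac (d * d') != 0 by rewrite tofrac_eq0 mulf_neq0.
apply: (mulIf nz); rewrite !tofracM.
by rewrite mulrA vE [v' * _]mulrCA vE' -!tofracM VV mulrC.
Qed.

(** * From fractions of polynomials to fractions of series *)

Section FracMorph.
Variable n : nat.

(** The map of fraction fields induced by the injective morphism [series_of_mpoly]. It picks a value
    compatible with some representation a / b; by [som_fracE] every representation gives the same
    value. *)
Definition som_frac (z : {fraction {mpoly K[n]}}) : Fr :=
  xget 0 [set y | exists a b : {mpoly K[n]}, [/\ b != 0, z * tofrac b = tofrac a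
    & y * tofrac (series_of_mpoly b) = tofrac (series_of_mpoly a)]].

Let som_tofrac_neq0 (b : {mpoly K[n]}) :
  b != 0 -> tofrac (series_of_mpoly b) != 0 :> Fr.
Proof. by rewrite tofrac_eq0 -(raddf0 (@series_of_mpoly n)) (inj_eq (@som_inj n)). Qed.

Lemma som_fracE z (a b : {mpoly K[n]}) : b != 0 -> z * tofrac b = tofrac a ->
  som_frac z * tofrac (series_of_mpoly b) = tofrac (series_of_mpoly a).
Proof.
move=> b0 zE; rewrite /som_frac; case: xgetP => [y _ [c [d [d0 zE' yE]]]|no].
  have e : c * b = a * d.
    by apply/eqP; rewrite -tofrac_eq !tofracM -zE -zE' mulrAC.
  apply: (mulIf (som_tofrac_neq0 d0)).
  by rewrite mulrAC yE -!tofracM -!somM e.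
case: (no (tofrac (series_of_mpoly a) / tofrac (series_of_mpoly b))).
by exists a, b; split; rewrite ?divfK ?som_tofrac_neq0.
Qed.

Lemma som_frac_tofrac P : som_frac (tofrac P) = tofrac (series_of_mpoly P).
Proof.
have := @som_fracE (tofrac P) P 1 (oner_neq0 _); rewrite mulr1 => /(_ erefl).
by rewrite (rmorph1 (@series_of_mpoly n)) mulr1.
Qed.

Lemma som_frac_eq z w (b : {mpoly K[n]}) : b != 0 ->
  z * tofrac (series_of_mpoly b) = w * tofrac (series_of_mpoly b) :> Fr -> z = w.
Proof. by move=> b0; apply: mulIf; exact: som_tofrac_neq0. Qed.

Lemma som_frac_zmod : zmod_morphism som_frac.
Proof.
move=> z w; have [a [b [b0 zE]]] := fracE z; have [c [d [d0 wE]]] := fracE w.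
have bd0 : b * d != 0 by rewrite mulf_neq0.
apply: (som_frac_eq bd0).
rewrite (@som_fracE _ (a * d - c * b) _ bd0).
  rewrite raddfB /= !somM tofracB !tofracM mulrBl.
  rewrite -(som_fracE b0 zE) -(som_fracE d0 wE).
  move: (som_frac z) (som_frac w) (tofrac (series_of_mpoly b)).
  by move: (tofrac (series_of_mpoly d)) => x y u v; ring.
rewrite mulrBl tofracB !tofracM -zE -wE.
by move: (tofrac b) (tofrac d) => x y; ring.
Qed.

HB.instance Definition _ := GRing.isZmodMorphism.Build _ _ som_frac som_frac_zmod.

Lemma som_frac_monoid : monoid_morphism som_frac.
Proof.
split=> [|z w]; first by rewrite -tofrac1 som_frac_tofrac (rmorph1 (@series_of_mpoly n)).
have [a [b [b0 zE]]] := fracE z; have [c [d [d0 wE]]] := fracE w.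
have bd0 : b * d != 0 by rewrite mulf_neq0.
apply: (som_frac_eq bd0).
rewrite (@som_fracE _ (a * c) _ bd0).
  by rewrite !somM !tofracM mulrACA -(som_fracE b0 zE) -(som_fracE d0 wE).
by rewrite !tofracM mulrACA zE wE.
Qed.

HB.instance Definition _ := GRing.isMonoidMorphism.Build _ _ som_frac som_frac_monoid.

End FracMorph.

Definition finite_deg (f : series) : Prop :=
  exists D, forall m, (D <= degm m)%N -> f m = 0.

Definition hdeg (e : nat) (f : series) : Prop :=
  forall m, degm m != e -> f m = 0.

Lemma finite_degD f g : finite_deg f -> finite_deg g -> finite_deg (f + g).
Proof.
move=> [D h] [E h']; exists (maxn D E) => m; rewrite geq_max => /andP[h1 h2].
by rewrite seriesD h// h'// addr0.
Qed.

Lemma finite_degM f g : finite_deg f -> finite_deg g -> finite_deg (f * g).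
Proof.
move=> [D h] [E h']; exists (D + E)%N => m mL.
rewrite seriesM big_seq big1// => a; rewrite mem_subm => am.
have [Da|Da] := leqP D (degm a); first by rewrite h// mul0r.
by rewrite h' ?mulr0// degmB//; move: mL Da; lia.
Qed.

Lemma finite_degZ c f : finite_deg f -> finite_deg (c *: f).
Proof. by move=> [D h]; exists D => m /h; rewrite seriesZ => ->; rewrite mulr0. Qed.

Lemma finite_deg_mono a : finite_deg (mono a).
Proof.
exists (degm a).+1 => m; rewrite /mono; case: eqP => // ->.
by rewrite ltnn.
Qed.

Lemma finite_deg1 : finite_deg 1.
Proof. exact: (finite_deg_mono mset0). Qed.

Lemma hdeg_finite e f : hdeg e f -> finite_deg f.
Proof. by move=> h; exists e.+1 => m em; rewrite h// gtn_eqF. Qed.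

Lemma hdegM e e' f g : hdeg e f -> hdeg e' g -> hdeg (e + e') (f * g).
Proof.
move=> h h' m mL; rewrite seriesM big_seq big1// => a; rewrite mem_subm => am.
have [ae|ae] := eqVneq (degm a) e; last by rewrite h// mul0r.
rewrite h' ?mulr0//; apply: contra_neq mL => e2.
by rewrite -ae -e2 -degmD msetBDKC.
Qed.

Lemma hdeg_var i : hdeg 1 (var i).
Proof.
by move=> m; rewrite /var /mono; case: (m =P _) => // ->; rewrite degm_msetn eqxx.
Qed.

(** Since q is homogeneous, the component of degree d of f times q is the component of degree e + d
    of q f. If that is 0, so is the former, as there are no zero divisors. *)
Lemma finite_deg_div e q f : hdeg e q -> q != 0 -> finite_deg (q * f) ->
  finite_deg f.
Proof.
move=> hq q0 [D qfD]; exists D => m0 Dm0; pose d := degm m0.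
pose fd : series := fun m => if degm m == d then f m else 0.
have : q * fd == 0.
  apply/eqP/funext => m; have [dm|dm] := eqVneq (degm m) (e + d)%N; last first.
    apply: (hdegM hq _ dm) => m' /negPf h; by rewrite /fd h.
  rewrite -[RHS](qfD m); last by rewrite dm (leq_trans Dm0)// leq_addl.
  rewrite !seriesM !big_seq; apply: eq_bigr => a; rewrite mem_subm => am.
  have [ae|ae] := eqVneq (degm a) e; last by rewrite hq// !mul0r.
  by rewrite /fd degmB// ae dm addKn eqxx.
rewrite mulf_eq0 (negPf q0) /= => /eqP fd0.
have : fd m0 = f m0 by rewrite /fd eqxx.
by rewrite fd0 => <-.
Qed.

(** Fractions of bounded degree over a homogeneous denominator; if such a fraction is a series, it
    has bounded degree ([hfrac_tofrac]). The terms of the symmetrization are of this kind, because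
    the factor 1 + beta y of [ominus] ends up in the numerator and only differences x_i - x_j are
    inverted. *)
Definition hfrac (z : Fr) : Prop := exists (e : nat) (q p : series),
  [/\ hdeg e q, q != 0, finite_deg p & z * tofrac q = tofrac p].

Lemma hfrac_tofrac f : hfrac (tofrac f) -> finite_deg f.
Proof.
move=> [e [q [p [hq q0 fp fE]]]]; apply: (finite_deg_div hq q0).
suff -> : q * f = p by [].
by apply/eqP; rewrite -tofrac_eq tofracM mulrC fE.
Qed.

Lemma hfrac_fin f : finite_deg f -> hfrac (tofrac f).
Proof.
move=> ff; exists 0%N, 1, f; split; rewrite ?oner_neq0 ?tofrac1 ?mulr1//.
move=> m; rewrite -mono0 /mono; case: (m =P _) => // ->.
by rewrite degm0 eqxx.
Qed.

Lemma hfracV e q : hdeg e q -> q != 0 -> hfrac (tofrac q)^-1.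
Proof.
move=> hq q0; exists e, q, 1; split=> //; first exact: finite_deg1.
by rewrite mulVf ?tofrac1// tofrac_eq0.
Qed.

Lemma hfracD z w : hfrac z -> hfrac w -> hfrac (z + w).
Proof.
move=> [e [q [p [hq q0 fp zE]]]] [e' [q' [p' [hq' q0' fp' wE]]]].
exists (e + e')%N, (q * q'), (p * q' + p' * q); split.
- exact: hdegM.
- by rewrite mulf_neq0.
- by apply: finite_degD; apply: finite_degM => //; apply: hdeg_finite; eassumption.
by rewrite tofracD !tofracM -zE -wE; move: (tofrac q) (tofrac q') => x y; ring.
Qed.

Lemma hfracM z w : hfrac z -> hfrac w -> hfrac (z * w).
Proof.
move=> [e [q [p [hq q0 fp zE]]]] [e' [q' [p' [hq' q0' fp' wE]]]].
exists (e + e')%N, (q * q'), (p * p'); split.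
- exact: hdegM.
- by rewrite mulf_neq0.
- exact: finite_degM.
by rewrite !tofracM -zE -wE mulrACA.
Qed.

Lemma hfrac_sum (I : Type) (r : seq I) (P : pred I) (F : I -> Fr) :
  (forall i, P i -> hfrac (F i)) -> hfrac (\sum_(i <- r | P i) F i).
Proof.
move=> h; apply: (big_ind hfrac) => //; last exact: hfracD.
rewrite -tofrac0; apply: hfrac_fin; by exists 0%N.
Qed.

Lemma hfrac_prod (I : Type) (r : seq I) (P : pred I) (F : I -> Fr) :
  (forall i, P i -> hfrac (F i)) -> hfrac (\prod_(i <- r | P i) F i).
Proof.
move=> h; apply: (big_ind hfrac) => //; last exact: hfracM.
rewrite -tofrac1; apply: hfrac_fin; exact: finite_deg1.
Qed.

(** * Partial fractions in n variables *)

Section PartialFractions.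
Variables (F : fieldType) (b : F) (x : nat -> F).
Hypothesis x_inj : injective x.

Definition pker (y z : F) : F := oplus b y z / ominus b y z.

Lemma pkerE y z : pker y z = (y + z + b * y * z) * (1 + b * z) / (y - z).
Proof. by rewrite /pker /ominus invf_div mulrA. Qed.

(* In n variables, sum_k Gcoef_k z^k = kcoef + sum_i dcoef_i / (1 - z x_i).   *)
Definition cfact n i : F := \prod_(j < n | j != i :> nat) pker (x i) (x j).

Definition dcoef n i : F := cfact n i * (2 + b * x i) * (1 + b * x i).

Definition kcoef n : F := \prod_(j < n) - (1 + b * x j).

Lemma cfactS n i : (i < n)%N -> cfact n.+1 i = cfact n i * pker (x i) (x n).
Proof.
by move=> lt_in; rewrite /cfact big_mkcond big_ord_recr /= -big_mkcond gtn_eqF.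
Qed.

Lemma cfact_max n : cfact n.+1 n = \prod_(j < n) pker (x n) (x j).
Proof.
rewrite /cfact big_mkcond big_ord_recr /= eqxx mulr1.
by apply: eq_bigr => j _; rewrite ltn_eqF.
Qed.

Lemma dcoefS n i : (i < n)%N -> dcoef n.+1 i = dcoef n i * pker (x i) (x n).
Proof.
move=> lt_in; rewrite /dcoef cfactS//.
by move: (cfact n i) (pker _ _) => c p; ring.
Qed.

Lemma kcoefS n : kcoef n.+1 = - (kcoef n * (1 + b * x n)).
Proof. by rewrite /kcoef big_ord_recr /= mulrN. Qed.

(** With z = 1 / y each factor of G becomes [pker y (x i)], so this is the partial fraction
    decomposition of G in z. Adding a variable multiplies by one more simple fraction, which is
    separated from the others. *)
Lemma partial_fractions n y : (forall i, (i < n)%N -> y != x i) ->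
  kcoef n + \sum_(i < n) dcoef n i * (y / (y - x i)) =
  \prod_(i < n) pker y (x i).
Proof.
elim: n y => [|n IH] y yx; first by rewrite /kcoef !big_ord0 addr0.
rewrite big_ord_recr /= [RHS]big_ord_recr /= -IH; last first.
  by move=> i lt_in; apply: yx; exact: ltnW.
have yn : y - x n != 0 by rewrite subr_eq0 yx.
(* The new residue contains the product in n variables at y = x_n, so the induction hypothesis is
   used a second time. *)
rewrite [in dcoef n.+1 n]/dcoef cfact_max -IH; last first.
  by move=> i lt_in; rewrite (inj_eq x_inj) gtn_eqF.
set W := (2 + b * x n) * (1 + b * x n) * (y / (y - x n)).
have -> : \sum_(i < n) dcoef n.+1 i * (y / (y - x i)) =
    (\sum_(i < n) dcoef n i * (y / (y - x i))) * pker y (x n) -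
    (\sum_(i < n) dcoef n i * (x n / (x n - x i))) * W.
  rewrite !mulr_suml -sumrB; apply: eq_bigr => i _; rewrite dcoefS// !pkerE /W.
  have yi : y - x i != 0 by rewrite subr_eq0 yx// ltnW// ltnS.
  have ni : x n - x i != 0 by rewrite subr_eq0 (inj_eq x_inj) gtn_eqF.
  have i_n : x i - x n != 0 by rewrite subr_eq0 (inj_eq x_inj) ltn_eqF.
  move: (dcoef n i) (x i) (x n) yn yi ni i_n => d p q h1 h2 h3 h4.
  by field; rewrite h1 h2 h3 h4.
have -> : kcoef n.+1 = kcoef n * pker y (x n) - kcoef n * W.
  rewrite kcoefS pkerE /W; move: (kcoef n) (x n) yn => d p h1.
  by field; rewrite h1.
move: (\sum_(_ < _) _) (\sum_(_ < _) _) => S T.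
rewrite -[in X in _ + (_ + X)]mulrA -/W /W.
by move: (kcoef n) (pker _ _) (y / _) => d p q; ring.
Qed.

Lemma dcoef_max n : dcoef n.+1 n =
  (kcoef n + \sum_(i < n) dcoef n i * (x n / (x n - x i))) *
  (2 + b * x n) * (1 + b * x n).
Proof.
rewrite /dcoef cfact_max -partial_fractions// => i lt_in.
by rewrite (inj_eq x_inj) gtn_eqF.
Qed.

(* Multiplication by u (u + x z) / (1 - x z), where u = 1 + b x, in terms of *)
(* partial fractions in z.                                                   *)
Lemma partial_fractions_step n k :
  \sum_(j < k.+1)
    (- ((1 + b * x n) *+ (j == 0%N :> nat)) +
      (2 + b * x n) * (1 + b * x n) * x n ^+ j) *
    (kcoef n *+ (k - j == 0)%N + \sum_(i < n) dcoef n i * x i ^+ (k - j)) =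
  kcoef n.+1 *+ (k == 0%N) + \sum_(i < n.+1) dcoef n.+1 i * x i ^+ k.
Proof.
set u := 1 + b * x n; set v := (2 + b * x n) * u.
have -> : \sum_(j < k.+1) (- (u *+ (j == 0%N :> nat)) + v * x n ^+ j) *
    (kcoef n *+ (k - j == 0)%N + \sum_(i < n) dcoef n i * x i ^+ (k - j)) =
   - u * (kcoef n *+ (k == 0%N) + \sum_(i < n) dcoef n i * x i ^+ k) +
   v * (kcoef n * x n ^+ k + \sum_(i < n) dcoef n i *
     \sum_(j < k.+1) x i ^+ (k - j) * x n ^+ j).
  under eq_bigr => j _ do rewrite mulrDl.
  rewrite big_split /=; congr (_ + _).
    rewrite big_ord_recl /= [X in _ + X]big1 => [|j _].
      by rewrite addr0 subn0 mulr1n.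
    by rewrite mulr0n oppr0 mul0r.
  under eq_bigr => j _ do rewrite mulrDr.
  rewrite big_split /= mulrDr; congr (_ + _).
    rewrite big_ord_recr /= subnn eqxx mulr1n [X in X + _]big1 ?add0r; last first.
      by move=> j _; rewrite subn_eq0 leqNgt ltn_ord /= mulr0n mulr0.
    by rewrite -mulrA [_ * kcoef n]mulrC.
  under eq_bigr => j _ do rewrite mulr_sumr.
  rewrite exchange_big /= mulr_sumr; apply: eq_bigr => i _.
  rewrite !mulr_sumr; apply: eq_bigr => j _.
  by move: (dcoef n i) (x i ^+ _) (x n ^+ _) => p q r; ring.
have ge i : (i < n)%N ->
    \sum_(j < k.+1) x i ^+ (k - j) * x n ^+ j =
    (x i ^+ k.+1 - x n ^+ k.+1) / (x i - x n).
  move=> lt_in; have h : x i - x n != 0 by rewrite subr_eq0 (inj_eq x_inj) ltn_eqF.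
  apply: (mulIf h); rewrite divfK// subrXX mulrC; congr (_ * _).
rewrite [in RHS]big_ord_recr /= dcoef_max -/u kcoefS -/u.
have -> : \sum_(i < n) dcoef n i * (\sum_(j < k.+1) x i ^+ (k - j) * x n ^+ j) =
    \sum_(i < n) dcoef n i * ((x i ^+ k.+1 - x n ^+ k.+1) / (x i - x n)).
  by apply: eq_bigr => i _; rewrite ge.
have -> : \sum_(i < n) dcoef n.+1 i * x i ^+ k =
    - u * (\sum_(i < n) dcoef n i * x i ^+ k) +
    v * (\sum_(i < n) dcoef n i * ((x i ^+ k.+1 - x n ^+ k.+1) / (x i - x n))) -
    (\sum_(i < n) dcoef n i * (x n / (x n - x i))) * v * x n ^+ k.
  rewrite !mulr_sumr !mulr_suml -big_split -sumrB; apply: eq_bigr => i _ /=.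
  rewrite dcoefS// pkerE /v /u !exprS.
  have ni : x n - x i != 0 by rewrite subr_eq0 (inj_eq x_inj) gtn_eqF.
  have i_n : x i - x n != 0 by rewrite subr_eq0 (inj_eq x_inj) ltn_eqF.
  move: (dcoef n i) (x i ^+ k) (x n ^+ k) (x i) (x n) ni i_n => d p q y z h1 h2.
  by field; rewrite h1 h2.
move: (\sum_(_ < _) _) (\sum_(_ < _) _) (\sum_(_ < _) _) => A B C.
move: (kcoef n) (x n ^+ k) (k == 0%N) => p q c; rewrite /v.
by case: c; rewrite ?mulr1n ?mulr0n; ring.
Qed.

End PartialFractions.

(** * Partial fractions of G in n variables *)

Lemma gseq_coef (R : comNzRingType) (beta : R) k j :
  (gseq ('X : {poly R}) beta%:P k)`_j =
  2 *+ (k == j) + 3 * beta *+ (k == j.+1) + beta ^+ 2 *+ (k == j.+2) -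
  ((k == 0%N)%:R + beta *+ (k == 1%N)) *+ (j == 0%N).
Proof.
have e2 : 2 * 'X + 2 * beta%:P = (2 : R)%:P * 'X + (2 * beta)%:P :> {poly R}.
  by rewrite polyCM !polyC_natr.
case: k => [|[|k]] /=.
- rewrite coef1; case: j => [|j] /=; rewrite ?mulr0n ?mulr1n; ring.
- rewrite e2 coefD coefMX coefC; case: j => [|[|j]] /=; rewrite ?coefC /= ?mulr0n ?mulr1n; ring.
have -> : 'X^k * (2 * 'X^2 + 3 * beta%:P * 'X + beta%:P ^+ 2) =
   ((2 : R)%:P * 'X^2 + (3 * beta)%:P * 'X + (beta ^+ 2)%:P) * 'X^k.
  by rewrite mulrC !polyCM !polyC_natr -expr2.
rewrite coefMXn; case: ltnP => jk.
  have -> : (k.+2 == j) = false by lia.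
  have -> : (k.+2 == j.+1) = false by lia.
  have -> : (k.+2 == j.+2) = false by lia.
  by rewrite !mulr0n !addr0 mul0rn subr0.
have [i ->] : exists i, (j = k + i)%N by exists (j - k)%N; rewrite subnKC.
rewrite addKn !coefD coefMXn coefMX !coefC.
have -> : (k.+2 == k + i)%N = (i == 2)%N by lia.
have -> : (k.+2 == (k + i).+1)%N = (i == 1)%N by lia.
have -> : (k.+2 == (k + i).+2)%N = (i == 0)%N by lia.
rewrite mulr0n addr0 mul0rn subr0.
by case: i => [|[|[|i]]] /=; rewrite ?mulr0n ?mulr1n ?addr0 ?add0r.
Qed.

Lemma kf_neq0 c : c != 0 -> kf c != 0.
Proof. by rewrite fmorph_eq0. Qed.

Lemma xf_inj : injective xf.
Proof. by move=> i j /eqP; rewrite tofrac_eq => /eqP /var_inj. Qed.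

Local Notation bF := (kf beta).

Lemma beta_neq0 : beta != 0.
Proof. by rewrite /beta tofrac_eq0 polyX_eq0. Qed.

Lemma tofrac_series_neq0 (f : series) m : f m != 0 -> tofrac f != 0 :> Fr.
Proof. by rewrite tofrac_eq0; apply: contraNneq => ->. Qed.

Lemma res_mulX n f q m : (res n f * var n ^+ q) m =
  (if bnd n.+1 m then f (m `\` msetn (m n) n)%mset else 0) *+ (m n == q) :> K.
Proof.
rewrite mulrC varX monoM; case: ifP => qm; last first.
  case: eqP => [e|]; last by rewrite mulr0n.
  case/negP: qm; rewrite -e; apply/msubsetP => y; rewrite msetnE.
  by case: eqP => [->|].
have qn : (q <= m n)%N by have /msubsetP/(_ n) := qm; rewrite msetnxx.
rewrite /res.
have -> : bnd n (m `\` msetn q n)%mset = bnd n.+1 m && (m n == q).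
  apply/idP/andP => [/bndP h|[/bndP h /eqP e]].
    have := h n (leqnn n); rewrite msetE2 msetnxx => e; split; last by lia.
    apply/bndP => y ny; have := h y (ltnW ny).
    by rewrite msetE2 msetnE gtn_eqF// subn0.
  apply/bndP => y; rewrite leq_eqVlt msetE2 msetnE => /predU1P[<-|ny].
    by rewrite eqxx -e subnn.
  by rewrite gtn_eqF// subn0 h.
by case: (m n =P q) => [->|]; rewrite ?andbT ?andbF.
Qed.

Lemma bnd0 (m : monom) : bnd 0 m = (m == mset0).
Proof.
apply/idP/eqP => [/bndP h|->]; last by rewrite /bnd enum_mset0.
by apply/msetP => y; rewrite h// mset0E.
Qed.

Lemma res0_Gcoef k : res 0 (Gcoef k) = 1 *+ (k == 0%N).
Proof.
apply/funext => m; have -> : (1 *+ (k == 0%N) : series) m = (m == mset0)%:R *+ (k == 0%N).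
  by case: eqP.
rewrite /res bnd0; case: eqP => [->|_]; last by rewrite mul0rn.
by rewrite /Gcoef Gp0 coef1.
Qed.

(** The coefficient of z^j in the factor of G that belongs to x_n; the last term corrects the powers
    x_n^0 and x_n^1, where [gseq] departs from its general form. *)
Definition hser n j : series := 2 *: var n ^+ j + (3 * beta) *: var n ^+ j.+1 +
  beta ^+ 2 *: var n ^+ j.+2 - (var n ^+ 0 + beta *: var n ^+ 1) *+ (j == 0%N).

Lemma hser_combE (R : comNzRingType) (C b : R) (p q r s t u : bool) :
  2 * (C *+ p) + 3 * b * (C *+ q) + b ^+ 2 * (C *+ r) -
    (C *+ s + b * (C *+ t)) *+ u =
  C * (2 *+ p + 3 * b *+ q + b ^+ 2 *+ r - (s%:R + b *+ t) *+ u).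
Proof. by case: p; case: q; case: r; case: s; case: t; case: u; ring. Qed.

Lemma mulr_serD (f g h : series) m : (f * (g + h)) m = (f * g) m + (f * h) m :> K.
Proof. by rewrite mulrDr. Qed.

Lemma mulr_serZ c (f g : series) m : (f * (c *: g)) m = c * (f * g) m :> K.
Proof. by rewrite -scalerAr. Qed.

Lemma mulr_serB (f g h : series) m : (f * (g - h)) m = (f * g) m - (f * h) m :> K.
Proof. by rewrite mulrBr. Qed.

Lemma mulr_ser_nat (f g : series) (b : bool) m :
  (f * (g *+ b)) m = (f * g) m *+ b :> K.
Proof. by case: b; rewrite ?mulr0n ?mulr1n ?mulr0. Qed.

Lemma res_mul_hser n f j m : (res n f * hser n j) m =
  (if bnd n.+1 m then f (m `\` msetn (m n) n)%mset else 0) *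
  (gseq ('X : {poly K}) beta%:P (m n))`_j.
Proof.
rewrite gseq_coef /hser mulr_serB !mulr_serD !mulr_serZ mulr_ser_nat mulr_serD.
rewrite (mulr_serZ beta (res n f) (var n ^+ 1)).
suff comb (V : nat -> K) C : (forall q, V q = C *+ (m n == q)) ->
    2 * V j + 3 * beta * V j.+1 + beta ^+ 2 * V j.+2 -
      (V 0%N + beta * V 1%N) *+ (j == 0%N) =
    C * (2 *+ (m n == j) + 3 * beta *+ (m n == j.+1) + beta ^+ 2 *+ (m n == j.+2) -
      ((m n == 0%N)%:R + beta *+ (m n == 1%N)) *+ (j == 0%N)).
  exact: (comb (fun q => (res n f * var n ^+ q) m) _ (fun q => res_mulX n f q m)).
move=> VE; rewrite !VE.
exact: (@hser_combE K C beta (m n == j) (m n == j.+1) (m n == j.+2)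
  (m n == 0%N) (m n == 1%N) (j == 0%N)).
Qed.

Lemma res_GcoefS n k : res n.+1 (Gcoef k) =
  \sum_(j < k.+1) hser n j * res n (Gcoef (k - j)).
Proof.
apply/funext => m.
have -> : (\sum_(j < k.+1) hser n j * res n (Gcoef (k - j))) m =
    \sum_(j < k.+1) (res n (Gcoef (k - j)) * hser n j) m :> K.
  elim/big_rec2: _ => [//|j g h _ IH]; by rewrite seriesD IH mulrC.
under eq_bigr => j _ do rewrite res_mul_hser.
rewrite /res; case: ifP => bm; last first.
  by rewrite big1// => j _; rewrite mul0r.
set m' := (m `\` msetn (m n) n)%mset.
have bm' : bnd n m'.
  apply/bndP => y; rewrite leq_eqVlt msetE2 msetnE => /predU1P[<-|ny].
    by rewrite eqxx subnn.
  by rewrite gtn_eqF// subn0; move/bndP: bm; apply.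
have GE : Gp m = gseq 'X beta%:P (m n) * Gp m'.
  rewrite (GpE bm) (GpE bm') big_ord_recr /= mulrC; congr (_ * _).
  by apply: eq_bigr => i _; rewrite msetE2 msetnE ltn_eqF// subn0.
rewrite {1}/Gcoef GE coefM; apply: eq_bigr => j _; exact: mulrC.
Qed.

Local Notation dF := (dcoef (kf beta) xf).

Lemma tofrac_comb (R : idomainType) (f g h e e' : R) k :
  tofrac (f + g + h - (e + e') *+ k) =
  tofrac f + tofrac g + tofrac h - (tofrac e + tofrac e') *+ k.
Proof. by rewrite tofracB tofracMn !tofracD. Qed.

Lemma tofracZX c n q : tofrac (c *: var n ^+ q) = kf c * xf n ^+ q.
Proof. by rewrite tofracZ tofracXn. Qed.

Lemma hser_algebra (R : comNzRingType) (b x y : R) (k : bool) :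
  2 * y + 3 * b * (x * y) + b * b * (x * (x * y)) - (1 + b * x) *+ k =
  - ((1 + b * x) *+ k) + (2 + b * x) * (1 + b * x) * y.
Proof. by case: k; ring. Qed.

Lemma tofrac_hser n j : tofrac (hser n j) =
  - ((1 + kf beta * xf n) *+ (j == 0%N)) +
  (2 + kf beta * xf n) * (1 + kf beta * xf n) * xf n ^+ j.
Proof.
have k2 : kf 2 = 2 by exact: (rmorph_nat kf 2).
have k3 : kf (3 * beta) = 3 * kf beta.
  by rewrite (rmorphM kf); congr (_ * _); exact: (rmorph_nat kf 3).
have kb : kf (beta ^+ 2) = kf beta * kf beta by rewrite (rmorphXn kf).
have v0 : tofrac (var n ^+ 0) = 1 :> Fr by exact: tofrac1.
transitivity (kf 2 * xf n ^+ j + kf (3 * beta) * xf n ^+ j.+1 +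
  kf (beta ^+ 2) * xf n ^+ j.+2 - (1 + kf beta * xf n ^+ 1) *+ (j == 0%N)).
  by rewrite -v0 -!tofracZX; exact: tofrac_comb.
rewrite k2 k3 kb (exprS (xf n) j.+1) (exprS (xf n) j) expr1.
exact: hser_algebra.
Qed.

Lemma tofrac_res_Gcoef n k : tofrac (res n (Gcoef k)) =
  kcoef (kf beta) xf n *+ (k == 0%N) + \sum_(i < n) dF n i * xf i ^+ k.
Proof.
elim: n k => [|n IH] k.
  by rewrite res0_Gcoef tofracMn tofrac1 big_ord0 addr0 /kcoef big_ord0.
rewrite res_GcoefS rmorph_sum -partial_fractions_step; last exact: xf_inj.
apply: eq_bigr => j _.
transitivity (tofrac (hser n j) * tofrac (res n (Gcoef (k - j)))).
  exact: tofracM.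
by rewrite tofrac_hser IH.
Qed.

(** * One-row and two-index functions in n variables *)

Section InverseAlgebra.
Variables (R : comNzRingType) (x y z : R).
Hypothesis xy : (1 + z * x) * y = 1.

(** In these identities z is beta and y is 1 / (1 + beta x), so that - (x y) is the inverse of x for
    the formal group law. *)
Lemma inv_alg1 : y * (0 - x * y - x) = (2 + z * x) * (- (x * y)) * y.
Proof.
transitivity (- (x * y * (y + (1 + z * x) * y))); last by ring.
by rewrite xy; ring.
Qed.

Lemma inv_alg2 : y * y - y = z * (- (x * y) * y).
Proof.
transitivity (y * y - y * ((1 + z * x) * y)); first by rewrite xy mulr1.
by ring.
Qed.

Lemma inv_alg3 p t :
  y * ((2 + z * x) * p * y) - z * t - (2 + z * x) * p * y =
  - z * (t - (2 + z * x) * (- (x * y) * p) * y).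
Proof.
transitivity ((2 + z * x) * p * (y * y - y) - z * t); first by ring.
by rewrite inv_alg2; ring.
Qed.

Lemma inv_alg4 : y * y - z * ((2 + z * x) * - (x * y) * y) = 1.
Proof.
transitivity (((1 + z * x) * y) * ((1 + z * x) * y)); first by ring.
by rewrite xy mulr1.
Qed.

Lemma inv_alg5 p : y * (0 - x * ((2 + z * x) * p * y) - 0) =
  (2 + z * x) * (- (x * y) * p) * y.
Proof. by ring. Qed.

End InverseAlgebra.

Lemma addr_eq_swap (V : zmodType) (a b c d : V) :
  a + b + c = - d -> a + c = - b - d.
Proof. by move=> <-; rewrite addrAC [RHS]addrC addrK. Qed.

Lemma eqd_subr_eq0 L f g : eqd L f g <-> eqd L (f - g) 0.
Proof.
split=> h m mL.
  by rewrite -[LHS]/(f m - g m) h// subrr.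
apply/eqP; rewrite -subr_eq0; apply/eqP; exact: (h m mL).
Qed.

Lemma eqdM_shift a b f g g' : eqd a f 0 -> eqd b g g' ->
  eqd (a + b) (f * g) (f * g').
Proof.
move=> h1 /eqd_subr_eq0 h2; apply/eqd_subr_eq0; rewrite -mulrBr.
exact: eqdM0.
Qed.

Section SingleVariable.
Variable i : nat.
Local Notation x := (var i).

Definition pser (c : nat -> K) : series :=
  fun m => if m == msetn (m i) i then c (m i) else 0.

Lemma pser_eqd c L : eqd L (pser c) (\sum_(p < L) c p *: x ^+ p).
Proof.
move=> m mL.
have -> : (\sum_(p < L) c p *: x ^+ p) m =
    \sum_(p < L) c p * (m == msetn p i)%:R :> K.
  elim/big_rec2: _ => [//|p f g _ IH]; by rewrite seriesD IH seriesZ varX.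
rewrite /pser; case: eqP => [e|ne].
  have miL : (m i < L)%N by move: mL; rewrite {1}e degm_msetn.
  rewrite (bigD1 (Ordinal miL))//= -e eqxx mulr1 big1 ?addr0// => p pm.
  rewrite (_ : (m == _) = false) ?mulr0//; apply: contraNF pm => /eqP e'.
  by apply/eqP/val_inj; rewrite /= e' msetnxx.
rewrite big1// => p _; rewrite (_ : (m == _) = false) ?mulr0//.
by apply/eqP => e; apply: ne; rewrite {2}e msetnxx.
Qed.

Lemma eq_pser c c' : c =1 c' -> pser c = pser c'.
Proof. by move=> /funext ->. Qed.

Lemma pserZ a c : pser (fun p => a * c p) = a *: pser c.
Proof.
by apply/funext => m; rewrite seriesZ /pser; case: ifP => _; rewrite ?mulr0.
Qed.

Lemma pserD c c' : pser (fun p => c p + c' p) = pser c + pser c'.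
Proof.
by apply/funext => m; rewrite seriesD /pser; case: ifP => _; rewrite ?addr0.
Qed.

Lemma pser_delta : pser (fun p => (p == 0%N)%:R) = 1.
Proof.
apply: (@eqd_eq 1) => -[//|L] _; apply: (eqd_trans (@pser_eqd _ _)).
rewrite big_ord_recl /= expr0 scale1r big1 ?addr0; first exact: eqd_refl.
by move=> p _; rewrite scale0r.
Qed.

Definition sh (c : nat -> K) (p : nat) : K := if p is q.+1 then c q else 0.

Lemma pser_shift c : x * pser c = pser (sh c).
Proof.
apply: (@eqd_eq 0) => L _.
apply: (eqd_trans (eqdM (eqd_refl _) (@pser_eqd c L))); apply: eqd_sym.
apply: (eqdW (leqnSn L)); apply: (eqd_trans (@pser_eqd _ _)).
rewrite big_ord_recl /= scale0r add0r mulr_sumr.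
by under [X in eqd _ _ X]eq_bigr => p _ do rewrite -scalerAr -exprS.
Qed.

Definition bS : series := beta%:A.

Lemma bSE f : bS * f = beta *: f.
Proof. by rewrite /bS mulr_algl. Qed.

Definition ui : series := pser (fun p => (- beta) ^+ p).

Lemma pser_mulu c : (1 + bS * x) * pser c = pser (fun p => c p + beta * sh c p).
Proof. by rewrite mulrDl mul1r -mulrA pser_shift bSE -pserZ -pserD. Qed.

Lemma uiE : (1 + bS * x) * ui = 1.
Proof.
rewrite pser_mulu -pser_delta; apply: eq_pser => -[|p] /=.
  by rewrite mulr0 addr0.
by rewrite exprS mulNr addNr.
Qed.

Lemma mulu_eq f g : (1 + bS * x) * f = g -> f = ui * g.
Proof. by move=> <-; rewrite mulrA [ui * _]mulrC uiE mul1r. Qed.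

(** Generating series over the first index, which is never positive. The recurrences in that index
    become multiplication by 1 + beta x and can be inverted; what remains are recurrences in b. *)
Let T0 b := pser (fun p => tau0 (- p%:Z) b).
Let T1 b := pser (fun p => tau1 (- p%:Z) b).
Let T2 b := pser (fun p => tau2 (- p%:Z) b).
Definition tau3_ser b := pser (fun p => tau3 (- p%:Z) b).

Let NSz (p : nat) : - (p.+1)%:Z = - p%:Z - 1.
Proof. by lia. Qed.

Lemma T3E b : tau3_ser b = ui * T1 b.
Proof.
apply: mulu_eq; rewrite pser_mulu; apply: eq_pser => -[|p] /=.
  by have := tau3_rel 1 b; rewrite subrr (tau3_gt0 _ (a := 1)).
by rewrite NSz tau3_rel.
Qed.

Lemma T2E b : T2 b = ui * T0 b.
Proof.
apply: mulu_eq; rewrite pser_mulu; apply: eq_pser => -[|p] /=.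
  by have := tau2_rel 1 b; rewrite subrr (tau2_gt0 _ (a := 1)).
by rewrite NSz tau2_rel.
Qed.

Lemma T1_rel b : T1 (b - 1) + bS * T1 b = T2 (b - 1).
Proof.
rewrite bSE -pserZ -pserD; apply: eq_pser => p; exact: tau1_rel.
Qed.

Lemma T0_rel b : T0 b = ui * ((b == 0)%:R - x * T0 (b - 1) - x *+ (b == 1)).
Proof.
apply: mulu_eq; rewrite pser_mulu.
have e1 : ((b == 0)%:R : series) = pser (fun p => (b == 0)%:R * (p == 0%N)%:R).
  by rewrite pserZ pser_delta; case: (b == 0); rewrite ?scale1r ?scale0r.
have e2 : x *+ (b == 1) = pser (fun p => (b == 1)%:R * (p == 1%N)%:R).
  rewrite pserZ -[x]mulr1 -pser_delta pser_shift.
  rewrite (_ : sh _ = fun p => (p == 1%N)%:R); last by apply/funext => -[].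
  by case: (b == 1); rewrite ?scale1r ?scale0r.
pose A p : K := (b == 0)%:R * (p == 0%N)%:R.
pose B p : K := -1 * sh (fun q => tau0 (- q%:Z) (b - 1)) p.
pose C p : K := -1 * ((b == 1)%:R * (p == 1%N)%:R).
transitivity (pser (fun p => A p + B p + C p)); last first.
  have eB : pser B = - (x * T0 (b - 1)).
    by rewrite /B (pserZ (-1) (sh _)) scaleN1r /T0 pser_shift.
  have eC : pser C = - (x *+ (b == 1)).
    by rewrite e2 -scaleN1r -(pserZ (-1) (fun p => (b == 1)%:R * (p == 1%N)%:R)).
  have eAB : pser (fun p => A p + B p) = (b == 0)%:R - x * T0 (b - 1).
    by rewrite e1 -eB; exact: pserD.
  by rewrite -eAB -eC; exact: pserD.
apply: eq_pser => -[|p]; rewrite /A /B /C /=.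
  by rewrite !mulr0 !addr0 mulr1 tau0_0.
have := @tau0_rel (- p%:Z) b; rewrite -NSz => /(_ _); rewrite oppr_le0 => /(_ isT).
have -> : (- p%:Z == 0) = (p == 0%N) by lia.
have -> : (p.+1 == 1)%N = (p == 0)%N by [].
move=> h; rewrite mulr0 add0r !mulN1r -natrM mulnb andbC.
exact: addr_eq_swap h.
Qed.

Lemma T0_neg b : b < 0 -> T0 b = 0.
Proof.
move=> b0; rewrite -(scale0r (pser (fun=> 0))) -pserZ.
by apply: eq_pser => p; rewrite tau0_lt0// mul0r.
Qed.

Let Xs := - (x * ui).

Lemma T0_0 : T0 0 = ui.
Proof. by rewrite T0_rel T0_neg// mulr0 subr0 subr0 mulr1. Qed.

Lemma T0_pos n : T0 n.+1%:Z = (2 + bS * x) * Xs ^+ n.+1 * ui.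
Proof.
elim: n => [|n IH].
  rewrite expr1 -(inv_alg1 uiE).
  have := T0_rel 1; rewrite subrr T0_0; exact.
rewrite exprS -inv_alg5 -IH; have := T0_rel n.+2%:Z.
by rewrite (_ : n.+2%:Z - 1 = n.+1).
Qed.

Let T1_step b : T1 (b - 1) = T2 (b - 1) - bS * T1 b.
Proof. by rewrite -T1_rel addrK. Qed.

(** [T1_step] expresses T1 through its value at the next larger b, so there is no initial value to
    start from. Instead, the error e satisfies e_k = - beta e_(k+1) and e_k has order at least k + 1
    in x; iterating gives e_n arbitrarily high order. *)
Lemma T1_pos n : T1 n.+1%:Z = (2 + bS * x) * Xs ^+ n.+1 * ui.
Proof.
apply/eqP; rewrite -subr_eq0; apply/eqP.
pose e k := T1 k.+1%:Z - (2 + bS * x) * Xs ^+ k.+1 * ui.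
have eS k : e k = - bS * e k.+1.
  rewrite /e (_ : k.+1%:Z = k.+2%:Z - 1); last by lia.
  rewrite T1_step T2E (_ : k.+2%:Z - 1 = k.+1); last by lia.
  rewrite T0_pos [Xs ^+ k.+2]exprS; exact: (inv_alg3 uiE).
have eN k N : e k = (- bS) ^+ N * e (k + N)%N.
  elim: N => [|N IH]; first by rewrite mul1r addn0.
  by rewrite IH eS exprSr mulrA addnS.
have e0 k : eqd k.+1 (e k) 0.
  have x0 : eqd k.+1 (Xs ^+ k.+1) 0.
    apply: eqdX0 => m m1; rewrite /Xs -scaleN1r seriesZ.
    by rewrite (@eqdM0 1 0 _ ui (@var_eqd i) (fun m h => match notF h with end)) ?mulr0.
  have w0 : eqd k.+1 ((2 + bS * x) * Xs ^+ k.+1 * ui) 0.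
    rewrite mulrAC -[k.+1]add0n; apply: eqdM0 => //.
  apply: (proj1 (eqd_subr_eq0 _ _ _)); apply: (fun h => eqd_trans h (eqd_sym w0)) => m mk.
  rewrite /T1 /pser; case: eqP => // me.
  have dm : degm m = m i by rewrite {1}me degm_msetn.
  by rewrite tau1_ltD//; move: mk; rewrite dm; lia.
apply: (@eqd_eq 0) => L _; rewrite -/(e n) (eN n L).
apply: (@eqdW L (0 + (n + L).+1)); first by lia.
by apply: eqdM0.
Qed.

Lemma T1_neg n : T1 (- n%:Z) = (- bS) ^+ n.
Proof.
elim: n => [|n IH].
  rewrite -[- 0%:Z]/(1 - 1 : int) T1_step (T1_pos 0) T2E T0_0 expr1 /Xs.
  exact: (inv_alg4 uiE).
by rewrite NSz T1_step IH T2E T0_neg ?mulr0 ?sub0r ?exprS ?mulNr//; lia.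
Qed.

Lemma tau3_ser_pos n :
  tau3_ser n.+1%:Z = (2 + bS * x) * (- (x * ui)) ^+ n.+1 * ui ^+ 2.
Proof. by rewrite T3E T1_pos /Xs expr2 mulrC mulrA. Qed.

Lemma tau3_ser_neg n : tau3_ser (- n%:Z) = (- bS) ^+ n * ui.
Proof. by rewrite T3E T1_neg mulrC. Qed.

End SingleVariable.

Lemma geometric_eqd (y v : series) M : eqd 1 y 0 -> (1 + bS * y) * v = 1 ->
  eqd M (\sum_(j < M) (- bS * y) ^+ j) v.
Proof.
move=> y0 yv; set w := - bS * y; set S := \sum_(_ < _) _.
have SE : S = v - w ^+ M * v.
  rewrite -[LHS]mul1r -yv mulrAC; transitivity (v - (w ^+ M - 1 + 1) * v); last by rewrite subrK.
  rewrite subrX1 -/S /w; move: S bS => T z.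
  by ring.
apply: (proj2 (eqd_subr_eq0 _ _ _)).
have -> : S - v = - v * w ^+ M by rewrite SE [LHS]addrAC subrr sub0r mulNr mulrC.
rewrite -[M]add0n; apply: eqdM0 => //; apply: eqdX0.
by rewrite /w -[1%N]add0n; apply: eqdM0.
Qed.

Lemma tau_sum_single i (a b L : nat) (c : int) : (0 < a)%N -> (a <= L)%N ->
  eqd L (\sum_(k < L) tau3 (a%:Z - k%:Z) c *: var i ^+ k)
        (var i ^+ a * tau3_ser i c).
Proof.
move=> a0 aL; have [d ->] : exists d, L = (a + d)%N by exists (L - a)%N; rewrite subnKC.
rewrite big_split_ord /= [X in X + _]big1 ?add0r => [|k _]; last first.
  by rewrite tau3_gt0 ?scale0r//; have := ltn_ord k; lia.
have -> : \sum_(k < d) tau3 (a%:Z - (a + k)%N%:Z) c *: var i ^+ (a + k) =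
    var i ^+ a * \sum_(k < d) tau3 (- k%:Z) c *: var i ^+ k.
  rewrite mulr_sumr; apply: eq_bigr => k _; rewrite -scalerAr -exprD.
  by rewrite (_ : a%:Z - (a + k)%N%:Z = - k%:Z); last by lia.
apply: eqdM_shift; first exact: eqdX0 (@var_eqd i).
exact: eqd_sym (@pser_eqd i _ d).
Qed.

(** The terms with k < a vanish. From l = b on, [tau3_ser] is a geometric progression, whose sum is
    the last term, with v = 1 / (1 + beta y). *)
Lemma tau_sum i (y v : series) (a b L : nat) :
  (0 < a)%N -> (0 < b)%N -> (a + b <= L)%N -> eqd 1 y 0 -> (1 + bS * y) * v = 1 ->
  eqd L (\sum_(k < L) \sum_(l < L)
           tau3 (a%:Z - k%:Z) (b%:Z - l%:Z) *: (var i ^+ k * y ^+ l))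
        (var i ^+ a * (\sum_(l < b) y ^+ l * tau3_ser i (b%:Z - l%:Z) +
           y ^+ b * v * ui i)).
Proof.
move=> a0 b0 abL y0 yv; rewrite exchange_big /=.
have h1 : eqd L (\sum_(l < L) \sum_(k < L)
      tau3 (a%:Z - k%:Z) (b%:Z - l%:Z) *: (var i ^+ k * y ^+ l))
    (\sum_(l < L) y ^+ l * (var i ^+ a * tau3_ser i (b%:Z - l%:Z))).
  apply: eqd_sum => l _.
  have -> : \sum_(k < L) tau3 (a%:Z - k%:Z) (b%:Z - l%:Z) *: (var i ^+ k * y ^+ l) =
      y ^+ l * \sum_(k < L) tau3 (a%:Z - k%:Z) (b%:Z - l%:Z) *: var i ^+ k.
    rewrite mulr_sumr; apply: eq_bigr => k _; rewrite -scalerAr.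
    by congr (_ *: _); exact: mulrC.
  by apply: eqdM => //; apply: tau_sum_single => //; lia.
apply: (eqd_trans h1).
have [d dE] : exists d, L = (b + d)%N by exists (L - b)%N; lia.
rewrite dE big_split_ord /= mulrDr; apply: eqdD.
  rewrite mulr_sumr; have -> : \sum_(l < b) y ^+ l * (var i ^+ a * tau3_ser i (b%:Z - l%:Z)) =
    \sum_(l < b) var i ^+ a * (y ^+ l * tau3_ser i (b%:Z - l%:Z)); last by [].
  by apply: eq_bigr => l _; rewrite mulrCA.
have -> : \sum_(l < d) y ^+ (b + l) * (var i ^+ a * tau3_ser i (b%:Z - (b + l)%N%:Z)) =
    (var i ^+ a * ui i) * (y ^+ b * \sum_(l < d) (- bS * y) ^+ l).
  rewrite !mulr_sumr; apply: eq_bigr => l _.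
  rewrite (_ : b%:Z - (b + l)%N%:Z = - l%:Z); last by lia.
  rewrite tau3_ser_neg exprD exprMn.
  by move: (y ^+ b) (y ^+ l) (_ ^+ l) (_ ^+ a) (ui i) => p q r s t; ring.
have -> : var i ^+ a * (y ^+ b * v * ui i) = (var i ^+ a * ui i) * (y ^+ b * v).
  by move: (y ^+ b) (_ ^+ a) (ui i) => p s t; ring.
apply: eqdM => //; apply: eqdM_shift; first exact: eqdX0.
exact: geometric_eqd.
Qed.

Section Algebra.
Variables (F : fieldType) (b : F).

Lemma row_alg (c v u r e d f : F) : u != 0 ->
  c * (v * r) * (d * f) * (e / u) = c * v * u * (r / u ^+ 2 * (d * f * e)).
Proof. by move=> u0; field. Qed.

Lemma onerow_alg (c v r u : F) : u != 0 -> c * (v * r) = c * v * u * r / u.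
Proof. by move=> u0; field. Qed.

Lemma ysum_row_alg (c v p q e u w : F) : u != 0 -> w != 0 ->
  c * v * w * (p * q * e / (u ^+ 2 * w)) = p / u ^+ 2 * (c * (v * q) * e).
Proof. by move=> u0 w0; field; rewrite u0 w0. Qed.

Definition akl (y z : F) : F := (z - y) / oplus b y z.

Lemma pkerV (z w : F) : (pker b w z)^-1 = akl z w / (1 + b * z).
Proof.
rewrite pkerE invf_div /akl /oplus.
have -> : w + z + b * w * z = z + w + b * z * w by ring.
by rewrite invfM mulrA.
Qed.

Variable x : nat -> F.
Hypothesis x_inj : injective x.
Hypothesis u0 : forall i, 1 + b * x i != 0.
Hypothesis xx0 : forall i j, oplus b (x i) (x j) != 0.

(* For y = 0 and y = x_j this is the value of                                 *)
(* sum_(k, l) tau3 (a - k) (d - l) x_i^k y^l, with v = (1 + b y)^-1.          *)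
Definition ysum (i a d : nat) (y v : F) : F :=
  x i ^+ a * (\sum_(l < d) y ^+ l * ((2 + b * x i) *
    (- (x i / (1 + b * x i))) ^+ (d - l) * (1 + b * x i)^-1 ^+ 2) +
    y ^+ d * v * (1 + b * x i)^-1).

Lemma ysum_alg (p q r s t : F) :
  1 + b * p != 0 -> 1 + b * q != 0 -> oplus b p q != 0 ->
  r * ((2 + b * p) / (1 + b * p) ^+ 2 *
    (- (p / (1 + b * p)) * (t - s) / - (oplus b p q / (1 + b * p))) +
    s / (1 + b * q) / (1 + b * p)) =
  r * (2 + b * p) * t / (1 + b * p) ^+ 2 *
    (- (p / (1 + b * p)) / - (oplus b p q / (1 + b * p))) +
  r * s * akl p q / ((1 + b * p) ^+ 2 * (1 + b * q)).
Proof.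
rewrite /akl /oplus => h1 h2 h3; field.
by rewrite oppr_eq0 h1 h2 h3.
Qed.

(** Let X be the inverse of x_i for the formal group law. The geometric sum splits [ysum] into a
    part with X^d and a part with y^d. The parts with X^d add up to a multiple of the partial
    fraction at y = X, which is 0 because its factor [pker X (x i)] vanishes. The parts with y^d
    give the right-hand side. *)
Lemma ysum_row n i a d : (i < n)%N -> (0 < d)%N ->
  kcoef b x n * ysum i a d 0 1 +
    \sum_(j < n) dcoef b x n j * ysum i a d (x j) (1 + b * x j)^-1 =
  x i ^+ a / (1 + b * x i) ^+ 2 *
    \sum_(j < n) cfact b x n j * bpow b (x j) d * akl (x i) (x j).
Proof.
move=> lt_in d0; set u := 1 + b * x i; pose X := - (x i / u).
have ui0 : u != 0 by exact: u0.
have Xx j : X - x j = - (oplus b (x i) (x j) / u).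
  by rewrite /X /oplus /u; move: (x i) (x j) (u0 i) => p q h; field.
have Xx0 j : X - x j != 0.
  by rewrite Xx oppr_eq0 mulf_neq0// invr_eq0.
have XS : kcoef b x n + \sum_(j < n) dcoef b x n j * (X / (X - x j)) = 0.
  rewrite partial_fractions//; last by move=> j _; rewrite -subr_eq0.
  rewrite (bigD1 (Ordinal lt_in))//= pkerE.
  have -> : X + x i + b * X * x i = 0.
    by rewrite /X /u; move: (x i) (u0 i) => p h; field.
  by rewrite !mul0r.
have geo j : \sum_(l < d) x j ^+ l * X ^+ (d - l) =
    X * (X ^+ d - x j ^+ d) / (X - x j).
  apply: (mulIf (Xx0 j)); rewrite divfK// subrXX mulrCA [RHS]mulrC.
  congr (_ * _); rewrite mulr_sumr; apply: eq_bigr => l _.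
  rewrite mulrA -exprS [LHS]mulrC; congr (_ ^+ _ * _); have := ltn_ord l; lia.
have y0 : ysum i a d 0 1 = x i ^+ a * (2 + b * x i) * X ^+ d / u ^+ 2.
  rewrite /ysum -/u -/X; case: d d0 {geo} => // d _.
  rewrite big_ord_recl big1 ?addr0 /=; last first.
    by move=> l _; rewrite expr0n /= mul0r.
  rewrite [0 ^+ d.+1]expr0n /= !mul0r addr0 expr0 mul1r subn0 exprVn.
  by rewrite !mulrA.
have yj j : ysum i a d (x j) (1 + b * x j)^-1 =
    x i ^+ a * (2 + b * x i) * X ^+ d / u ^+ 2 * (X / (X - x j)) +
    x i ^+ a * x j ^+ d * akl (x i) (x j) / (u ^+ 2 * (1 + b * x j)).
  rewrite /ysum -/u -/X.
  have -> : \sum_(l < d) x j ^+ l * ((2 + b * x i) * X ^+ (d - l) * u^-1 ^+ 2) =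
      (2 + b * x i) / u ^+ 2 * (X * (X ^+ d - x j ^+ d) / (X - x j)).
    rewrite -geo mulr_sumr; apply: eq_bigr => l _; rewrite exprVn.
    by move: (x j ^+ l) (X ^+ _) (u ^+ 2)^-1 => p q r; ring.
  rewrite Xx; exact: ysum_alg (ui0) (u0 j) (xx0 i j).
rewrite y0; under eq_bigr => j _ do rewrite yj mulrDr.
rewrite big_split /= addrA.
have -> : kcoef b x n * (x i ^+ a * (2 + b * x i) * X ^+ d / u ^+ 2) +
   \sum_(j < n) dcoef b x n j *
     (x i ^+ a * (2 + b * x i) * X ^+ d / u ^+ 2 * (X / (X - x j))) = 0.
  move: (x i ^+ a * _ * _ / _) => c.
  have e := congr1 (fun z => c * z) XS; rewrite mulr0 mulrDr mulr_sumr in e.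
  rewrite -[RHS]e.
  rewrite [X in X + _ = _]mulrC; congr (_ + _).
  by apply: eq_bigr => j _; exact: mulrCA.
rewrite add0r mulr_sumr; apply: eq_bigr => j _.
rewrite /dcoef /bpow gtn_eqF//.
exact: (ysum_row_alg _ _ _ _ _ ui0 (u0 j)).
Qed.

(** The constant term of the second factor is treated as one more node y = 0, with 0^l as the delta
    at l = 0. The constant term of the first factor only meets [t 0 l]. *)
Lemma expand_pair n L (t : nat -> nat -> F) (D : nat -> F) (kap : F) :
  (forall l, t 0%N l = 0) ->
  \sum_(k < L) \sum_(l < L) t k l * ((kap *+ (k == 0%N :> nat) +
    \sum_(i < n) D i * x i ^+ k) * (kap *+ (l == 0%N :> nat) +
    \sum_(i < n) D i * x i ^+ l)) =
  \sum_(i < n) D i * (kap * (\sum_(k < L) \sum_(l < L) t k l * (x i ^+ k * 0 ^+ l)) +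
    \sum_(j < n) D j * \sum_(k < L) \sum_(l < L) t k l * (x i ^+ k * x j ^+ l)).
Proof.
move=> t0.
transitivity (\sum_(i < n) \sum_(k < L) \sum_(l < L) D i * (kap *
    (t k l * (x i ^+ k * 0 ^+ l)) + \sum_(j < n) D j * (t k l * (x i ^+ k * x j ^+ l)))).
  rewrite [RHS]exchange_big; apply: eq_bigr => k _ /=.
  rewrite [RHS]exchange_big; apply: eq_bigr => l _ /=.
  have -> : t k l * ((kap *+ (k == 0%N :> nat) + \sum_(i < n) D i * x i ^+ k) *
      (kap *+ (l == 0%N :> nat) + \sum_(i < n) D i * x i ^+ l)) =
     (\sum_(i < n) D i * x i ^+ k) * (t k l *
      (kap *+ (l == 0%N :> nat) + \sum_(i < n) D i * x i ^+ l)).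
    rewrite [LHS]mulrCA mulrDl; case: (nat_of_ord k) => [|k'].
      by rewrite t0 !mul0r !mulr0 addr0.
    by rewrite mulr0n mul0r add0r.
  rewrite mulr_suml; apply: eq_bigr => i _; rewrite -mulrA; congr (_ * _).
  rewrite mulrCA mulrDr mulrDr; congr (_ + _).
    by rewrite expr0n; case: (_ == _); rewrite ?mulr1n ?mulr0n; ring.
  by rewrite !mulr_sumr; apply: eq_bigr => j _; move: (D j) (x j ^+ _) => p q; ring.
apply: eq_bigr => i _; rewrite -[LHS]/(\sum_(k < L) _).
under eq_bigr => k _ do rewrite -mulr_sumr.
rewrite -mulr_sumr; congr (_ * _).
under eq_bigr => k _ do rewrite big_split /=.
rewrite big_split /=; congr (_ + _).
  by rewrite mulr_sumr; apply: eq_bigr => k _; rewrite mulr_sumr.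
under eq_bigr => k _ do rewrite exchange_big /=.
rewrite exchange_big /=; apply: eq_bigr => j _.
by rewrite mulr_sumr; apply: eq_bigr => k _; rewrite mulr_sumr.
Qed.

End Algebra.

Lemma oplus_neq0 i j : oplus (kf beta) (xf i) (xf j) != 0.
Proof.
have -> : oplus (kf beta) (xf i) (xf j) =
    tofrac (var i + var j + beta *: (var i * var j)).
  by rewrite !tofracD tofracZ tofracM /oplus mulrA.
apply: (@tofrac_series_neq0 _ (msetn 1 i)); rewrite !seriesD seriesZ.
have -> : (var i * var j) (msetn 1 i) = 0.
  apply: (@eqdM0 1 1 _ _ (@var_eqd i) (@var_eqd j)); by rewrite degm_msetn.
rewrite mulr0 addr0 {1}/var /mono eqxx /var /mono.
case: (msetn 1 i == msetn 1 j :> monom); last by rewrite addr0 oner_eq0.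
exact: (natK_neq0 1).
Qed.

Lemma u_mul_ui i : (1 + kf beta * xf i) * tofrac (ui i) = 1.
Proof.
rewrite /xf -tofracZ -tofrac1 -tofracD -tofracM -(bSE (var i)); congr tofrac.
exact: uiE.
Qed.

Lemma u_neq0 i : 1 + kf beta * xf i != 0.
Proof.
apply/eqP => h; have := u_mul_ui i.
by rewrite h mul0r => /eqP; rewrite eq_sym oner_eq0.
Qed.

Lemma tofrac_ui i : tofrac (ui i) = (1 + kf beta * xf i)^-1.
Proof. by apply: (mulfI (u_neq0 i)); rewrite u_mul_ui divff// u_neq0. Qed.

Lemma tofrac_res_sum n (I : Type) (r : seq I) (P : pred I) (f : I -> series) :
  tofrac (res n (\sum_(i <- r | P i) f i)) = \sum_(i <- r | P i) tofrac (res n (f i)).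
Proof.
elim/big_rec2: _ => [|i u v _ <-]; first by rewrite raddf0 tofrac0.
by rewrite raddfD -tofracD.
Qed.

Lemma tofrac_tau_sum i (y : series) (a b : int) L :
  tofrac (\sum_(k < L) \sum_(l < L)
    tau3 (a - k%:Z) (b - l%:Z) *: (var i ^+ k * y ^+ l)) =
  \sum_(k < L) \sum_(l < L) kf (tau3 (a - k%:Z) (b - l%:Z)) *
    (xf i ^+ k * tofrac y ^+ l).
Proof.
rewrite rmorph_sum; apply: eq_bigr => k _; rewrite rmorph_sum; apply: eq_bigr => l _.
by rewrite [LHS]tofracZ tofracM !tofracXn.
Qed.

Lemma flim_tau i y v (a b : nat) : (0 < a)%N -> (0 < b)%N ->
  eqd 1 y 0 -> (1 + bS * y) * v = 1 ->
  flim (fun L => \sum_(k < L) \sum_(l < L)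
      kf (tau3 (a%:Z - k%:Z) (b%:Z - l%:Z)) * (xf i ^+ k * tofrac y ^+ l))
    (ysum bF xf i a b (tofrac y) (tofrac v)).
Proof.
move=> a0 b0 y0 yv.
have -> : ysum bF xf i a b (tofrac y) (tofrac v) =
    tofrac (var i ^+ a * (\sum_(l < b) y ^+ l * tau3_ser i (b%:Z - l%:Z) +
           y ^+ b * v * ui i)).
  rewrite tofracM tofracXn tofracD !tofracM tofracXn tofrac_ui /ysum.
  congr (_ * (_ + _)); rewrite rmorph_sum; apply: eq_bigr => l _.
  have [d dE] : exists d, (b - l = d.+1)%N.
    by exists (b - l).-1; have := ltn_ord l; lia.
  rewrite [RHS]tofracM tofracXn; congr (_ * _).
  rewrite (_ : b%:Z - l%:Z = d.+1%:Z); last by lia.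
  rewrite tau3_ser_pos dE [RHS]tofracM [X in _ = X * _]tofracM !tofracXn.
  rewrite tofracN [in RHS]tofracM tofrac_ui; congr (_ * _ * _).
  rewrite tofracD tofracM; congr (_ + _); exact: esym (rmorph_nat _ 2).
apply: (@flim_eq 0 (fun L => tofrac (\sum_(k < L) \sum_(l < L)
    tau3 (a%:Z - k%:Z) (b%:Z - l%:Z) *: (var i ^+ k * y ^+ l)))).
  by move=> L _; rewrite tofrac_tau_sum.
by apply: (@flim_tofrac _ _ (a + b)) => L abL; apply: tau_sum.
Qed.

(** Both factors G are replaced by partial fractions, [flim_tau] gives the limit at each pair of
    nodes, and [ysum_row] carries out the sum over the second node. *)
Lemma tofrac_res_Phi_coef n (a b : nat) : (0 < a)%N -> (0 < b)%N ->
  tofrac (res n (Phi_coef a%:Z b%:Z)) =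
  \sum_(i < n) \sum_(j < n) cfact bF xf n i * bpow bF (xf i) a *
    (cfact bF xf n j * bpow bF (xf j) b) *
    (akl bF (xf i) (xf j) / (1 + bF * xf i)).
Proof.
move=> a0 b0.
pose S L := \sum_(k < L) \sum_(l < L)
  tau3 (a%:Z - k%:Z) (b%:Z - l%:Z) *: (Gcoef k * Gcoef l).
have SE L : eqd L (S L) (Phi_coef a%:Z b%:Z).
  move=> m mL; rewrite (Phi_coefE _ _ mL) /S.
  elim/big_rec2: _ => [//|k f g _ IH]; rewrite seriesD IH; congr (_ + _).
  elim/big_rec2: _ => [//|l f' g' _ IH']; rewrite seriesD IH' seriesZ.
  by congr (_ + _); exact: mulrC.
pose t k l : Fr := kf (tau3 (a%:Z - k%:Z) (b%:Z - l%:Z)).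
have SF L : tofrac (res n (S L)) = \sum_(k < L) \sum_(l < L) t k l *
    ((kcoef bF xf n *+ (k == 0%N :> nat) + \sum_(i < n) dcoef bF xf n i * xf i ^+ k) *
     (kcoef bF xf n *+ (l == 0%N :> nat) + \sum_(i < n) dcoef bF xf n i * xf i ^+ l)).
  rewrite /S tofrac_res_sum; apply: eq_bigr => k _.
  rewrite tofrac_res_sum; apply: eq_bigr => l _.
  transitivity (t k l * (tofrac (res n (Gcoef k)) * tofrac (res n (Gcoef l)))).
    rewrite -tofracM -resM /t -tofracZ -resZ //.
  by rewrite !tofrac_res_Gcoef.
apply: (@flim_unique (fun L => tofrac (res n (S L)))).
  by apply: (@flim_tofrac _ _ 0) => L _; apply: res_eqd; exact: SE.
apply: (@flim_eq 0 (fun L => \sum_(i < n) dcoef bF xf n i *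
   (kcoef bF xf n * (\sum_(k < L) \sum_(l < L) t k l * (xf i ^+ k * 0 ^+ l)) +
    \sum_(j < n) dcoef bF xf n j *
       \sum_(k < L) \sum_(l < L) t k l * (xf i ^+ k * tofrac (var j) ^+ l)))).
  move=> L _; rewrite SF -expand_pair// => l.
  by rewrite /t subr0 tau3_gt0 ?rmorph0.
have -> : \sum_(i < n) \sum_(j < n) cfact bF xf n i * bpow bF (xf i) a *
    (cfact bF xf n j * bpow bF (xf j) b) *
    (akl bF (xf i) (xf j) / (1 + bF * xf i)) =
  \sum_(i < n) dcoef bF xf n i *
   (kcoef bF xf n * ysum bF xf i a b 0 1 +
    \sum_(j < n) dcoef bF xf n j * ysum bF xf i a b (tofrac (var j)) (tofrac (ui j))).
  apply: eq_bigr => i _.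
  have := ysum_row xf_inj u_neq0 oplus_neq0 a (ltn_ord i) b0.
  under eq_bigr => j _ do rewrite -tofrac_ui.
  rewrite -/(xf _) => ->; rewrite !mulr_sumr; apply: eq_bigr => j _.
  rewrite /dcoef {1}/bpow gtn_eqF//; have := u_neq0 i.
  exact: (row_alg (cfact bF xf n i) (2 + bF * xf i)).
apply: flim_sum => i _; apply: flimM; first exact: flim_cst.
apply: flimD.
  apply: flimM; first exact: flim_cst.
  have := @flim_tau i 0 1 a b a0 b0; rewrite tofrac0 tofrac1; apply=> //.
  by rewrite mulr0 addr0 mulr1.
apply: flim_sum => j _; apply: flimM; first exact: flim_cst.
by apply: flim_tau => //; [exact: var_eqd|exact: uiE].
Qed.

(* The coefficient of z^a in (1 + beta / z)^-1 sum_k Gcoef_k z^k.             *)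
Definition onerow (a : nat) : series := fun m =>
  \sum_(t < (degm m).+1) (- beta) ^+ t * Gcoef (a + t) m.

Lemma onerow_eqd a L : eqd L (\sum_(t < L) (- beta) ^+ t *: Gcoef (a + t)) (onerow a).
Proof.
move=> m mL.
have -> : (\sum_(t < L) (- beta) ^+ t *: Gcoef (a + t)) m =
    \sum_(t < L) (- beta) ^+ t * Gcoef (a + t) m :> K.
  by elim/big_rec2: _ => [//|t f g _ IH]; rewrite seriesD IH seriesZ.
rewrite /onerow (big_ord_widen L (fun t => (- beta) ^+ t * Gcoef (a + t) m) mL).
rewrite [RHS]big_mkcond /=; apply: eq_bigr => t _; case: ltnP => // h.
by rewrite Gcoef_eq0 ?mulr0// (leq_trans h)// leq_addl.
Qed.

Lemma onerow_eq0 a m : (degm m < a)%N -> onerow a m = 0.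
Proof.
move=> ma; rewrite /onerow big1// => t _; rewrite Gcoef_eq0 ?mulr0//.
by rewrite (leq_trans ma)// leq_addr.
Qed.

(** At the pole z = 1 / x_i the factor 1 / (1 + beta / z) is 1 / u_i, which cancels the factor u_i
    of [dcoef]. *)
Lemma tofrac_res_onerow n a : (0 < a)%N ->
  tofrac (res n (onerow a)) = \sum_(i < n) cfact bF xf n i * bpow bF (xf i) a.
Proof.
move=> a0; apply: (@flim_unique (fun L =>
    tofrac (res n (\sum_(t < L) (- beta) ^+ t *: Gcoef (a + t))))).
  by apply: (@flim_tofrac _ _ 0) => L _; apply: res_eqd; exact: onerow_eqd.
apply: (@flim_eq 0 (fun L => \sum_(i < n) dcoef bF xf n i * xf i ^+ a *
    tofrac (\sum_(t < L) (- bS * var i) ^+ t))).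
  move=> L _; rewrite tofrac_res_sum.
  transitivity (\sum_(t < L) \sum_(i < n) dcoef bF xf n i * xf i ^+ a *
     (- bF * xf i) ^+ t).
    rewrite exchange_big; apply: eq_bigr => i _; rewrite -mulr_sumr; congr (_ * _).
    rewrite rmorph_sum; apply: eq_bigr => t _.
    by rewrite [LHS]tofracXn tofracM tofracN.
  apply: eq_bigr => t _.
  transitivity (kf (- beta) ^+ t * tofrac (res n (Gcoef (a + t)))); last first.
    by rewrite -rmorphXn -tofracZ -resZ.
  rewrite tofrac_res_Gcoef gtn_eqF ?addn_gt0 ?a0// mulr0n add0r mulr_sumr rmorphN.
  apply: eq_bigr => i _; rewrite exprD exprMn.
  by move: (dcoef _ _ _ _) (xf i ^+ a) (xf i ^+ t) (_ ^+ t) => p q r s; ring.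
have -> : \sum_(i < n) cfact bF xf n i * bpow bF (xf i) a =
    \sum_(i < n) dcoef bF xf n i * xf i ^+ a * tofrac (ui i).
  apply: eq_bigr => i _; rewrite tofrac_ui /dcoef /bpow gtn_eqF//.
  exact: (onerow_alg (cfact bF xf n i) (2 + bF * xf i) _ (u_neq0 i)).
apply: flim_sum => i _; apply: flimM; first exact: flim_cst.
apply: (@flim_tofrac _ _ 0) => L _; apply: geometric_eqd; first exact: var_eqd.
exact: uiE.
Qed.

Lemma Phi_coef_eq0 (a b : nat) m : (degm m < a + b)%N -> Phi_coef a%:Z b%:Z m = 0.
Proof.
move=> mab; rewrite (Phi_coefE _ _ (ltnSn (degm m))) big1// => k _; rewrite big1// => l _.
have [kl|kl] := ltnP (k + l) (a + b)%N.
  by rewrite tau3_ltD ?mulr0//; lia.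
have h j : eqd j (Gcoef j) 0 by move=> m' /Gcoef_eq0.
by rewrite (eqdM0 (h k) (h l)) ?mul0r// (leq_trans mab).
Qed.

(** * Symmetrization and expansion of Pfaffians *)

Lemma extend_inj r n (rn : (r <= n)%N) (f : 'I_r -> 'I_n) : injective f ->
  exists w : 'S_n, forall k, w (widen_ord rn k) = f k.
Proof.
move=> finj; suff h k : (k <= r)%N ->
    exists w : 'S_n, forall i : 'I_r, (i < k)%N -> w (widen_ord rn i) = f i.
  by have [w wf] := h r (leqnn r); exists w => k; apply: wf.
elim: k => [|k IH] kr; first by exists 1%g.
have [w wf] := IH (ltnW kr); pose k' := Ordinal kr.
exists (w * tperm (w (widen_ord rn k')) (f k'))%g => i; rewrite ltnS leq_eqVlt permM.
case/predU1P => [ik|ik].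
  by have -> : i = k' by [apply: val_inj]; rewrite tpermL.
rewrite (wf i ik) tpermD//.
  rewrite -(wf i ik) (inj_eq perm_inj); apply/eqP => /(congr1 val) /= e.
  by rewrite e ltnn in ik.
by rewrite (inj_eq finj); apply/eqP => /(congr1 val) /= e; rewrite e ltnn in ik.
Qed.

Lemma card_ord_geq r n : (r <= n)%N -> #|[pred i : 'I_n | (r <= i)%N]| = (n - r)%N.
Proof.
move=> rn; have e : #|[pred i : 'I_n | (i < r)%N]| = r.
  by rewrite -sum1_card (big_ord_narrow rn) sum1_card card_ord.
rewrite -{2}e -[n in (n - _)%N]card_ord -(cardC [pred i : 'I_n | (i < r)%N]).
by rewrite addKn; apply: eq_card => i; rewrite !inE -leqNgt.
Qed.

(** The permutations with a given injective restriction form a coset of the group permuting the last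
    n - r points. *)
Lemma sum_perm_restrict (R : nmodType) r n (rn : (r <= n)%N)
    (T : {ffun 'I_r -> 'I_n} -> R) :
  (forall f : {ffun 'I_r -> 'I_n}, ~~ injectiveb f -> T f = 0) ->
  \sum_(w : 'S_n) T [ffun k => w (widen_ord rn k)] = (\sum_f T f) *+ (n - r)`!.
Proof.
move=> T0; rewrite (partition_big (fun w : 'S_n => [ffun k => w (widen_ord rn k)]) xpredT)//=.
rewrite -sumrMnl; apply: eq_bigr => f _.
rewrite (eq_bigr (fun=> T f)) => [|w /eqP -> //].
have [finj|/T0 ->] := boolP (injectiveb f); last by rewrite big1 ?mul0rn.
have [w0 w0f] := extend_inj rn (injectiveP _ finj).
pose A : {set 'I_n} := finset (fun i : 'I_n => (r <= i)%N).
have cA : #|A| = (n - r)%N.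
  by rewrite -(card_ord_geq rn); apply: eq_card => i; rewrite finset.in_set [RHS]inE.
rewrite -cA -card_perm -sumr_const (reindex_inj (mulIg w0)) /=; apply: eq_bigl => s.
apply/eqP/idP => [e|/fintype.subsetP on].
  apply/fintype.subsetP => i; rewrite inE finset.in_set; apply: contraR; rewrite -ltnNge => ir.
  have := congr1 (fun g : {ffun _} => g (Ordinal ir)) e; rewrite ffunE permM -w0f.
  by move/perm_inj => h; apply/eqP; rewrite (_ : i = widen_ord rn (Ordinal ir))//; apply: val_inj.
apply/ffunP => k; rewrite ffunE permM -w0f; congr (w0 _).
apply/eqP; apply: contraTT (ltn_ord k) => /on; rewrite finset.in_set /=.
by rewrite -leqNgt.
Qed.

Section Symmetrizer.
Variables (F : fieldType) (b : F) (x : nat -> F).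
Hypothesis x_inj : injective x.
Hypothesis u0 : forall i, 1 + b * x i != 0.
Hypothesis xx0 : forall i j, oplus b (x i) (x j) != 0.

Definition symterm n (lambda : seq nat) (r := size lambda) (f : 'I_r -> nat) : F :=
  \prod_(k < r) (cfact b x n (f k) * bpow b (x (f k)) (nth 0%N lambda k) *
     (1 + b * x (f k))^-1 ^+ (r.-1 - k)) *
  \prod_(k < r) \prod_(l < r | (k < l)%N) akl b (x (f k)) (x (f l)).

Lemma pker_neq0 i j : i != j -> pker b (x i) (x j) != 0.
Proof.
move=> ij; rewrite pkerE mulf_neq0 ?mulf_neq0 ?xx0 ?u0//.
by rewrite invr_eq0 subr_eq0 (inj_eq x_inj).
Qed.

(** The product over j > k in row k is the full product [cfact] divided by the factors of the
    earlier places l < k. By [pkerV] the inverse of such a factor is A(x_(f l), x_(f k)) / u_(f l);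
    collecting by l, there are r - 1 - l powers of 1 / u_(f l). *)
Lemma GQ_term_restrict n (lambda : seq nat) (w : 'S_n) (rn : (size lambda <= n)%N) :
  GQ_term b lambda (fun i => x (w i)) =
  symterm n (lambda := lambda) (fun k => w (widen_ord rn k)).
Proof.
set r := size lambda in rn *; pose f (k : 'I_r) := w (widen_ord rn k).
rewrite /GQ_term !(big_ord_narrow rn) /=.
have row (k : 'I_r) :
    \prod_(j < n | (widen_ord rn k < j)%N) pker b (x (f k)) (x (w j)) =
    cfact b x n (f k) * \prod_(l < r | (l < k)%N) (pker b (x (f k)) (x (f l)))^-1.
  have -> : cfact b x n (f k) =
      \prod_(j < n | j != widen_ord rn k) pker b (x (f k)) (x (w j)).
    rewrite /cfact (reindex_inj (@perm_inj _ w)); apply: eq_bigl => j /=.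
    by rewrite val_eqE (inj_eq perm_inj).
  rewrite [in RHS](bigID (fun j : 'I_n => (j < k)%N)) /= mulrAC.
  have -> : \prod_(j < n | (j != widen_ord rn k) && (j < k)%N)
      pker b (x (f k)) (x (w j)) = \prod_(l < r | (l < k)%N) pker b (x (f k)) (x (f l)).
    have := @big_ord_narrow_cond _ 1 *%R r n (fun j : 'I_n => (j < k)%N)
       (fun j => pker b (x (f k)) (x (w j))) rn.
    rewrite /= => <-; apply: eq_bigl => j.
    apply/andP/andP => -[h1 h2]; split=> //.
      exact: ltn_trans h2 (ltn_ord k).
    by rewrite -val_eqE /= ltn_eqF.
  rewrite -[in RHS]big_split /= [X in _ = X * _]big1 ?mul1r => [|l lk].
    apply: eq_bigl => j; rewrite -val_eqE /= -leqNgt ltn_neqAle eq_sym.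
    by [].
  rewrite divff// pker_neq0// val_eqE /f (inj_eq perm_inj) -val_eqE /=.
  by rewrite gtn_eqF.
under [X in _ * X]eq_bigr => k _ do rewrite row.
rewrite big_split /= mulrA /symterm -/r big_split /= -!mulrA.
rewrite [X in _ = X * _]big_split /= [X in _ = X * _]mulrC -!mulrA; congr (_ * (_ * _)).
rewrite (exchange_big_dep xpredT) //= -big_split /=; apply: eq_bigr => l _.
under eq_bigr => k _ do rewrite pkerV.
rewrite big_split /= mulrC; congr (_ * _).
rewrite prodr_const; congr (_ ^+ _).
have -> : #|[pred k : 'I_r | (l < k)%N]| = #|[pred k : 'I_r | (l.+1 <= k)%N]|.
  by [].
by rewrite card_ord_geq//; have := ltn_ord l; lia.
Qed.

Lemma symterm_eq0 n (lambda : seq nat) (f : 'I_(size lambda) -> nat) k l :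
  k != l -> f k = f l -> symterm n f = 0.
Proof.
wlog kl : k l / (k < l)%N.
  move=> h ne e; case: (ltngtP k l) => [kl|lk|/val_inj kl].
  - exact: h kl ne e.
  - by apply: h lk _ (esym e); rewrite eq_sym.
  - by rewrite kl eqxx in ne.
move=> _ e; have a0 : akl b (x (f k)) (x (f l)) = 0 by rewrite /akl e subrr mul0r.
rewrite /symterm [X in _ * X](bigD1 k)//= [X in _ * (X * _)](bigD1 l)//= a0.
by rewrite !mul0r mulr0.
Qed.

Lemma symmetrize n (lambda : seq nat) : (size lambda <= n)%N ->
  (n - size lambda)`!%:R != 0 :> F ->
  ((n - size lambda)`!%:R)^-1 *
    \sum_(w : 'S_n) GQ_term b lambda (fun i => x (w i)) =
  \sum_(f : {ffun 'I_(size lambda) -> 'I_n}) symterm n (fun k => f k).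
Proof.
move=> rn f0; rewrite (eq_bigr _ (fun w _ => GQ_term_restrict w rn)).
pose T (f : {ffun 'I_(size lambda) -> 'I_n}) : F := symterm n (fun k => f k).
have -> : \sum_(w : 'S_n) symterm n (lambda := lambda) (fun k => w (widen_ord rn k)) =
    \sum_(w : 'S_n) T [ffun k => w (widen_ord rn k)].
  apply: eq_bigr => w _; rewrite /T; congr symterm; apply/funext => k.
  by rewrite ffunE.
rewrite sum_perm_restrict => [|f /injectivePn[k [l kl e]]].
  by rewrite -[X in _ * X]mulr_natl mulKf.
by apply: (symterm_eq0 _ kl); rewrite e.
Qed.

End Symmetrizer.

(** * Multilinear expansion of a Pfaffian *)

Section PfaffianSums.
Variable R : comNzRingType.

Lemma eq_Pf N (a a' : 'I_N -> 'I_N -> R) :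
  (forall i j : 'I_N, (i < j)%N -> a i j = a' i j) -> Pf a = Pf a'.
Proof.
move=> h; apply: eq_bigr => w /andP[_ /forallP lt_w]; congr (_ * _).
by apply: eq_bigr => i _; rewrite h.
Qed.

Lemma rmorph_Pf (S : comNzRingType) (g : {rmorphism R -> S}) N
    (a : 'I_N -> 'I_N -> R) : g (Pf a) = Pf (fun i j => g (a i j)).
Proof.
rewrite rmorph_sum; apply: eq_bigr => w _.
by rewrite rmorphM rmorph_sign rmorph_prod.
Qed.

Variable T : finType.

Definition ins n (b : 'I_n.+1) (p : T) (f : {ffun 'I_n -> T}) : {ffun 'I_n.+1 -> T} :=
  [ffun i => if unlift b i is Some j then f j else p].

Lemma ins_id n (b : 'I_n.+1) p f : ins b p f b = p.
Proof. by rewrite ffunE unlift_none. Qed.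

Lemma ins_lift n (b : 'I_n.+1) p f i : ins b p f (lift b i) = f i.
Proof. by rewrite ffunE liftK. Qed.

Lemma sum_ins n (b : 'I_n.+1) (G : {ffun 'I_n.+1 -> T} -> R) :
  \sum_f G f = \sum_p \sum_(f : {ffun 'I_n -> T}) G (ins b p f).
Proof.
rewrite pair_big /= (reindex (fun q : T * {ffun 'I_n -> T} => ins b q.1 q.2)) //=.
exists (fun f : {ffun 'I_n.+1 -> T} => (f b, [ffun i => f (lift b i)])) => [[p f] _|f _] /=.
  by rewrite ins_id; congr (_, _); apply/ffunP => i; rewrite ffunE ins_lift.
apply/ffunP => i; case: (unliftP b i) => [j|] ->; first by rewrite ins_lift ffunE.
by rewrite ins_id.
Qed.

Lemma Pf_sum N (v : 'I_N -> T -> R) (A : T -> T -> R) : ~~ odd N ->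
  Pf (fun i j => \sum_p \sum_q v i p * v j q * A p q) =
  \sum_(f : {ffun 'I_N -> T}) (\prod_i v i (f i)) * Pf (fun i j => A (f i) (f j)).
Proof.
have [h Nh] := ubnP N; elim: h N Nh v => // h IH [|[|n]] Nh v Ne //.
  pose f0 : {ffun 'I_0 -> T} := ffun0 (card_ord 0).
  rewrite Pf0 (big_pred1 f0) => [|f]; first by rewrite big_ord0 Pf0 mul1r.
  by apply/esym/eqP/ffunP => -[].
rewrite /= negbK in Ne; rewrite Pf_rec//.
under [RHS]eq_bigr => f _ do rewrite Pf_rec// mulr_sumr.
rewrite [RHS]exchange_big; apply: eq_bigr => b _ /=.
rewrite (IH n)// ?(leq_ltn_trans (leqnSn n))//.
rewrite (sum_ins ord0) -mulrA mulr_suml mulr_sumr; apply: eq_bigr => p _.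
rewrite (sum_ins b) mulr_suml mulr_sumr; apply: eq_bigr => q _.
rewrite !mulr_sumr; apply: eq_bigr => f _.
rewrite big_ord_recl ins_id (bigD1_ord b)//= !ins_lift ins_id.
under [in RHS]eq_bigr => i _ do rewrite !ins_lift.
have -> : Pf (fun i j : 'I_n => A (ins ord0 p (ins b q f) (lift ord0 (lift b i)))
    (ins ord0 p (ins b q f) (lift ord0 (lift b j)))) = Pf (fun i j => A (f i) (f j)).
  by apply: eq_Pf => i j _; rewrite !ins_lift.
move: (Pf _) (\prod_(_ < _) _) ((-1) ^+ b) (v _ p) (v _ q) (A p q) => P V s y z a.
by ring.
Qed.

End PfaffianSums.

(** * Identification of GQ *)

Lemma sum_option (R : nmodType) (T : finType) (G : option T -> R) :
  \sum_p G p = G None + \sum_t G (Some t).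
Proof.
rewrite (bigD1 None)//=; congr (_ + _).
rewrite (reindex_omap Some id) /=; last by case.
by apply: eq_bigl => t; rewrite eqxx.
Qed.

Lemma sum_ffun_some (R : comNzRingType) (T : finType) r
    (G : {ffun 'I_r -> option T} -> R) :
  (forall (f : {ffun 'I_r -> option T}) i, f i = None -> G f = 0) ->
  \sum_f G f = \sum_(g : {ffun 'I_r -> T}) G [ffun i => Some (g i)].
Proof.
elim: r G => [|r IH] G G0.
  rewrite (big_pred1 (ffun0 (card_ord 0))) => [|f]; last first.
    by apply/esym/eqP/ffunP => -[].
  rewrite (big_pred1 (ffun0 (card_ord 0))) => [|f]; last first.
    by apply/esym/eqP/ffunP => -[].
  by congr G; apply/ffunP => -[].
rewrite (sum_ins ord0) (sum_ins ord0) sum_option [X in X + _]big1 ?add0r => [|f _].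
  apply: eq_bigr => t _; rewrite (IH (fun f => G (ins ord0 (Some t) f))).
    apply: eq_bigr => g _; congr G; apply/ffunP => i; rewrite [RHS]ffunE.
    by case: (unliftP ord0 i) => [j|] ->; rewrite ?ins_lift ?ins_id// ffunE.
  by move=> f i fi; apply: (G0 _ (lift ord0 i)); rewrite ins_lift.
by apply: (G0 _ ord0); rewrite ins_id.
Qed.

Section Nodes.
Variables (F : fieldType) (b : F) (x : nat -> F).
Hypothesis two0 : 2 != 0 :> F.
Hypothesis b0 : b != 0.
Hypothesis x0 : forall i, x i != 0.
Hypothesis v0 : forall i, 2 + b * x i != 0.
Hypothesis u0 : forall i, 1 + b * x i != 0.
Hypothesis xx0 : forall i j, oplus b (x i) (x j) != 0.

(* In the coordinate s = b x / (2 + b x) the kernel akl is the Schur kernel;  *)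
(* the extra node -1, used when the number of parts is odd, corresponds to    *)
(* 1 + b x = 0.                                                               *)
Definition node (p : option nat) : F :=
  if p is Some i then b * x i / (2 + b * x i) else -1.

Lemma akl_sker i j : akl b (x i) (x j) = sker (node (Some i)) (node (Some j)).
Proof.
rewrite /akl /sker /node; have := xx0 i j; rewrite /oplus.
move: (v0 i) (v0 j); move: (x i) (x j) => p q h1 h2 h3.
have e : b * q / (2 + b * q) + b * p / (2 + b * p) =
    2 * b * (p + q + b * p * q) / ((2 + b * p) * (2 + b * q)).
  by field; rewrite h1 h2.
by rewrite e; field; rewrite h1 h2 h3 two0 b0.
Qed.

Lemma u_sker i : sker (node (Some i)) (node None) = 1 + b * x i.
Proof.
rewrite /sker /node; move: (v0 i); move: (x i) => p h1.
have -> : -1 + b * p / (2 + b * p) = - 2 / (2 + b * p) by field.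
by field; rewrite h1 oppr_eq0 two0.
Qed.

Lemma node_neq0 p : node p != 0.
Proof.
case: p => [i|] /=; last by rewrite oppr_eq0 oner_eq0.
by rewrite mulf_neq0 ?mulf_neq0 ?invr_eq0 ?b0.
Qed.

Lemma nodeD_neq0 p q : node p + node q != 0.
Proof.
have one i : -1 + b * x i / (2 + b * x i) != 0.
  have -> : -1 + b * x i / (2 + b * x i) = - 2 / (2 + b * x i).
    by move: (v0 i); move: (x i) => y h; field.
  by rewrite mulf_neq0 ?invr_eq0 ?oppr_eq0.
case: p q => [i|] [j|] /=; rewrite ?one// 1?addrC ?one//.
  have -> : b * x j / (2 + b * x j) + b * x i / (2 + b * x i) =
      2 * b * oplus b (x i) (x j) / ((2 + b * x i) * (2 + b * x j)).
    by rewrite /oplus; move: (v0 i) (v0 j); move: (x i) (x j) => y z h1 h2; field; rewrite h1 h2.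
  by rewrite mulf_neq0 ?invr_eq0 ?mulf_neq0.
by rewrite -opprD oppr_eq0.
Qed.

Variables (n : nat) (lambda : seq nat).
Local Notation r := (size lambda).

(** [None] is the extra node. Rows below r are supported on the variables, while the additional row
    present for odd r is supported on [None] alone. *)
Definition weight (N i : nat) (p : option 'I_n) : F :=
  if p is Some k then
    if (i < r)%N then cfact b x n k * bpow b (x k) (nth 0%N lambda i) *
      (1 + b * x k)^-1 ^+ (N - i.+1) else 0
  else (r <= i)%N%:R.

Lemma weight_some N i (k : 'I_n) : (i < r)%N -> weight N i (Some k) =
  cfact b x n k * bpow b (x k) (nth 0%N lambda i) * (1 + b * x k)^-1 ^+ (N - i.+1).
Proof. by rewrite /weight => ->. Qed.

Lemma weight_some_out N i (k : 'I_n) : (r <= i)%N -> weight N i (Some k) = 0.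
Proof. by rewrite /weight ltnNge => ->. Qed.

Lemma weight_none N i : weight N i None = (r <= i)%N%:R.
Proof. by []. Qed.

Definition nodeo (p : option 'I_n) : F := node (omap (@nat_of_ord n) p).

(** [Pf_sum] and [Pf_schur] leave a sum of Schur products over f. If N = r + 1, every row carries
    one power of 1 / u more than [symterm] does; the kernel with the extra node, equal to u by
    [u_sker], cancels it. *)
Lemma Pf_weight (N : nat) : ~~ odd N -> (N == r) || (N == r.+1) ->
  Pf (fun i j : 'I_N =>
    \sum_p \sum_q weight N i p * weight N j q * sker (nodeo p) (nodeo q)) =
  \sum_(f : {ffun 'I_r -> 'I_n}) symterm b x n (fun k => f k).
Proof.
move=> Ne Nr; rewrite (Pf_sum (fun i : 'I_N => weight N i)
  (fun p q => sker (nodeo p) (nodeo q)) Ne).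
rewrite (eq_bigr (fun f : {ffun 'I_N -> option 'I_n} =>
    (\prod_(i < N) weight N i (f i)) * sprod (fun i : 'I_N => nodeo (f i)))); last first.
  move=> f _; congr (_ * _).
  rewrite (Pf_schur (s := fun i : 'I_N => nodeo (f i)))// => [i|i j]; first exact: node_neq0.
  exact: nodeD_neq0.
have wSome N' (k : 'I_r) (i : 'I_n) : weight N' k (Some i) =
    cfact b x n i * bpow b (x i) (nth 0%N lambda k) * (1 + b * x i)^-1 ^+ (N' - k.+1).
  by rewrite weight_some.
have wNone N' (k : 'I_r) : weight N' k None = 0.
  by rewrite weight_none leqNgt ltn_ord.
case/orP: Nr => /eqP NE.
  rewrite NE; rewrite sum_ffun_some; last first.
    move=> f i fi; rewrite (bigD1 i)//= fi wNone.
    by rewrite !mul0r.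
  apply: eq_bigr => g _; rewrite /symterm; congr (_ * _).
    apply: eq_bigr => k _; rewrite ffunE wSome; congr (_ * _ ^+ _).
    by have := ltn_ord k; lia.
  apply: eq_bigr => k _; apply: eq_bigr => l _.
  by rewrite !ffunE akl_sker.
(* Only those f survive that take the value [None] at the last place and nowhere else. *)
rewrite NE (sum_ins ord_max) sum_option [X in _ + X]big1 ?addr0 => [|t _]; last first.
  rewrite big1// => f _; rewrite (bigD1 ord_max)//= ins_id /weight ltnn.
  by rewrite !mul0r.
rewrite sum_ffun_some; last first.
  move=> f i fi.
  have w0 : weight r.+1 (lift ord_max i) (ins ord_max None f (lift ord_max i)) = 0.
    by rewrite ins_lift fi lift_max wNone.
  by rewrite (bigD1 (lift ord_max i))// w0 /= !mul0r.
apply: eq_bigr => g _; rewrite (bigD1_ord ord_max)//= ins_id {1}/weight leqnn mul1r.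
rewrite /sprod (prod_pairsD1 _ ord_max) /symterm mulrA; congr (_ * _).
  rewrite -big_split; apply: eq_bigr => k _ /=.
  have lm : bump r k = k by rewrite /bump leqNgt ltn_ord.
  rewrite ins_lift ffunE ins_id lm ltn_ord wSome.
  rewrite [sker _ _]u_sker.
  have -> : (r.+1 - k.+1 = (r.-1 - k).+1)%N by have := ltn_ord k; lia.
  by rewrite exprSr -!mulrA mulVf// mulr1.
apply: eq_bigr => k _; apply: eq_bigr => l _.
by rewrite !ins_lift !ffunE akl_sker.
Qed.

End Nodes.

Section Identification.

Lemma som_varE n (i : 'I_n) : series_of_mpoly ('X_i : {mpoly K[n]}) = var i.
Proof.
rewrite somX /var; congr mono; apply/msetP => y.
rewrite mset_ofE msetnE; case: eqP => [->|ne].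
  by rewrite (bigD1 i)//= eqxx mnm1E eqxx big1// => j ji;
    rewrite mnm1E; case: eqP => // /val_inj e; rewrite e eqxx in ji.
rewrite big1// => j _; case: eqP => // yj; rewrite mnm1E.
by case: eqP => // ij; case: ne; rewrite yj ij.
Qed.

Lemma som_const n (c : K) : series_of_mpoly (c%:MP : {mpoly K[n]}) = c%:A.
Proof.
rewrite -[c%:MP]mulr1 mul_mpolyC somZ; congr (_ *: _).
exact: (rmorph1 (@series_of_mpoly n)).
Qed.

Lemma fmorph_GQ_term (F F' : fieldType) (g : {rmorphism F -> F'}) be lambda n
    (y : 'I_n -> F) :
  g (GQ_term be lambda y) = GQ_term (g be) lambda (fun i => g (y i)).
Proof.
rewrite /GQ_term rmorphM !rmorph_prod; congr (_ * _).
  apply: eq_bigr => i _; rewrite /bpow; case: (_ == _); rewrite ?rmorph1//.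
  by rewrite rmorphM rmorphXn rmorphD rmorphM rmorph_nat.
apply: eq_bigr => i _; rewrite rmorph_prod; apply: eq_bigr => j _.
by rewrite /oplus /ominus !fmorph_div rmorphB !rmorphD !rmorphM rmorph1.
Qed.

Lemma hfrac_var i : hfrac (xf i).
Proof. exact: hfrac_fin (finite_deg_mono _). Qed.

Lemma hfrac_const c : hfrac (kf c).
Proof. apply: hfrac_fin; apply: finite_degZ; exact: finite_deg1. Qed.

Lemma hfrac_1 : hfrac 1.
Proof. rewrite -tofrac1; apply: hfrac_fin; exact: finite_deg1. Qed.

Lemma hfrac_nat k : hfrac k%:R.
Proof. rewrite -(rmorph_nat kf); exact: hfrac_const. Qed.

Lemma hfracX z k : hfrac z -> hfrac (z ^+ k).
Proof.
move=> hz; elim: k => [|k IH]; first by rewrite expr0; exact: hfrac_1.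
by rewrite exprS; apply: hfracM.
Qed.

Lemma hfrac_subV i j : i != j -> hfrac (xf i - xf j)^-1.
Proof.
move=> ij; rewrite -tofracB; apply: (@hfracV 1).
  move=> m dm; rewrite -[LHS]/(var i m - var j m).
  by rewrite (hdeg_var i dm) (hdeg_var j dm) subr0.
by rewrite subr_eq0; apply: contraNneq ij => /var_inj ->.
Qed.

Lemma hfrac_GQ_term n lambda (w : 'S_n) :
  hfrac (GQ_term (kf beta) lambda (fun i => xf (w i))).
Proof.
rewrite /GQ_term; apply: hfracM; apply: hfrac_prod => i _.
  rewrite /bpow; case: ifP => _; first exact: hfrac_1.
  apply: hfracM; last exact: hfracX (hfrac_var _).
  apply: hfracD; first exact: (hfrac_nat 2).
  by apply: hfracM; [exact: hfrac_const|exact: hfrac_var].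
apply: hfrac_prod => j ij; rewrite -/(pker (kf beta) (xf (w i)) (xf (w j))) pkerE.
apply: hfracM; last first.
  apply: hfrac_subV; rewrite val_eqE (inj_eq perm_inj).
  by apply: contraTneq ij => ->; rewrite ltnn.
have hb k : hfrac (kf beta * xf k).
  by apply: hfracM; [exact: hfrac_const|exact: hfrac_var].
apply: hfracM; apply: hfracD.
- by apply: hfracD; exact: hfrac_var.
- by apply: hfracM; [exact: hb|exact: hfrac_var].
- exact: hfrac_1.
- exact: hb.
Qed.

Lemma fact_Fr_neq0 k : k`!%:R != 0 :> Fr.
Proof. by rewrite -(rmorph_nat kf) fmorph_eq0; exact: factK_neq0. Qed.

Lemma som_frac_GQ_frac lambda n : som_frac (GQ_frac lambda n) =
  ((n - size lambda)`!%:R)^-1 *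
    \sum_(w : 'S_n) GQ_term (kf beta) lambda (fun i => xf (w i)).
Proof.
rewrite /GQ_frac rmorphM fmorphV rmorph_nat; congr (_ * _).
rewrite rmorph_sum; apply: eq_bigr => w _; rewrite fmorph_GQ_term.
have e1 : som_frac (tofrac (beta%:MP : {mpoly K[n]})) = kf beta.
  by rewrite som_frac_tofrac som_const.
have e2 i : som_frac (tofrac ('X_(w i) : {mpoly K[n]})) = xf (w i).
  by rewrite som_frac_tofrac som_varE.
have e3 : (fun i => som_frac (tofrac ('X_(w i) : {mpoly K[n]}))) = (fun i => xf (w i)).
  by apply/funext => i; exact: e2.
transitivity (GQ_term (som_frac (tofrac (beta%:MP : {mpoly K[n]}))) lambda
  (fun i => som_frac (tofrac ('X_(w i) : {mpoly K[n]})))); first by [].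
by rewrite e1 e3.
Qed.

(** By [symmetrize] the fraction [GQ_frac] is the restriction of S to n variables. This restriction
    has bounded degree since it is an [hfrac], so it comes from a polynomial, which is [GQ_fin]. The
    restrictions converge to S, and limits are unique, so both uses of [xget] return the expected
    value. *)
Theorem GQ_eq lambda (S : series) :
  (forall n, (size lambda <= n)%N -> tofrac (res n S) =
    \sum_(f : {ffun 'I_(size lambda) -> 'I_n}) symterm (kf beta) xf n (fun k => f k)) ->
  GQ lambda = S.
Proof.
move=> SE.
have fin n : (size lambda <= n)%N -> series_of_mpoly (GQ_fin lambda n) = res n S.
  move=> rn; have gE : som_frac (GQ_frac lambda n) = tofrac (res n S).
    rewrite som_frac_GQ_frac (SE n rn).
    exact: (symmetrize xf_inj u_neq0 oplus_neq0 rn (fact_Fr_neq0 _)).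
  have [D rD] : finite_deg (res n S).
    apply: hfrac_tofrac; rewrite -gE som_frac_GQ_frac; apply: hfracM.
      rewrite -(rmorph_nat kf) -fmorphV; exact: hfrac_const.
    by apply: hfrac_sum => w _; exact: hfrac_GQ_term.
  have [P PE] := som_finite n D S.
  have PS : series_of_mpoly P = res n S.
    apply/funext => m; rewrite PE; case: (ltnP (degm m) D) => [mD|Dm].
      by rewrite andbT.
    by rewrite andbF (rD m Dm).
  have PG : tofrac P = GQ_frac lambda n.
    apply: (fmorph_inj (@som_frac n)).
    by apply: etrans (som_frac_tofrac P) _; rewrite PS; exact: esym gE.
  rewrite -PS; congr series_of_mpoly; apply: xget_subset1 => // P1 P2 /= h1 h2.
  by apply/eqP; rewrite -tofrac_eq h1 h2.
apply: xget_subset1.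
  move=> m; have [N bm] := bnd_exists m; exists (maxn (size lambda) N) => n.
  by rewrite geq_max => /andP[rn Nn]; rewrite fin// /res (bndW Nn bm).
move=> f g /= hf hg; apply/funext => m; have [N hN] := hf m; have [N' hN'] := hg m.
by rewrite -(hN (maxn N N')) ?leq_maxl// (hN' (maxn N N')) ?leq_maxr.
Qed.

Lemma GQ_onerow a : (0 < a)%N -> GQ [:: a] = onerow a.
Proof.
move=> a0; apply: GQ_eq => n _; rewrite (tofrac_res_onerow _ a0).
rewrite (sum_ins ord0); apply: eq_bigr => i _.
rewrite (big_pred1 (ffun0 (card_ord 0))) => [|f]; last by apply/esym/eqP/ffunP => -[].
rewrite /symterm !big_ord1 big_pred0 => [|l]; last by case: l => -[].
by rewrite !ins_id /= subn0 expr0 !mulr1.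
Qed.

End Identification.

(** * The binomial sums and the entries of the Pfaffian *)

Lemma pser_negbin i p : pser i (fun k => beta ^+ k * binz (- p%:Z) k) = ui i ^+ p.
Proof.
elim: p => [|p IH].
  rewrite expr0 -(pser_delta i); apply: eq_pser => k.
  by rewrite oppr0 (binz_nat 0); case: k => [|k]; rewrite ?mulr1 ?mulr0.
rewrite exprS -IH; apply: mulu_eq; rewrite pser_mulu; apply: eq_pser => -[|k] /=.
  by rewrite mulr0 addr0 !binz0.
rewrite (binzS (- p%:Z)) (_ : - p%:Z - 1 = - p.+1%:Z); last by lia.
by rewrite mulrA -exprS -mulrDr.
Qed.

Lemma flim_negbin i p : flim
  (fun L => \sum_(k < L) kf (beta ^+ k * binz (- p%:Z) k) * xf i ^+ k)
  ((1 + kf beta * xf i)^-1 ^+ p).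
Proof.
rewrite -tofrac_ui -tofracXn -pser_negbin.
apply: (@flim_eq 0 (fun L => tofrac (\sum_(k < L)
   (beta ^+ k * binz (- p%:Z) k) *: var i ^+ k))).
  by move=> L _; rewrite rmorph_sum; apply: eq_bigr => k _; rewrite [LHS]tofracZX.
by apply: (@flim_tofrac _ _ 0) => L _; apply: eqd_sym; exact: pser_eqd.
Qed.

(** The growth of orders leaves finitely many nonzero terms at each monomial, so [ssum] is the
    actual sum and not the default value 0. *)
Lemma ssum_eqd (f : nat -> series) L : (forall k, eqd k (f k) 0) ->
  eqd L (\sum_(k < L) f k) (ssum f).
Proof.
move=> f0 m mL; rewrite /ssum (@fsbig_nat _ (fun k => f k m : K^o) L).
  by elim/big_rec2: _ => [//|k u v _ IH]; rewrite seriesD IH.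
by move=> k Lk; apply: f0; exact: leq_trans Lk.
Qed.

Lemma ssum_eq0 (f : nat -> series) L :
  (forall k, eqd k (f k) 0) -> (forall k, eqd L (f k) 0) -> eqd L (ssum f) 0.
Proof.
move=> f0 fL; apply: (eqd_trans (eqd_sym (@ssum_eqd f L f0))) => m mL.
have e := @eqd_sum L _ (index_enum 'I_L) xpredT _ (fun=> 0) (fun k _ => fL k).
by rewrite e// big1.
Qed.

Section PairSum.
Variables (F : fieldType) (x : nat -> F).

Lemma pair_sum L n (c d P Q : nat -> F) (M : nat -> nat -> F) :
  \sum_(k < L) \sum_(l < L) c k * d l *
    (\sum_(i < n) \sum_(j < n) P i * x i ^+ k * (Q j * x j ^+ l) * M i j) =
  \sum_(i < n) \sum_(j < n) (P i * \sum_(k < L) c k * x i ^+ k) *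
    (Q j * \sum_(l < L) d l * x j ^+ l) * M i j.
Proof.
pose T i j k l := P i * (c k * x i ^+ k) * (Q j * (d l * x j ^+ l)) * M i j.
transitivity (\sum_(k < L) \sum_(l < L) \sum_(i < n) \sum_(j < n) T i j k l).
  apply: eq_bigr => k _; apply: eq_bigr => l _; rewrite mulr_sumr.
  apply: eq_bigr => i _; rewrite mulr_sumr; apply: eq_bigr => j _; rewrite /T.
  by move: (x i ^+ k) (x j ^+ l) (M i j) => y z w; ring.
transitivity (\sum_(i < n) \sum_(j < n) \sum_(k < L) \sum_(l < L) T i j k l).
  under eq_bigr => k _ do rewrite exchange_big /=.
  rewrite exchange_big; apply: eq_bigr => i _ /=.
  under eq_bigr => k _ do rewrite exchange_big /=.
  by rewrite exchange_big.
apply: eq_bigr => i _; apply: eq_bigr => j _.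
rewrite [P i * _]big_distrr [Q j * _]big_distrr big_distrlr /= mulr_suml.
by apply: eq_bigr => k _; rewrite mulr_suml.
Qed.

Lemma bpow_shift b (y : F) a k : (0 < a)%N -> bpow b y (a + k) = bpow b y a * y ^+ k.
Proof. by move=> a0; rewrite /bpow !gtn_eqF ?addn_gt0 ?a0// exprD mulrA. Qed.

Lemma pair_term (c v y d e z s v' e' : F) : v' = v * y -> e' = e * z ->
  c * v * y * (d * e * z) * s = c * v' * (d * e') * s.
Proof. by move=> -> ->; rewrite !mulrA. Qed.

Lemma pair_weight (c v d s w w1 w2 s' : F) :
  w1 = c * (v / w) -> w2 = d -> s = s' -> c * v * d * (s / w) = w1 * w2 * s'.
Proof. by move=> -> -> ->; move: w^-1 => y; ring. Qed.

Lemma single_weight (c v w w1 w2 s : F) :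
  w != 0 -> w1 = c * (v / w) -> w2 = 1 -> s = w -> c * v = w1 * w2 * s.
Proof. by move=> w0 -> -> ->; field. Qed.

End PairSum.

Local Notation uF i := (1 + bF * xf i).

(** Raising the indices by k and l multiplies the (i, j) summand of [tofrac_res_Phi_coef] by x_i^k
    x_j^l, so the double sum factors into two binomial series, u_i^(-p) and u_j^(-q). *)
Lemma tofrac_res_pair n (a b p q : nat) : (0 < a)%N -> (0 < b)%N ->
  tofrac (res n (ssum (fun k => ssum (fun l =>
    (beta ^+ (k + l) * binz (- p%:Z) k * binz (- q%:Z) l) *:
      GQ2 (a + k) (b + l))))) =
  \sum_(i < n) \sum_(j < n) (cfact bF xf n i * bpow bF (xf i) a * (uF i)^-1 ^+ p) *
    (cfact bF xf n j * bpow bF (xf j) b * (uF j)^-1 ^+ q) *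
    (akl bF (xf i) (xf j) / uF i).
Proof.
move=> a0 b0.
pose g k l : series := (beta ^+ (k + l) * binz (- p%:Z) k * binz (- q%:Z) l) *:
      GQ2 (a + k) (b + l).
have g0 k l : eqd (k + l) (g k l) 0.
  move=> m mkl; rewrite /g seriesZ /GQ2 Phi_coef_eq0 ?mulr0//.
  by apply: leq_trans mkl _; lia.
have gl k l : eqd l (g k l) 0 by apply: eqdW (g0 k l); exact: leq_addl.
have gk k l : eqd k (g k l) 0 by apply: eqdW (g0 k l); exact: leq_addr.
have gS L : eqd L (\sum_(k < L) \sum_(l < L) g k l) (ssum (fun k => ssum (g k))).
  have h1 : eqd L (\sum_(k < L) \sum_(l < L) g k l) (\sum_(k < L) ssum (g k)).
    by apply: eqd_sum => k _; apply: ssum_eqd.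
  apply: (eqd_trans h1); apply: ssum_eqd => k.
  by apply: ssum_eq0 => l; [exact: gl|exact: gk].
pose c k := kf (beta ^+ k * binz (- p%:Z) k).
pose d l := kf (beta ^+ l * binz (- q%:Z) l).
apply: (@flim_unique (fun L => tofrac (res n (\sum_(k < L) \sum_(l < L) g k l)))).
  by apply: (@flim_tofrac _ _ 0) => L _; apply: res_eqd; exact: gS.
apply: (@flim_eq 0 (fun L => \sum_(i < n) \sum_(j < n)
    (cfact bF xf n i * bpow bF (xf i) a * \sum_(k < L) c k * xf i ^+ k) *
    (cfact bF xf n j * bpow bF (xf j) b * \sum_(l < L) d l * xf j ^+ l) *
    (akl bF (xf i) (xf j) / uF i))).
  move=> L _; rewrite -(pair_sum xf L n c d
    (fun i => cfact bF xf n i * bpow bF (xf i) a)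
    (fun j => cfact bF xf n j * bpow bF (xf j) b)
    (fun i j => akl bF (xf i) (xf j) / uF i)).
  rewrite tofrac_res_sum; apply: eq_bigr => k _.
  rewrite tofrac_res_sum; apply: eq_bigr => l _.
  rewrite /g resZ tofracZ /c /d -(rmorphM kf); congr (kf _ * _).
    by rewrite exprD mulrACA mulrA.
  rewrite /GQ2 (@tofrac_res_Phi_coef n (a + k) (b + l)) ?addn_gt0 ?a0 ?b0//.
  apply: eq_bigr => i _; apply: eq_bigr => j _.
  exact: pair_term (bpow_shift bF (xf i) k a0) (bpow_shift bF (xf j) l b0).
apply: flim_sum => i _; apply: flim_sum => j _.
apply: flimM; last exact: flim_cst.
by apply: flimM; apply: flimM; try exact: flim_cst; exact: flim_negbin.
Qed.

Lemma tofrac_res_single n (a p : nat) : (0 < a)%N ->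
  tofrac (res n (ssum (fun k => (beta ^+ k * binz (- p%:Z) k) *: GQ [:: (a + k)%N]))) =
  \sum_(i < n) cfact bF xf n i * bpow bF (xf i) a * (uF i)^-1 ^+ p.
Proof.
move=> a0; pose g k : series := (beta ^+ k * binz (- p%:Z) k) *: GQ [:: (a + k)%N].
have g0 k : eqd k (g k) 0.
  move=> m mk; rewrite /g seriesZ GQ_onerow ?addn_gt0 ?a0// onerow_eq0 ?mulr0//.
  by apply: leq_trans mk _; exact: leq_addl.
apply: (@flim_unique (fun L => tofrac (res n (\sum_(k < L) g k)))).
  by apply: (@flim_tofrac _ _ 0) => L _; apply: res_eqd; exact: ssum_eqd.
apply: (@flim_eq 0 (fun L => \sum_(i < n) cfact bF xf n i * bpow bF (xf i) a *
    \sum_(k < L) kf (beta ^+ k * binz (- p%:Z) k) * xf i ^+ k)).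
  move=> L _; rewrite tofrac_res_sum; under eq_bigr => i _ do rewrite mulr_sumr.
  rewrite exchange_big; apply: eq_bigr => k _.
  rewrite /g resZ tofracZ GQ_onerow ?addn_gt0 ?a0// tofrac_res_onerow ?addn_gt0 ?a0//.
  rewrite mulr_sumr; apply: eq_bigr => i _; rewrite bpow_shift//.
  by rewrite !mulrA; congr (_ * _); rewrite mulrC mulrA.
by apply: flim_sum => i _; apply: flimM; [exact: flim_cst|exact: flim_negbin].
Qed.

Lemma two_Fr_neq0 : 2 != 0 :> Fr.
Proof.
have -> : 2 = kf 2 by exact: esym (rmorph_nat kf 2).
by rewrite fmorph_eq0; exact: (natK_neq0 1).
Qed.

Lemma xf_neq0 i : xf i != 0.
Proof. by rewrite tofrac_eq0; exact: mono_neq0. Qed.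

Lemma tofrac_two_add (R : idomainType) (a c : R) :
  tofrac (1 + (1 + a * c)) = 2 + tofrac a * tofrac c.
Proof. by rewrite !tofracD tofrac1 tofracM addrA. Qed.

Lemma v_neq0 i : 2 + bF * xf i != 0.
Proof.
have e : tofrac (1 + (1 + bS * var i)) = 2 + bF * xf i by exact: tofrac_two_add.
rewrite -e; apply: (@tofrac_series_neq0 _ mset0); rewrite !seriesD bSE seriesZ.
rewrite (@var_eqd i mset0) ?degm0// mulr0 addr0 -mono0 /mono eqxx.
exact: (natK_neq0 1).
Qed.

Lemma even_ceil_cases r : (even_ceil r == r) || (even_ceil r == r.+1).
Proof. by rewrite /even_ceil uphalf_half; have := odd_double_half r; case: odd; lia. Qed.

(** The binomial sum in row i gives one power of 1 / u_i less than [weight]. For j < r the missing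
    power is already present in [GQ2]; in the column j = r the surplus of [weight] is cancelled by
    the kernel u_i of the extra node. *)
Lemma tofrac_res_rho n lambda (N := even_ceil (size lambda)) (i j : 'I_N) :
  0%N \notin lambda -> (i < j)%N ->
  tofrac (res n (rho lambda i.+1 j.+1)) =
  \sum_(p : option 'I_n) \sum_(q : option 'I_n) weight bF xf lambda N i p * weight bF xf lambda N j q *
    sker (nodeo bF xf p) (nodeo bF xf q).
Proof.
move=> l0 ij; set r := size lambda in N i j ij *.
have jN : (j < N)%N := ltn_ord j.
have Nr : (N <= r.+1)%N by case/orP: (even_ceil_cases r); rewrite -/N => /eqP ->.
have ir : (i < r)%N by lia.
have pos k : (k < r)%N -> (0 < nth 0%N lambda k)%N.
  by move=> kr; rewrite lt0n; apply: contraNneq l0 => <-; exact: mem_nth.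
have uE k : (uF k)^-1 ^+ (N - i.+1) = (uF k)^-1 ^+ (N - i.+2) * (uF k)^-1.
  by rewrite -exprSr; congr (_ ^+ _); lia.
(* The truncated subtraction is exact, since i < j < N. *)
have e1 : i.+1%:Z + 1 - N%:Z = - (N - i.+2)%N%:Z by lia.
have e2 : j.+1%:Z - N%:Z = - (N - j.+1)%N%:Z by lia.
rewrite sum_option big1 ?add0r => [|q _]; last first.
  by rewrite weight_none leqNgt ir !mul0r.
case: (ltngtP j r) => [jr|jr|jr].
- have -> : rho lambda i.+1 j.+1 = ssum (fun k => ssum (fun l =>
      (beta ^+ (k + l) * binz (i.+1%:Z + 1 - N%:Z) k * binz (j.+1%:Z - N%:Z) l) *:
        GQ2 (nth 0%N lambda i + k) (nth 0%N lambda j + l))).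
    by rewrite /rho eqSS (ltn_eqF jr).
  rewrite e1 e2 tofrac_res_pair ?pos//; apply: eq_bigr => k _.
  rewrite sum_option weight_none leqNgt jr mulr0 mul0r add0r.
  apply: eq_bigr => l _; apply: pair_weight.
  - exact: etrans (weight_some bF xf N k ir) (congr1 (fun z => _ * z) (uE k)).
  - exact: weight_some.
  - exact: akl_sker two_Fr_neq0 (kf_neq0 beta_neq0) v_neq0 oplus_neq0 k l.
- by move: jr jN Nr; lia.
have -> : rho lambda i.+1 j.+1 = ssum (fun k =>
    (beta ^+ k * binz (i.+1%:Z + 1 - N%:Z) k) *: GQ [:: (nth 0%N lambda i + k)%N]).
  by rewrite /rho eqSS jr eqxx.
rewrite e1 tofrac_res_single ?pos//; apply: eq_bigr => k _.
rewrite sum_option big1 ?addr0 => [|q _]; last first.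
  by rewrite (weight_some_out _ _ _ _ (eq_leq (esym jr))) mulr0 mul0r.
apply: (single_weight (u_neq0 k)).
- exact: etrans (weight_some bF xf N k ir) (congr1 (fun z => _ * z) (uE k)).
- by rewrite weight_none (eq_leq (esym jr)).
- exact: u_sker two_Fr_neq0 v_neq0 k.
Qed.

Theorem proposition7p3 (lambda : seq nat) :
  strict_partition lambda ->
  GQ lambda =
  Pf (fun i j : 'I_(even_ceil (size lambda)) => rho lambda i.+1 j.+1).
Proof.
case/andP=> _ l0; apply: GQ_eq => n _.
have [Ne _ _] := even_ceilP (size lambda).
rewrite -(Pf_weight two_Fr_neq0 (kf_neq0 beta_neq0) xf_neq0 v_neq0 u_neq0 oplus_neq0 n
  Ne (even_ceil_cases _)).
rewrite (rmorph_Pf (res n)) (rmorph_Pf (@FracField.tofrac series)).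
by apply: eq_Pf => i j ij; apply: tofrac_res_rho.
Qed.
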